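(* Let $\mathbb F$ be a non-trivial finite field. Let $A$ be a full rank $\ell\times k$ matrix with entries from $\mathbb F$ such that $A$ satisfies the columns condition over $\mathbb F$ and $A$ is irredundant with respect to $\mathbb F^n$ for all sufficiently large $n\in\mathbb N$. Given any integer $r\ge2$, there exist constants $C,c>0$ such that $$\lim_{n\to\infty}\mathbb P\big[\mathbb F^n_p\text{ is }(A,r)\text{-Rado}\big]=\begin{cases}0 & \text{if } p\le c\,|\mathbb F|^{-n/m_{\mathbb F}(A)};\\ 1 & \text{if } p\ge C\,|\mathbb F|^{-n/m_{\mathbb F}(A)}.\end{cases}$$
   Context: $\mathbb F$ acts on $\mathbb F^n$ by scalar multiplication, so for $x=(x_1,\dots,x_k)$ with $x_j\in\mathbb F^n$, $Ax=(\sum_j a_{ij}x_j)_i$. $\mathbb F^n_p$ is the random subset of $\mathbb F^n$ containing each element independently with probability $p$. A subset $S\subseteq\mathbb F^n$ is $(A,r)$-Rado if every $r$-colouring of $S$ yields a monochromatic $x\in S^k$ with pairwise distinct entries and $Ax=0$. $A$ is irredundant with respect to $\mathbb F^n$ if there is a solution to $Ax=0$ in $\mathbb F^n$ with pairwise distinct entries. Full rank means rank (over $\mathbb F$) equal to $\ell$. Columns condition over $\mathbb F$: there is a partition $C_0,\dots,C_m$ of the columns of $A$ such that, with $s_i$ the sum of the columns in $C_i$, $s_0=0$ and each $s_i$ ($1\le i\le m$) is an $\mathbb F$-linear combination of the columns in $C_0\cup\dots\cup C_{i-1}$. With $A_{\overline W}$ the submatrix of columns indexed by $[k]\setminus W$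 (rank $0$ if empty), $m_{\mathbb F}(A):=\max_{W\subseteq[k],|W|\ge2}\frac{|W|-1}{|W|-1+\mathrm{rank}_{\mathbb F}(A_{\overline W})-\mathrm{rank}_{\mathbb F}(A)}$. *)

(* Defs.v *)
From HB Require Import structures.
From mathcomp Require Import all_boot all_order all_algebra.

Set Implicit Arguments.
Unset Strict Implicit.
Unset Printing Implicit Defensive.

Import Order.TTheory GRing.Theory Num.Theory.
Local Open Scope ring_scope.

Section MatrixNotions.
Variables (F : finFieldType) (l k : nat).
Implicit Type A : 'M[F]_(l, k).

Definition is_solution A n (x : 'I_k -> 'rV[F]_n) : bool :=
  [forall i : 'I_l, \sum_(j < k) A i j *: x j == 0].

Definition irredundant A n : Prop :=
  exists x : 'I_k -> 'rV[F]_n, injective x /\ is_solution A x.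

Definition columns_condition A : Prop :=
  exists (m : nat) (C : 'I_m.+1 -> {set 'I_k}),
  [/\ forall i, C i != set0,
      forall i j, i != j -> [disjoint C i & C j],
      \bigcup_i C i = [set: 'I_k],
      \sum_(j in C ord0) col j A = 0 &
      forall i : 'I_m.+1, (0 < i)%N -> exists d : 'I_k -> F,
        \sum_(j in C i) col j A
        = \sum_(j in \bigcup_(h < m.+1 | (h < i)%N) C h) d j *: col j A].

(* A colouring of S is given as the restriction of a colouring of F^n; for
   r > 0 every colouring of S arises in this way. *)
Definition rado A (r n : nat) (S : {set 'rV[F]_n}) : bool :=
  [forall chi : {ffun 'rV[F]_n -> 'I_r},
    [exists x : {ffun 'I_k -> 'rV[F]_n},
      [&& injectiveb x, [forall j, x j \in S], is_solution A x
        & [exists c : 'I_r, [forall j, chi (x j) == c]]]]].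

Definition cols_outside A (W : {set 'I_k}) : 'M[F]_(l, #|~: W|) :=
  colsub (fun j : 'I_#|~: W| => enum_val j) A.

Definition m_ratio (R : realFieldType) A (W : {set 'I_k}) : R :=
  (#|W|%:R - 1)
  / (#|W|%:R - 1 + (\rank (cols_outside A W))%:R - (\rank A)%:R).

(* The initial value is the term for W = [k], so for k >= 2 this is exactly the
   maximum over the W with |W| >= 2. *)
Definition m_F (R : realFieldType) A : R :=
  \big[Num.max/m_ratio R A [set: 'I_k]]_(W : {set 'I_k} | (2 <= #|W|)%N)
    m_ratio R A W.

End MatrixNotions.

(* Probability of the event E for the random subset of T containing each element
   independently with probability p. *)
Definition random_subset_prob (R : realFieldType) (T : finType) (p : R)
    (E : pred {set T}) : R :=
  \sum_(S : {set T} | E S) \prod_(v : T) (if v \in S then p else 1 - p).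

(* Main.v *)
Require Import Defs.
From HB Require Import structures.
From mathcomp Require Import all_boot all_order all_algebra.
From mathcomp Require Import ring lra zify.

Set Implicit Arguments.
Unset Strict Implicit.
Unset Printing Implicit Defensive.

(** The exponent is governed by a set [W] of coordinates of minimal size among those
    attaining the maximum in [m_F]. Writing solutions of [A x = 0] as [x = Q z] with [Q] a
    kernel basis, the rank of the rows of [Q] in [U] is at least
    [1 + (|U| - 1) / m_F], and larger if [1 < |U| < |W|].

    One-statement. The columns condition makes a monochromatic solution appear in the
    vectors with leading coefficient one of any large vector space (Hales-Jewett plus
    pigeonhole); it can be taken of full rank, and averaging over all linear maps into
    [F^n] shows that [r] sets with few solutions leave a positive proportion of [F^n]
    uncovered. A hypergraph container argument then provides, for a colouring without
    monochromatic solutions, small disjoint fingerprints inside the random set that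
    determine such sets covering it; a union bound over fingerprints concludes.

    Zero-statement. If the solutions restricted to [W] that lie in the random set are not
    two-colourable, a minimal non-colourable family contains either a path of length [n] or
    a walk closing up so often that its expected number of occurrences is a negative power
    of [|F|^n] up to polynomial factors in [n]. *)

(** * Minimal non-two-colourable families *)

(** Let [w] be the size of the critical set [W], [d] the rank of its rows, [N] the number of
    vectors, and [eta] the root of order [w - 1] of [N]; the threshold is [eta ^- (d - 1)]. Call the
    [W]-part of a solution an edge. At the threshold the random set has about [N * p], that is
    [eta ^+ (w - d)], elements; an edge glued to old vertices at one point changes an expected count
    only by a constant factor, and an edge glued at exactly two points divides it by
    [eta ^+ (w - d)]. So closing one cycle merely cancels the initial surplus, and a second loss
    must always be found. The minimality of [W] supplies it: the balance inequality is then strict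
    between integers for partial overlaps, so each of them costs at least one factor [eta].

    On the other side, fingerprints have total size at most a constant times the threshold density
    times [N], while each leaves a fixed fraction of the space to be avoided, with probability
    exponentially small in [p * N]. The constant [C] is chosen last, so that the number of
    fingerprints loses against this gain. *)

Section TwoColouring.
Variable V : finType.
Implicit Types (X Y Z e f g : {set V}) (EE : {set {set V}}).

Definition proper_col EE X := [forall e in EE, ~~ (e \subset X) && ~~ (e \subset ~: X)].

Definition colourable EE := [exists X, proper_col EE X].

Lemma proper_colC EE X : proper_col EE X -> proper_col EE (~: X).
Proof. by move=> /forall_inP h; apply/forall_inP => e /h; rewrite setCK andbC. Qed.

(** A proper colouring of the other edges makes [e] monochromatic. Flipping the colour of [v]
    repairs [e], hence spoils another edge, which must contain [v] and otherwise have the opposite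
    colour, so it meets [e] in [v] only. *)
Lemma critical_edge EE e v : (forall e, e \in EE -> 1 < #|e|) ->
  ~~ colourable EE -> colourable (EE :\ e) -> e \in EE -> v \in e ->
  exists2 e', e' \in EE & e :&: e' = [set v].
Proof.
move=> sz ncol col eE ve.
have key X : proper_col (EE :\ e) X -> e \subset X ->
    exists2 e', e' \in EE & e :&: e' = [set v].
  move=> /forall_inP pX eX.
  have /existsPn/(_ (X :\ v)) := ncol; rewrite negb_forall => /existsP[e'].
  rewrite negb_imply negb_and !negbK => /andP[e'E mono].
  have [u ue uv] : exists2 u, u \in e & u != v.
    have /card_gt1P[x [y [xe ye xy]]] := sz e eE.
    have [xv|xv] := eqVneq x v; last by exists x.
    by exists y; rewrite // -xv eq_sym.
  have e'e : e' != e.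
    apply/eqP => ee; move: mono; rewrite ee => /orP[]/subsetP; first by move/(_ v ve); rewrite !inE eqxx.
    by move/(_ u ue); rewrite !inE uv (subsetP eX).
  have /pX/andP[n1 n2] : e' \in EE :\ e by rewrite !inE e'e.
  have {}mono : e' \subset ~: (X :\ v).
    by case/orP: mono => // h; rewrite (subset_trans h) ?subsetDl in n1.
  have ve' : v \in e'.
    apply: contraR n2 => nv; apply/subsetP => x xe'; have := subsetP mono x xe'.
    rewrite !inE; have [xv|//] := eqVneq x v; first by rewrite -xv xe' in nv.
  exists e' => //; apply/setP => x; rewrite !inE; apply/andP/eqP => [[xe xe']|-> //].
  have := subsetP mono x xe'; rewrite !inE (subsetP eX) // andbT negbK => /eqP //.
have /existsP[X pX] := col.
have : ~~ proper_col EE X by move/existsPn: ncol; apply.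
rewrite negb_forall => /existsP[e0]; rewrite negb_imply negb_and !negbK => /andP[e0E mono].
have e0e : e0 = e.
  apply/eqP; apply: contraT => ne; have /forall_inP/(_ e0) := pX.
  by rewrite !inE ne e0E => /(_ isT)/andP[/negPf n1 /negPf n2]; rewrite n1 n2 in mono.
case/orP: mono; rewrite e0e; first exact: key.
by apply: key; exact: proper_colC.
Qed.

Lemma minimal_noncolourable EE : ~~ colourable EE ->
  exists EE', [/\ EE' \subset EE, ~~ colourable EE' &
    forall e, e \in EE' -> colourable (EE' :\ e)].
Proof.
move=> nc; have [EE' /minsetP[nc' min] sub] := @minset_exists _ [pred EE | ~~ colourable EE] EE nc.
exists EE'; split => // e eE; apply: contraT => nce.
have := min _ nce (subsetDl _ _) => /setP/(_ e).
by rewrite !inE eqxx eE.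
Qed.

End TwoColouring.

(** * Walks through a minimal family and their accumulated loss *)

Section Walks.
Variables (V : finType) (EE : {set {set V}}) (w pot : nat) (loss : {set V} -> {set V} -> nat).
Implicit Types (X Y Z e f g : {set V}).

Definition meets_once Y Z e := (#|e :&: Y| == 1) && (e :&: Y \subset Z).

Definition step_ok (m : bool) Y Z e := if m then e :&: Y != set0 else meets_once Y Z e.

(** State of a walk: [Y] holds all vertices met, [Z] those added by the last edge, [c] the total
    loss. The continuation [fin] tests the final state, so that walks can be prolonged inside a
    proof. *)
Fixpoint reach (ms : seq bool) Y Z (c : nat) (fin : {set V} -> {set V} -> nat -> Prop) : Prop :=
  if ms is m :: ms' then
    exists2 e, e \in EE & step_ok m Y Z e /\ reach ms' (e :|: Y) (e :\: Y) (c + loss e Y) fin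
  else fin Y Z c.

Lemma reach_cat ms1 ms2 Y Z c fin :
  reach ms1 Y Z c (fun Y Z c => reach ms2 Y Z c fin) -> reach (ms1 ++ ms2) Y Z c fin.
Proof.
elim: ms1 Y Z c => [//|m ms IH] Y Z c /= [e eE [ok h]]; exists e => //; split => //.
exact: IH.
Qed.

Lemma reach_impl ms Y Z c (fin fin' : {set V} -> {set V} -> nat -> Prop) :
  (forall Y Z c, fin Y Z c -> fin' Y Z c) -> reach ms Y Z c fin -> reach ms Y Z c fin'.
Proof.
move=> imp; elim: ms Y Z c => [|m ms IH] Y Z c /=; first exact: imp.
by move=> [e eE [ok h]]; exists e => //; split => //; exact: IH.
Qed.

Hypotheses (w3 : 3 <= w) (szE : forall e, e \in EE -> #|e| = w) (pot0 : 0 < pot).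
Hypothesis loss_pair : forall e Y, e \in EE -> #|e :&: Y| = 2 -> pot <= loss e Y.
Hypothesis loss_gt0 : forall e Y, e \in EE -> 2 <= #|e :&: Y| < w -> 0 < loss e Y.

(** Strict inequality: a loss of [pot] only balances the surplus a walk starts with. *)
Definition heavy Y Z c := pot < c.

Definition stuck X E := forall e u, e \in EE -> u \in E :\: X -> e :&: (E :|: X) <> [set u].

(** Greedy extension by edges leaving from the newest vertices. In the last alternative the stuck
    edge [E'] is not yet added, so the end of the walk can still be rearranged around it. *)
Lemma longest_path n Y E : E \in EE -> #|E :&: Y| = 1 -> forall c,
  reach (nseq n false) (E :|: Y) (E :\: Y) c (fun _ _ _ => True) \/ stuck Y E \/
  exists2 t, t < n & reach (nseq t false) (E :|: Y) (E :\: Y) c (fun X Z c' => c <= c' /\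
    exists2 E', E' \in EE & [/\ #|E' :&: X| = 1, meets_once X Z E' & stuck X E']).
Proof.
elim: n Y E => [|n IH] Y E EEE EY c; first by left.
have [/exists_inP[e eE me]|/exists_inPn none] := boolP [exists e in EE, meets_once (E :|: Y) (E :\: Y) e]; last first.
  right; left => e u eE uE eu; have /negP[] := none e eE.
  by rewrite /meets_once eu cards1 eqxx sub1set.
have e1 : #|e :&: (E :|: Y)| = 1 by case/andP: me => /eqP.
have [h|[st|[t tn h]]] := IH _ e eE e1 (c + loss e (E :|: Y)).
- by left; exists e.
- by right; right; exists 0 => //; split => //; exists e.
right; right; exists t.+1; rewrite //=; exists e => //; split => //.
apply: reach_impl h => X Z c' [cc' ex]; split => //.
exact: leq_trans (leq_addr _ _) cc'.
Qed.

Hypothesis crit : forall e v, e \in EE -> v \in e -> exists2 e', e' \in EE & e :&: e' = [set v].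

Lemma edge_not_sub e Y : e \in EE -> #|e :&: Y| < w -> ~~ (e \subset Y).
Proof. by move=> eE lt; apply/negP => /setIidPl ee; rewrite ee szE // ltnn in lt. Qed.

Lemma not_sub_lt e Y : e \in EE -> ~~ (e \subset Y) -> #|e :&: Y| < w.
Proof.
move=> eE ns; rewrite -(szE eE) ltn_neqAle subset_leq_card ?subsetIl // andbT.
apply: contra ns => /eqP cE; apply/setIidPl/eqP.
by rewrite eqEcard subsetIl cE leqnn.
Qed.

Lemma meets_gt0 e Y k : #|e :&: Y| = k.+1 -> e :&: Y != set0.
Proof. by move=> h; rewrite -card_gt0 h. Qed.

Lemma reach_light Y Z c : pot <= c -> (exists2 e, e \in EE & 2 <= #|e :&: Y| < w) ->
  reach [:: true] Y Z c heavy.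
Proof.
move=> pc [e eE h]; exists e => //; split.
  by case/andP: h => h _; rewrite /= -card_gt0; apply: leq_trans h.
by have := loss_gt0 eE h; rewrite /= /heavy; lia.
Qed.

Lemma reach2_heavy Y Z c f E : f \in EE -> E \in EE -> 2 <= #|f :&: Y| < w ->
  #|E :&: (f :|: Y)| = 2 -> reach [:: true; true] Y Z c heavy.
Proof.
move=> fE EEE hf hE; exists f => //; split.
  by case/andP: hf => h _; rewrite /= -card_gt0; apply: leq_trans h.
exists E => //; split; first exact: meets_gt0 hE.
by have := loss_gt0 fE hf; have := loss_pair EEE hE; rewrite /= /heavy; lia.
Qed.

(* An edge at which a path gets stuck can also be reached through one of its other
   vertices, so it closes a cycle. *)
Lemma stuck_heavy Y Z c E : pot <= c -> E \in EE -> #|E :&: Y| = 1 -> stuck Y E ->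
  reach [:: true] Y Z c heavy \/ reach [:: true; true] Y Z c heavy.
Proof.
move=> pc EEE EY st.
have [u] : exists u, u \in E :\: Y.
  apply/set0Pn; rewrite setD_eq0 edge_not_sub // EY; lia.
move=> uEY; have [uY uE] : u \notin Y /\ u \in E by move: uEY; rewrite inE => /andP.
have [e eE Ee] := crit EEE uE.
have cU : e :&: (E :|: Y) = u |: (e :&: Y) by rewrite setIUr setIC Ee.
have ct : #|e :&: (E :|: Y)| = #|e :&: Y|.+1.
  by rewrite cU cardsU1 inE (negPf uY) andbF.
have eY : e :&: Y != set0.
  apply/eqP => e0; apply: (st e u eE uEY).
  by rewrite cU e0 setU0.
have [lt|ge] := leqP #|e :&: Y| 1; last first.
  left; apply: reach_light => //; exists e; rewrite // ge /=; apply: not_sub_lt => //.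
  have ue : u \in e by have := set11 u; rewrite -Ee inE => /andP[].
  by apply/negP => /subsetP/(_ u ue); rewrite (negPf uY).
(* Here [e] meets [Y] in one vertex; adding [E] first brings in [u], so that [e] then meets two old
   vertices. *)
right; exists E => //; split; first exact: meets_gt0 EY.
apply: reach_light; first exact: leq_trans (leq_addr _ _).
exists e => //; rewrite ct; have : 0 < #|e :&: Y| by rewrite card_gt0.
lia.
Qed.

(* [a] unrestricted, then [t] cheap, then [b] unrestricted steps; cheap steps leave from
   the new vertices of the previous edge, so that a path costs no polynomial factor. *)
Definition bad_walk n := exists v, exists a t b, [/\ a <= 4, t <= n & b <= 4] /\
  reach (nseq a true ++ nseq t false ++ nseq b true) [set v] [set v] 0
    (fun Y Z c => (t = n /\ b = 0) \/ pot < c).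

Lemma bad_walk_heavy n v a b : a <= 4 -> b <= 4 ->
  reach (nseq a true) [set v] [set v] 0 (fun Y Z c => reach (nseq b true) Y Z c heavy) ->
  bad_walk n.
Proof.
move=> a4 b4 h; exists v, a, 0, b; split => //.
apply: reach_cat; apply: reach_impl h => Y Z c /= h.
by apply: reach_impl h => *; right.
Qed.

Lemma bad_walk_path n v a b t : a <= 4 -> b <= 4 -> t < n ->
  reach (nseq a true) [set v] [set v] 0 (fun Y Z c => reach (nseq t false) Y Z c
    (fun Y Z c => reach (nseq b true) Y Z c heavy)) ->
  bad_walk n.
Proof.
move=> a4 b4 tn h; exists v, a, t, b; split; first by split => //; exact: ltnW.
apply: reach_cat; apply: reach_impl h => Y Z c h; apply: reach_cat.
apply: reach_impl h => Y' Z' c' h.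
by apply: reach_impl h => *; right.
Qed.

Lemma bad_walk_long n v a : a <= 4 ->
  reach (nseq a true) [set v] [set v] 0 (fun Y Z c => reach (nseq n false) Y Z c (fun _ _ _ => True)) ->
  bad_walk n.
Proof.
move=> a4 h; exists v, a, n, 0; split => //.
apply: reach_cat; apply: reach_impl h => Y Z c h; rewrite cats0.
by apply: reach_impl h => *; left.
Qed.

Lemma reach_from f v ms fin : f \in EE -> v \in f ->
  (forall c, reach ms f (f :\: [set v]) c fin) -> reach (true :: ms) [set v] [set v] 0 fin.
Proof.
move=> fE vf h; exists f => //; split.
  by apply/set0Pn; exists v; rewrite !inE vf eqxx.
by have -> : f :|: [set v] = f by apply/setUidPl; rewrite sub1set.
Qed.

(** The edge [g] loses at least 1 and [E] loses at least [pot], which together exceed [pot]. *)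
Lemma triple_heavy n f g E : f \in EE -> g \in EE -> E \in EE ->
  2 <= #|g :&: f| < w -> #|E :&: (g :|: f)| = 2 -> bad_walk n.
Proof.
move=> fE gE EEE hg hE.
have [v vf] : exists v, v \in f by apply/card_gt0P; rewrite (szE fE); lia.
apply: (@bad_walk_heavy n v 1 2) => //; apply: (@reach_from f v) => // c.
exact: reach2_heavy hg hE.
Qed.

Lemma reach_or ms Y Z c (A B : {set V} -> {set V} -> nat -> Prop) :
  reach ms Y Z c (fun Y Z c => A Y Z c \/ B Y Z c) -> reach ms Y Z c A \/ reach ms Y Z c B.
Proof.
elim: ms Y Z c => [//|m ms IH] Y Z c /= [e eE [ok /IH[]h]].
  by left; exists e.
by right; exists e.
Qed.

Lemma reach_const ms Y Z c (P : Prop) : reach ms Y Z c (fun _ _ _ => P) -> P.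
Proof. by elim: ms Y Z c => [//|m ms IH] Y Z c /= [e eE [ok /IH]]. Qed.

Hypothesis ncol : ~~ colourable EE.
Hypothesis mincol : forall e, e \in EE -> colourable (EE :\ e).

(* Three edges in triangle position exhaust the potential exactly; if no further edge
   interferes, the six vertices can be recoloured by hand. *)
Lemma triangle_bad n f g E u u' z : w = 3 -> f \in EE -> g \in EE -> E \in EE ->
  E :&: f = [set u] -> E :&: g = [set u'] -> g :&: f = [set z] -> u != u' -> bad_walk n.
Proof.
move=> w_eq fE gE EEE Ef Eg gf uu'.
have sz3 e : e \in EE -> #|e| = 3 by move=> /szE ->.
have [uE uf] : u \in E /\ u \in f by have := set11 u; rewrite -Ef inE => /andP.
have [u'E u'g] : u' \in E /\ u' \in g by have := set11 u'; rewrite -Eg inE => /andP.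
have [zg zf] : z \in g /\ z \in f by have := set11 z; rewrite -gf inE => /andP.
have inEf x : x \in E -> x \in f -> x = u by move=> h1 h2; apply/set1P; rewrite -Ef inE h1.
have inEg x : x \in E -> x \in g -> x = u' by move=> h1 h2; apply/set1P; rewrite -Eg inE h1.
have zE : z \notin E.
  by apply/negP => zE; case/eqP: uu'; rewrite -(inEf z) // -(inEg z).
have ug : u \notin g by apply/negP => ug; case/eqP: uu'; apply: inEg.
have u'f : u' \notin f by apply/negP => u'f; case/eqP: uu'; rewrite (inEf u').
have [v] : exists v, v \in E :\: [set u; u'].
  apply/set0Pn; rewrite setD_eq0; apply/negP => /subset_leq_card.
  by rewrite (sz3 _ EEE) cards2 uu'.
rewrite !inE negb_or => /andP[/andP[vu vu'] vE].
have vf : v \notin f by apply/negP => vf; case/eqP: vu; apply: inEf.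
have vg : v \notin g by apply/negP => vg; case/eqP: vu'; apply: inEg.
have EgfE : E :&: (g :|: f) = [set u'; u] by rewrite setIUr Ef Eg.
have Egf : #|E :&: (g :|: f)| = 2 by rewrite EgfE cards2 eq_sym uu'.
set Y0 := E :|: (g :|: f).
have cY0 : #|Y0| = 6.
  have := cardsUI g f; rewrite gf cards1 (sz3 _ gE) (sz3 _ fE) addn1 => -[c5].
  by apply/eqP; rewrite -(eqn_add2r 2) -{1}Egf cardsUI (sz3 _ EEE) c5.
(* [T] splits each of [E], [f] and [g]: it contains [u], [v] but not [u'], then [u], [z] but not the
   third vertex of [f], then only [z] of [g]. *)
pose T := [set u; v; z].
have cT : #|T| = 3.
  rewrite /T -setUA !cardsU1 cards1 !inE negb_or eq_sym vu.
  by have -> : u != z; [apply: contraNneq zE => <-|have -> : v != z by apply: contraNneq zE => <-].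
have TY0 : T \subset Y0.
  by apply/subsetP => x; rewrite !inE => /orP[/orP[]|] /eqP ->; rewrite ?uE ?vE ?zg ?orbT.
have start a fin : (forall Z c, pot <= c -> reach (nseq a true) Y0 Z c fin) ->
    reach (nseq a.+3 true) [set z] [set z] 0 fin.
  move=> h; apply: (@reach_from f z) => // c.
  exists g => //; split; first by apply: (@meets_gt0 _ _ 0); rewrite gf cards1.
  exists E => //; split; first exact: (@meets_gt0 _ _ 1).
  by apply: h; apply: leq_trans (leq_addl _ _); apply: loss_pair.
have [/exists_inP[e eE h]|/exists_inPn n2] := boolP [exists e in EE, 2 <= #|e :&: Y0| < w].
  apply: (@bad_walk_heavy n z 3 1) => //; apply: start => Z c pc /=.
  by apply: reach_light => //; exists e.
have [/exists_inP[e eE /eqP h]|/exists_inPn n1] := boolP [exists e in EE, #|e :&: Y0| == 1].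
  have e0 : e :&: Y0 != set0 := meets_gt0 h.
  have : reach (nseq 3 true) [set z] [set z] 0 (fun Y Z c =>
      (reach [:: true] Y Z c (fun Y Z c => reach (nseq n false) Y Z c (fun _ _ _ => True)) \/
       (reach [:: true] Y Z c heavy \/ reach [:: true; true] Y Z c heavy)) \/
      exists2 t, t < n & reach [:: true] Y Z c (fun Y Z c => reach (nseq t false) Y Z c
        (fun Y Z c => reach [:: true] Y Z c heavy \/ reach [:: true; true] Y Z c heavy))).
    apply: (start 0) => Z c pc.
    have [l|[st|[t tn l]]] := longest_path n eE h (c + loss e Y0).
    - by left; left; exists e.
    - by left; right; apply: stuck_heavy st.
    right; exists t => //; exists e => //; split => //=.
    apply: reach_impl l => X Z' c' [cc' [E' E'E [E'X _ st]]].
    by apply: stuck_heavy st => //; apply: leq_trans cc'; rewrite (leq_trans pc) ?leq_addr.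
  case/reach_or => [/reach_or[l|/reach_or[l|l]]|l].
  - by apply: (@bad_walk_long n z 4) => //; apply: (@reach_cat (nseq 3 true) [:: true]).
  - exact: (@bad_walk_heavy n z 3 1).
  - exact: (@bad_walk_heavy n z 3 2).
  have [t tn l'] : exists2 t, t < n & reach (nseq 4 true) [set z] [set z] 0
      (fun Y Z c => reach (nseq t false) Y Z c
        (fun Y Z c => reach [:: true] Y Z c heavy \/ reach [:: true; true] Y Z c heavy)).
    case: l => e1 ? [? [e2 ? [? [e3 ? [? [t tn l]]]]]]; exists t => //.
    apply: (@reach_cat (nseq 3 true) [:: true]).
    by exists e1 => //; split => //; exists e2 => //; split => //; exists e3.
  have : reach (nseq 4 true) [set z] [set z] 0
      (fun Y Z c => reach (nseq t false) Y Z c (fun Y Z c => reach [:: true] Y Z c heavy) \/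
        reach (nseq t false) Y Z c (fun Y Z c => reach [:: true; true] Y Z c heavy)).
    by apply: reach_impl l' => ? ? ? /reach_or.
  case/reach_or => l2.
    exact: (@bad_walk_path n z 4 1 t).
  exact: (@bad_walk_path n z 4 2 t).
have dich e : e \in EE -> #|e :&: Y0| = 0 \/ e \subset Y0.
  move=> eE; have := n2 e eE; have := n1 e eE.
  have [sub|ns] := boolP (e \subset Y0); first by right.
  by have := not_sub_lt eE ns; rewrite w_eq; case: #|e :&: Y0| => [|[|[|]]] //; left.
(* Every edge now lies inside [Y0] or avoids it. Recolouring [Y0] by [T] preserves the edges
   outside, so a monochromatic edge is [T] or its complement in [Y0]. *)
have /existsP[X /forall_inP pX] := mincol EEE.
have /existsPn/(_ ((X :\: Y0) :|: T)) := ncol.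
rewrite negb_forall => /existsP[e]; rewrite negb_imply negb_and !negbK => /andP[eE mono].
case: (dich e eE) => [/eqP|eY0].
  rewrite cards_eq0 => /eqP eY0.
  have eY x : x \in e -> x \notin Y0.
    by move=> xe; apply/negP => xY; have := in_set0 x; rewrite -eY0 inE xe xY.
  have /pX/andP[n3 n4] : e \in EE :\ E.
    rewrite !inE eE andbT; apply/eqP => eEq; have := eY u; rewrite eEq => /(_ uE).
    by rewrite !inE uE.
  have nT x : x \in e -> x \notin T by move=> /eY; apply: contra => /(subsetP TY0).
  case/orP: mono => /subsetP mono.
    case/negP: n3; apply/subsetP => x xe; have := mono x xe.
    by rewrite in_setU (negPf (nT x xe)) orbF in_setD => /andP[].
  case/negP: n4; apply/subsetP => x xe; have := mono x xe.
  by rewrite !in_setC in_setU in_setD (negPf (eY x xe)) /= negb_or => /andP[].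
case/orP: mono => mono.
  have eT : e = T.
    apply/eqP; rewrite eqEcard cT (sz3 _ eE) leqnn andbT; apply/subsetP => x xe.
    have := subsetP mono x xe; rewrite in_setU => /orP[|//].
    by rewrite in_setD (subsetP eY0 x xe).
  have TE : T :&: E = [set u; v].
    apply/setP => x; rewrite !inE; have [->|xu] := eqVneq x u; first by rewrite uE.
    have [->|xv] := eqVneq x v; first by rewrite vE.
    by have [->|] := eqVneq x z; rewrite ?(negPf zE).
  have fTE : f :&: (T :|: E) = [set u; z].
    apply/setP => x; rewrite !inE; have [->|xu] /= := eqVneq x u; first by rewrite uf.
    have [->|xv] /= := eqVneq x v.
      by rewrite (negPf vf) /=; apply/esym/negbTE; apply: contraNneq vf => ->.
    have [->|xz] /= := eqVneq x z; first by rewrite zf.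
    by apply/negP => /andP[xf /inEf/(_ xf)]; apply/eqP.
  apply: (@triple_heavy n E T f) => //; rewrite -?eT //.
    by rewrite eT TE cards2 eq_sym vu w_eq.
  rewrite eT fTE cards2; suff -> : u != z by [].
  by apply: contraNneq zE => <-.
have eT : e = Y0 :\: T.
  apply/eqP; rewrite eqEcard cardsD (setIidPr TY0) cY0 cT (sz3 _ eE) leqnn andbT.
  apply/subsetP => x xe; rewrite inE (subsetP eY0 x xe) andbT.
  by have := subsetP mono x xe; rewrite !inE negb_or => /andP[].
have eg : e :&: g = g :\ z.
  apply/setP => x; rewrite eT !inE; have [xg|] := boolP (x \in g); last by rewrite !andbF.
  rewrite !orbT /= !andbT !negb_or.
  have -> : x != u by apply: contraTneq xg => ->.
  by have -> : x != v by apply: contraTneq xg => ->.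
have feg : f :&: (e :|: g) = f :\ u.
  apply/setP => x; rewrite eT !inE andbC; have [xf|] := boolP (x \in f); last by rewrite !andbF.
  rewrite !orbT !andbT; have [->|xu] /= := eqVneq x u; first by rewrite (negPf ug).
  have [->|xz] /= := eqVneq x z; first by rewrite zg orbT.
  have xv : (x == v) = false by apply/negbTE; apply: contraTneq xf => ->.
  by rewrite xv.
apply: (@triple_heavy n g e f) => //.
  by rewrite eg; have := cardsD1 z g; rewrite zg (sz3 _ gE) w_eq add1n => -[<-].
by rewrite feg; have := cardsD1 u f; rewrite uf (sz3 _ fE) add1n => -[<-].
Qed.

(** Unlike [stuck_heavy], no loss has been accumulated yet. Two new vertices [u], [u'] of [E] give
    edges [f], [g] through them that both return to [X]: one return uses up [pot], the other adds
    the missing loss, unless [g] is already covered by the rest. *)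
Lemma stuck_bad n X Z c E : E \in EE -> #|E :&: X| = 1 -> stuck X E ->
  bad_walk n \/ (reach [:: true; true] X Z c heavy \/ reach [:: true; true; true] X Z c heavy).
Proof.
move=> EEE EX1 st; have /cards1P[v EX] : #|E :&: X| == 1 by apply/eqP.
have cEX : #|E :\: X| = w.-1 by have := cardsID X E; rewrite EX1 (szE EEE) add1n => <-.
have /card_gt1P[u [u' [uD u'D uu']]] : 1 < #|E :\: X| by rewrite cEX -ltnS prednK // (leq_trans _ w3).
have [uX uE] : u \notin X /\ u \in E by move: uD; rewrite inE => /andP.
have [u'X u'E] : u' \notin X /\ u' \in E by move: u'D; rewrite inE => /andP.
have [f fE Ef] := crit EEE uE; have [g gE Eg] := crit EEE u'E.
have uf : u \in f by have := set11 u; rewrite -Ef inE => /andP[].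
have u'g : u' \in g by have := set11 u'; rewrite -Eg inE => /andP[].
have u'f : u' \notin f.
  apply/negP => u'f; have : u' \in E :&: f by rewrite inE u'E.
  by rewrite Ef inE eq_sym (negPf uu').
have caseA x e : x \in E :\: X -> e \in EE -> E :&: e = [set x] ->
    (#|e :&: X| = 1 /\ #|e :&: (E :|: X)| = 2) \/ reach [:: true; true] X Z c heavy.
  move=> xD eE Ee; have [xX xE] : x \notin X /\ x \in E by move: xD; rewrite inE => /andP.
  have xe : x \in e by have := set11 x; rewrite -Ee inE => /andP[].
  have eU : e :&: (E :|: X) = x |: (e :&: X) by rewrite setIUr setIC Ee.
  have eX0 : 0 < #|e :&: X|.
    rewrite card_gt0; apply/eqP => e0; apply: (st e x eE xD); by rewrite eU e0 setU0.
  have [le1|gt1] := leqP #|e :&: X| 1.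
    have c1 : #|e :&: X| = 1 by apply/eqP; rewrite eqn_leq le1.
    by left; rewrite eU cardsU1 !inE (negPf xX) andbF c1.
  have vX : v \in X by have := set11 v; rewrite -EX inE => /andP[].
  right; apply: (reach2_heavy _ _ eE EEE); rewrite ?gt1 /=.
    by apply: not_sub_lt => //; apply/negP => /subsetP/(_ x xe); rewrite (negPf xX).
  rewrite setIUr Ee EX cards2; suff -> : x != v by [].
  by apply: contraNneq xX => ->.
case: (caseA u f uD fE Ef) => [[f1 f2]|]; last by right; left.
case: (caseA u' g u'D gE Eg) => [[g1 g2]|]; last by right; left.
(* If [g] has a vertex outside, it still loses after [E] and [f]. Otherwise all but two of its
   vertices lie in [f], and the walk is restarted from [f], [g], [E] alone. *)
have [gsub|gnsub] := boolP (g \subset f :|: (E :|: X)); last first.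
  right; right; exists E => //; split; first exact: meets_gt0 EX1.
  exists f => //; split; first exact: meets_gt0 f2.
  apply: reach_light; first by apply: leq_trans (leq_addl _ _); apply: loss_pair.
  exists g => //; rewrite not_sub_lt // andbT -g2.
  by apply: subset_leq_card; apply: setIS; apply: subsetUr.
have u'gf : u' \notin g :&: f by rewrite inE (negPf u'f) andbF.
have gfw : #|g :&: f| < w.
  by apply: not_sub_lt => //; apply/negP => /subsetP/(_ u' u'g); rewrite (negPf u'f).
have gfge : w - 2 <= #|g :&: f|.
  have := cardsID (E :|: X) g; rewrite g2 (szE gE) => cg.
  have -> : w - 2 = #|g :\: (E :|: X)| by rewrite -cg addKn.
  apply: subset_leq_card; apply/subsetP => x; rewrite inE => /andP[nx xg].
  by have := subsetP gsub x xg; rewrite in_setU (negPf nx) orbF inE xg.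
left; have [ge2|lt2] := leqP 2 #|g :&: f|.
  apply: (@triple_heavy n f g E) => //; first by rewrite ge2.
  by rewrite setIUr Ef Eg cards2 eq_sym uu'.
have w_eq : w = 3.
  have : w - 2 <= 1 by apply: leq_trans gfge _.
  by rewrite leq_subLR => w_le; apply/eqP; rewrite eqn_leq w3 w_le.
have /cards1P[z gf] : #|g :&: f| == 1.
  by rewrite eqn_leq -ltnS lt2; apply: leq_trans gfge; rewrite w_eq.
exact: (@triangle_bad n f g E u u' z).
Qed.

(** A path from any vertex either lasts [n] steps or gets stuck, and a stuck end yields a heavy walk
    with boundedly many unrestricted steps. *)
Theorem noncolourable_bad_walk n : bad_walk n.
Proof.
have [E EEE] : exists E, E \in EE.
  apply/set0Pn; apply: contraNneq ncol => E0; apply/existsP; exists set0.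
  by apply/forall_inP => e; rewrite E0 inE.
have [v vE] : exists v, v \in E by apply/card_gt0P; rewrite (szE EEE) (leq_trans _ w3).
have Ev : E :&: [set v] = [set v] by apply/setIidPr; rewrite sub1set.
have Ev1 : #|E :&: [set v]| = 1 by rewrite Ev cards1.
have [l|[st|[t tn l]]] := longest_path n EEE Ev1 (0 + loss E [set v]).
- apply: (@bad_walk_long n v 1) => //; exists E => //; split => //.
  exact: meets_gt0 Ev1.
- have [//|[h|h]] := stuck_bad n [set v] 0 EEE Ev1 st.
    exact: (@bad_walk_heavy n v 0 2).
  exact: (@bad_walk_heavy n v 0 3).
have : reach (nseq t false) (E :|: [set v]) (E :\: [set v]) (0 + loss E [set v])
    (fun X Z c => bad_walk n \/ (reach [:: true; true] X Z c heavy \/ reach [:: true; true; true] X Z c heavy)).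
  by apply: reach_impl l => X Z c [_ [E' E'E [E'X _ st]]]; exact: stuck_bad E'E E'X st.
have Ev0 : E :&: [set v] != set0 := meets_gt0 Ev1.
case/reach_or => [/reach_const //|/reach_or[] h].
  by apply: (@bad_walk_path n v 1 2 t) => //; exists E.
by apply: (@bad_walk_path n v 1 3 t) => //; exists E.
Qed.

End Walks.

Import Order.TTheory GRing.Theory Num.Theory.
Local Open Scope ring_scope.

(** * Ramsey theorems for vector spaces *)

Section HalesJewett.
Variable A : finType.
Implicit Types (I J K : finType) (s : seq A).

(* A template is a word whose [None] letters are the active coordinates of a combinatorial line. *)
Definition line_point I (f : {ffun I -> option A}) (a : A) : {ffun I -> A} :=
  [ffun i => odflt a (f i)].

Definition active I (f : {ffun I -> option A}) := [exists i, f i == None].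

(** Only letters of [s] have to agree. Words keep the full alphabet, so the induction can run over
    [s] without changing the type of words. *)
Definition mono_on I K (C : {ffun I -> A} -> K) s (f : {ffun I -> option A}) :=
  forall a b, a \in s -> b \in s -> C (line_point f a) = C (line_point f b).

Definition join_word (T : Type) I J (u : {ffun I -> T}) (v : {ffun J -> T}) :
    {ffun I + J -> T} :=
  [ffun i => match i with inl i => u i | inr j => v j end].

Definition const_word I (v : {ffun I -> A}) : {ffun I -> option A} :=
  [ffun i => Some (v i)].

Lemma line_point_join I J (f : {ffun I -> option A}) (g : {ffun J -> option A}) a :
  line_point (join_word f g) a = join_word (line_point f a) (line_point g a).
Proof. by apply/ffunP => -[i|j]; rewrite !ffunE. Qed.

Lemma line_point_const I (v : {ffun I -> A}) a : line_point (const_word v) a = v.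
Proof. by apply/ffunP => i; rewrite !ffunE. Qed.

Lemma active_joinl I J (f : {ffun I -> option A}) (g : {ffun J -> option A}) :
  active f -> active (join_word f g).
Proof. by move=> /existsP[i fi]; apply/existsP; exists (inl i); rewrite ffunE. Qed.

Lemma active_joinr I J (f : {ffun I -> option A}) (g : {ffun J -> option A}) :
  active g -> active (join_word f g).
Proof. by move=> /existsP[i fi]; apply/existsP; exists (inr i); rewrite ffunE. Qed.

Definition focused I K (C : {ffun I -> A} -> K) (x a0 : A) s (n : nat) :=
  exists (ls : seq {ffun I -> option A}) (p : {ffun I -> A}),
    [/\ size ls = n, forall l, l \in ls -> active l /\ mono_on C s l,
        forall l, l \in ls -> line_point l x = p &
        uniq [seq C (line_point l a0) | l <- ls]].

(* Colour focusing: the lines agree at [x] and carry distinct colours on [s]. *)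
Lemma focus_step (x a0 : A) s (K : finType) (n : nat) : a0 \in s ->
  (forall K' : finType, exists I : finType, forall C : {ffun I -> A} -> K',
     exists2 f, active f & mono_on C s f) ->
  (exists I : finType, forall C : {ffun I -> A} -> K,
     (exists2 f, active f & mono_on C (x :: s) f) \/ focused C x a0 s n) ->
  exists I : finType, forall C : {ffun I -> A} -> K,
     (exists2 f, active f & mono_on C (x :: s) f) \/ focused C x a0 s n.+1.
Proof.
move=> a0s HJs [I HI].
have [J HJ] := HJs {ffun {ffun I -> A} -> K}.
exists (I + J)%type => C.
(* A word on [J] is coloured by the whole colouring it induces on words over [I]; along [l'] this
   induced colouring is constant for letters in [s]. *)
pose C' (v : {ffun J -> A}) := [ffun u : {ffun I -> A} => C (join_word u v)].
have [l' l'act l'mono] := HJ C'.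
pose C'' u := C (join_word u (line_point l' a0)).
have C''E a u : a \in s -> C (join_word u (line_point l' a)) = C'' u.
  by move=> /l'mono/(_ a0s)/ffunP/(_ u); rewrite !ffunE.
have monoC'' l : active l -> mono_on C'' (x :: s) l ->
    exists2 f, active f & mono_on C (x :: s) f.
  move=> lact lmono; exists (join_word l (const_word (line_point l' a0))).
    exact: active_joinl.
  by move=> a b ha hb; rewrite !line_point_join !line_point_const; exact: lmono.
have [[l lact lmono]|[ls [p [szls lsP lsx lsu]]]] := HI C''; first by left; apply: (monoC'' l).
(* If the focus already has the colour of one of the lines, that line is monochromatic on [x :: s]
   as well. *)
have [pin|pnin] := boolP (C'' p \in [seq C'' (line_point l a0) | l <- ls]).
  case/mapP: pin => l lin pE; have [lact lm] := lsP _ lin; left.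
  apply: (monoC'' l) => // a b.
  have key c : c \in x :: s -> C'' (line_point l c) = C'' p.
    rewrite inE => /predU1P[->|cs]; first by rewrite lsx.
    by rewrite pE; exact: lm.
  by move=> /key-> /key->.
right; exists (join_word (const_word p) l' :: [seq join_word l l' | l <- ls]).
exists (join_word p (line_point l' x)); split.
- by rewrite /= size_map szls.
- move=> l; rewrite inE => /predU1P[->|/mapP[l0 l0in ->]]; split.
  + exact: active_joinr.
  + by move=> a b ha hb; rewrite !line_point_join !line_point_const !C''E.
  + exact: active_joinr.
  + move=> a b ha hb; rewrite !line_point_join !C''E //.
    by have [_] := lsP _ l0in; exact.
- move=> l; rewrite inE => /predU1P[->|/mapP[l0 l0in ->]]; rewrite line_point_join.
    by rewrite line_point_const.
  by rewrite lsx.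
- rewrite /= -map_comp line_point_join line_point_const C''E //.
  rewrite (eq_map (g := fun l => C'' (line_point l a0))) ?pnin //.
  by move=> l /=; rewrite line_point_join C''E.
Qed.

Lemma Hales_Jewett s (K : finType) : s != [::] ->
  exists I : finType, forall C : {ffun I -> A} -> K,
     exists2 f, active f & mono_on C s f.
Proof.
case: s => // x s _; elim: s x K => [|y s IHs] x K.
  exists unit => C; exists [ffun => None]; first by apply/existsP; exists tt; rewrite ffunE.
  by move=> a b; rewrite !inE => /eqP-> /eqP->.
have foc n : exists I : finType, forall C : {ffun I -> A} -> K,
     (exists2 f, active f & mono_on C (x :: y :: s) f) \/ focused C x y (y :: s) n.
  elim: n => [|n IHn]; last by apply: focus_step => //; rewrite mem_head.
  exists unit => C; right; exists [::], [ffun => x]; split=> //.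
(* More focused lines with distinct colours than there are colours is impossible. *)
have [I HI] := foc #|K|.+1; exists I => C.
have [//|[ls [p [szls _ _ uls]]]] := HI C.
have := max_card [in [seq C (line_point l y) | l <- ls]].
by rewrite (card_uniqP uls) size_map szls ltnn.
Qed.

End HalesJewett.

(** * Monochromatic affine subspaces and leading coefficients *)

Section VectorRamsey.
Variable F : finFieldType.

(** Hales-Jewett with the vectors of [F^t] as letters: the points of a combinatorial line form an
    affine [t]-space, with [u] marking the active coordinates. *)
Lemma mono_affine_subspace (K : finType) (t : nat) : exists n, forall chi : 'rV[F]_n -> K,
  exists (y0 : 'rV_n) (M : 'M_(t, n)), row_free M /\ forall v v', chi (y0 + v *m M) = chi (y0 + v' *m M).
Proof.
have [|I HI] := @Hales_Jewett 'rV[F]_t (enum 'rV[F]_t) K.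
  by apply/eqP => e0; have := mem_enum 'rV[F]_t 0; rewrite e0.
exists (#|I| * t)%N => chi.
pose wd (w : {ffun I -> 'rV[F]_t}) : 'rV_(#|I| * t) := mxvec (\matrix_i w (enum_val i)).
have [f /existsP[i0 /eqP fi0] fmono] := HI (fun w => chi (wd w)).
pose u : 'cV[F]_#|I| := \col_i (f (enum_val i) == None)%:R.
pose g (v : 'rV[F]_t) := mxvec (u *m v).
have glin : linear g by move=> a x y; rewrite /g mulmxDr -scalemxAr linearP.
pose gL := GRing.isLinear.Build F _ _ _ g glin.
pose gl : {linear 'rV[F]_t -> 'rV[F]_(#|I| * t)} := HB.pack g gL.
exists (wd (line_point f 0)), (lin1_mx gl); split.
  apply/row_freeP; apply/row_freeP; rewrite -kermx_eq0; apply/rowV0P => v /sub_kermxP.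
  rewrite mul_rV_lin1 /= /g => /(canRL mxvecK); rewrite linear0 => uv0.
  apply/rowP => j; have /matrixP/(_ (enum_rank i0) j) := uv0.
  by rewrite !mxE big_ord1 !mxE enum_rankK fi0 mul1r.
have key v : wd (line_point f 0) + v *m lin1_mx gl = wd (line_point f v).
  rewrite mul_rV_lin1 /= /g /wd -linearD; congr mxvec.
  apply/matrixP => i j; rewrite !mxE big_ord1 !mxE !ffunE.
  by case: (f (enum_val i)) => [c|] /=; rewrite ?mul0r ?addr0 // !mxE mul1r add0r.
by move=> v v'; rewrite !key; apply: fmono; rewrite mem_enum.
Qed.

Definition leading_one s (a : 'rV[F]_s) (i : 'I_s) :=
  (forall j : 'I_s, (j < i)%N -> a 0 j = 0) /\ a 0 i = 1.

(** Induction on [s]: in the layer with first coordinate 1 take a monochromatic affine subspace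
    [y0 + M], then recurse on its direction space in the layer with first coordinate 0. Vectors with
    leading position 0 stay in the affine subspace. *)
Lemma leading_colour (K : finType) (s : nat) : exists n, forall chi : 'rV[F]_n -> K,
  exists (Y : 'M_(s, n)), row_free Y /\
    forall i, exists c, forall a, leading_one a i -> chi (a *m Y) = c.
Proof.
elim: s => [|s [n IHs]].
  exists 0%N => chi; exists 0; split; last by case.
  by rewrite /row_free mxrank0.
have [n' Hn'] := mono_affine_subspace K n.
exists (1 + n')%N => chi.
have [y0 [M [Mfree Mc]]] := Hn' (fun y => chi (row_mx 1 y)).
have [Y [Yfree Yc]] := IHs (fun y => chi (row_mx 0 (y *m M))).
pose YY : 'M[F]_(1 + s, 1 + n') := block_mx 1 y0 0 (Y *m M).
have YYE (a : 'rV_(1 + s)) : a *m YY = row_mx (lsubmx a) (lsubmx a *m y0 + rsubmx a *m Y *m M).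
  by rewrite -[in LHS](hsubmxK a) /YY mul_row_block mulmx1 mulmx0 addr0 mulmxA.
exists YY; split.
  rewrite -kermx_eq0; apply/rowV0P => v /sub_kermxP; rewrite YYE => e0.
  have [vl vr] := eq_row_mx (etrans e0 (esym (row_mx0 _ _ _ _))).
  rewrite -(@hsubmxK _ 1 1 s v) vl; move: vr; rewrite vl mul0mx add0r => /eqP.
  rewrite (mulmx_free_eq0 _ Mfree) (mulmx_free_eq0 _ Yfree) => /eqP->.
  by rewrite row_mx0.
move=> i; have [i0|i0] := posnP i.
  exists (chi (row_mx 1 (y0 + 0 *m M))) => a0 [_]; move: (a0 : 'rV_(1 + s)) => a a1.
  have -> : a *m YY = row_mx 1 (y0 + rsubmx a *m Y *m M).
    rewrite YYE; have -> : lsubmx a = 1; last by rewrite mul1mx.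
    apply/rowP => j; rewrite !ord1 !mxE -a1; congr (a 0 _); apply: val_inj => /=.
    by rewrite i0.
  exact: Mc.
have ltis : (i.-1 < s)%N by have := ltn_ord i; case: (val i) i0.
have [c Hc] := Yc (Ordinal ltis); exists c => a' []; move: (a' : 'rV_(1 + s)) => a a0 a1.
have la0 : lsubmx a = 0.
  apply/rowP => j; rewrite !ord1 mxE [RHS]mxE; apply: a0 => //=.
rewrite YYE la0 mul0mx add0r; apply: Hc; split.
  by move=> j lj; rewrite mxE; apply: a0; rewrite /= add1n -ltn_predRL.
rewrite mxE -[RHS]a1; congr (a 0 _); apply: val_inj => /=.
by rewrite add1n prednK.
Qed.

End VectorRamsey.

Section MonochromaticSubspace.
Variable F : finFieldType.

Lemma increasing_selection n (B : {set 'I_n}) s : (s <= #|B|)%N ->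
  exists f : 'I_s -> 'I_n, (forall i j : 'I_s, (i < j)%N -> (f i < f j)%N) /\ forall i, f i \in B.
Proof.
move=> sB; case: s sB => [|s] sB; first by exists (fun i : 'I_0 => match i with Ordinal m h => False_rect _ (notF h) end); split; case.
have [x0 x0B] : exists x0, x0 \in B by apply/card_gt0P; apply: leq_trans sB.
have lt_s (i : 'I_s.+1) : (i < size (enum B))%N by rewrite -cardE (leq_trans _ sB).
have srt : sorted (fun i j : 'I_n => (i < j)%N) (enum B).
  rewrite /enum_mem; apply: sorted_filter; first by move=> ? ? ?; apply: ltn_trans.
  by rewrite -enumT; have := iota_ltn_sorted 0 n; rewrite -val_enum_ord sorted_map.
exists (fun i => nth x0 (enum B) i); split => [i j ij|i]; last by rewrite -mem_enum mem_nth.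
by apply: (sorted_ltn_nth _ x0 srt) => //; [move=> ? ? ?; apply: ltn_trans | rewrite inE..].
Qed.

Lemma pigeonhole (I K : finType) s (g : I -> K) : (#|K| * s < #|I|)%N ->
  exists c, (s <= #|[set i | g i == c]|)%N.
Proof.
move=> lt; apply/existsP; apply: contraTT lt => /existsPn small; rewrite -leqNgt.
rewrite -sum1_card (partition_big g predT) //= -sum_nat_const.
apply: leq_sum => c _; rewrite sum1dep_card -ltnS ltnW // ltnNge.
exact: small.
Qed.

(** Pigeonhole on the leading positions: [s] of them share a colour, and inserting coordinates there
    in increasing order (the matrix [P]) keeps leading ones leading. *)
Lemma vector_ramsey (K : finType) (s : nat) : exists n, forall chi : 'rV[F]_n -> K,
  exists (Y : 'M_(s, n)), row_free Y /\
    exists c, forall i a, leading_one a i -> chi (a *m Y) = c.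
Proof.
have [n Hn] := leading_colour F K (#|K| * s).+1.
exists n => chi; have [Y [Yfree /fin_all_exists[g Hg]]] := Hn chi.
have [c Bc] := @pigeonhole _ _ s g (eq_leq (esym (card_ord _))).
have [f [fmono fB]] := increasing_selection Bc.
pose P : 'M[F]_(s, _) := rowsub f 1%:M.
have PE a i : (a *m P) 0 i = \sum_j a 0 j *+ (f j == i).
  by rewrite !mxE; apply: eq_bigr => j _; rewrite !mxE mulr_natr.
have finj : injective f.
  move=> i j eij; apply: ord_inj; case: (ltngtP i j) => // /fmono.
    by rewrite eij ltnn.
  by rewrite eij ltnn.
have PEf a j : (a *m P) 0 (f j) = a 0 j.
  rewrite PE (bigD1 j) //= eqxx big1 ?addr0 // => j' /negPf nj.
  by rewrite (inj_eq finj) nj.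
exists (P *m Y); split.
  rewrite -kermx_eq0; apply/rowV0P => v /sub_kermxP; rewrite mulmxA => /eqP.
  rewrite (mulmx_free_eq0 _ Yfree) => /eqP v0.
  by apply/rowP => j; rewrite -PEf v0 !mxE.
exists c => i a [a0 a1]; rewrite mulmxA.
have := fB i; rewrite inE => /eqP <-; apply: Hg; split; last by rewrite PEf.
move=> j ji; rewrite PE big1 // => h _; have [fhj|] := eqVneq; last by [].
rewrite mulr1n a0 // ltnNge leq_eqVlt; apply/negP => /orP[/eqP ih|/fmono].
  by move: ji; rewrite -fhj (val_inj ih) ltnn.
by rewrite fhj ltnNge ltnW.
Qed.

End MonochromaticSubspace.

(** * Solutions as multiples of a kernel basis *)

Section KernelBasis.
Variables (F : finFieldType) (l k : nat) (A : 'M[F]_(l, k)).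

Definition null_dim := \rank (kermx A^T).

Definition null_basis : 'M[F]_(k, null_dim) := (row_base (kermx A^T))^T.

Lemma mul_null_basis : A *m null_basis = 0.
Proof.
apply: trmx_inj; rewrite trmx_mul trmxK trmx0; apply/sub_kermxP.
by rewrite eq_row_base.
Qed.

Lemma null_basisP p (X : 'M_(k, p)) : A *m X = 0 -> exists Y, X = null_basis *m Y.
Proof.
move=> AX; have : (X^T <= row_base (kermx A^T))%MS.
  by rewrite eq_row_base; apply/sub_kermxP; rewrite -trmx_mul AX trmx0.
case/submxP => Y XE; exists Y^T.
by apply: trmx_inj; rewrite trmx_mul !trmxK.
Qed.

Lemma null_dimE : null_dim = (k - \rank A)%N.
Proof. by rewrite /null_dim mxrank_ker mxrank_tr. Qed.

Definition rows_in m n (M : 'M[F]_(m, n)) (U : {set 'I_m}) : 'M_(#|U|, n) :=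
  rowsub (fun j : 'I_#|U| => enum_val j) M.

(** Double annihilator: a row vanishing on the kernel of [A] lies in the row space of [A]. *)
Lemma left_null_null_basis (u : 'rV_k) : u *m null_basis = 0 -> (u <= A)%MS.
Proof.
move=> u0; have : (kermx A^T <= kermx u^T)%MS.
  rewrite -(eq_row_base (kermx A^T)).
  by apply/sub_kermxP; rewrite -[row_base _]trmxK -trmx_mul u0 trmx0.
move=> /sub_kermxP K0; rewrite submxE.
have : (u *m (kermx A^T)^T) = 0 by apply: trmx_inj; rewrite trmx_mul trmxK K0 trmx0.
move=> uK.
have cok : (((cokermx A)^T <= kermx A^T)%MS).
  by apply/sub_kermxP; rewrite -trmx_mul mulmx_coker trmx0.
case/submxP: cok => B /(congr1 trmx); rewrite trmxK trmx_mul => ->.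
by rewrite mulmxA uK mul0mx.
Qed.

(* The row combinations of [A] supported on [U] form a space whose dimension is both
   [#|U| - \rank (rows_in null_basis U)] and [l - \rank (cols_outside A U)]. *)
Lemma rows_in_null_rank (U : {set 'I_k}) : \rank A = l ->
  (\rank (rows_in null_basis U) + l = #|U| + \rank (cols_outside A U))%N.
Proof.
move=> rA.
pose AU : 'M[F]_(l, #|U|) := colsub (fun j : 'I_#|U| => enum_val j) A.
pose Ac := cols_outside A U.
pose QU := rows_in null_basis U.
have AUE h i : AU h i = A h (enum_val i) by rewrite mxE.
have AcE h i : Ac h i = A h (enum_val i) by rewrite mxE.
have Afree : row_free A by rewrite /row_free rA.
(* Extension by zero from the coordinates in [U] to all of them. *)
pose ext (u : 'rV[F]_#|U|) : 'rV_k := \row_j \sum_i u 0 i *+ (enum_val i == j).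
have extE u i : ext u 0 (enum_val i) = u 0 i.
  rewrite mxE (bigD1 i) //= eqxx big1 ?addr0 // => j /negPf nj.
  by rewrite (inj_eq enum_val_inj) nj.
have extQ u : ext u *m null_basis = u *m QU.
  apply/rowP => j; rewrite [LHS]mxE [RHS]mxE.
  have extJ i : ext u 0 i = \sum_h u 0 h *+ (enum_val h == i) by rewrite mxE.
  under eq_bigr do rewrite extJ mulr_suml.
  rewrite exchange_big /=; apply: eq_bigr => i _.
  have -> : QU i j = null_basis (enum_val i) j by rewrite mxE.
  rewrite (bigD1 (enum_val i)) //= eqxx big1 ?addr0 //.
  by move=> h /negPf nh; rewrite eq_sym nh mul0r.
have kerE : (kermx Ac *m AU :=: kermx QU)%MS.
  apply/eqmxP/andP; split.
    apply/row_subP => i; rewrite row_mul; apply/sub_kermxP.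
    set a := row i _; have aAc : a *m Ac = 0 by rewrite /a -row_mul mulmx_ker row0.
    rewrite -extQ; have -> : ext (a *m AU) = a *m A; last by rewrite -mulmxA mul_null_basis mulmx0.
    apply/rowP => j; have [jU|jU] := boolP (j \in U).
      rewrite -(enum_rankK_in jU jU) extE [LHS]mxE [RHS]mxE.
      by apply: eq_bigr => h _; rewrite AUE.
    have jUc : j \in ~: U by rewrite inE.
    rewrite mxE big1 => [|h _]; last first.
      have [hj|] := eqVneq; last by [].
      by move: jU; rewrite -hj enum_valP.
    have /rowP/(_ (enum_rank_in jUc j)) := aAc.
    rewrite mxE [RHS]mxE => <-; rewrite [RHS]mxE; apply: eq_bigr => h _.
    by rewrite AcE enum_rankK_in.
  apply/row_subP => i; set u := row i (kermx QU).
  have uQ : u *m QU = 0 by rewrite /u -row_mul mulmx_ker row0.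
  have /submxP[a ua] : (ext u <= A)%MS by apply: left_null_null_basis; rewrite extQ.
  have -> : u = a *m AU.
    apply/rowP => j; rewrite -extE ua [LHS]mxE [RHS]mxE; apply: eq_bigr => h _.
    by rewrite AUE.
  apply: submxMr; apply/sub_kermxP; apply/rowP => j.
  have jU : enum_val j \notin U by have := enum_valP j; rewrite inE.
  have /rowP/(_ (enum_val j)) := ua; rewrite mxE [in RHS]mxE big1.
    by move=> e; rewrite [RHS]mxE [RHS]e [LHS]mxE; apply: eq_bigr => h _; rewrite AcE.
  move=> h _; have [hj|] := eqVneq; last by [].
  by move: jU; rewrite -hj enum_valP.
(* Combinations of rows of [A] that vanish outside [U] are recovered from their restriction to [U],
   and [A] is row free, so no rank is lost. *)
have rk1 : \rank (kermx Ac *m AU) = \rank (kermx Ac).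
  apply/eqP; rewrite eqn_leq mxrankM_maxl -{1}(mxrankMfree _ Afree).
  have -> : (kermx Ac *m A) = kermx Ac *m AU *m \matrix_(i, j) (enum_val i == j)%:R.
    apply/matrixP => i j; have [jU|jU] := boolP (j \in U).
      rewrite [RHS]mxE (bigD1 (enum_rank_in jU j)) //= [X in _ * X + _]mxE.
      rewrite enum_rankK_in // eqxx mulr1 big1 ?addr0.
        rewrite [RHS]mxE.
        by rewrite [LHS]mxE; apply: eq_bigr => h _; rewrite AUE enum_rankK_in.
      move=> h nh; rewrite [X in _ * X]mxE; have [hj|] := eqVneq; last by rewrite mulr0.
      by case/eqP: nh; apply: enum_val_inj; rewrite enum_rankK_in.
    have jUc : j \in ~: U by rewrite inE.
    rewrite [RHS]mxE big1 => [|h _]; last first.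
      rewrite [X in _ * X]mxE; have [hj|] := eqVneq; last by rewrite mulr0.
      by move: jU; rewrite -hj enum_valP.
    have /matrixP/(_ i (enum_rank_in jUc j)) := mulmx_ker Ac.
    rewrite mxE [RHS]mxE => <-; rewrite [LHS]mxE; apply: eq_bigr => h _.
    by rewrite AcE enum_rankK_in.
  exact: mxrankM_maxl.
move: rk1; rewrite kerE !mxrank_ker.
have := rank_leq_row QU; have := rank_leq_row Ac.
rewrite -/QU -/Ac; lia.
Qed.

End KernelBasis.

(** * Supersaturation *)

Section Partition.
Variables (F : finFieldType) (l k : nat) (A : 'M[F]_(l, k)).

(** Column [t] of [D] records the relation expressing the sum of [C t] by earlier columns. Read by
    rows, coordinate [j] has its leading one at the block containing [j]. *)
Lemma columns_kernel : columns_condition A ->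
  exists (m : nat) (D : 'M[F]_(k, m.+1)) (blk : 'I_k -> 'I_m.+1), A *m D = 0 /\
    forall j, (forall t : 'I_m.+1, (t < blk j)%N -> D j t = 0) /\ D j (blk j) = 1.
Proof.
case=> m [C [_ Cdisj Ccov C0 Cd]].
pose U (t : 'I_m.+1) := \bigcup_(h < m.+1 | (h < t)%N) C h.
have /fin_all_exists[d dP] (t : 'I_m.+1) : exists d : 'I_k -> F,
    \sum_(j in C t) col j A = \sum_(j in U t) d j *: col j A.
  have [t0|t0] := posnP t; last exact: Cd.
  exists (fun=> 0); have -> : t = ord0 by apply: val_inj.
  by rewrite C0 big1 // => j _; rewrite scale0r.
have /fin_all_exists[blk blkP] (j : 'I_k) : exists t, j \in C t.
  have : j \in \bigcup_i C i by rewrite Ccov inE.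
  by case/bigcupP => t _ jt; exists t.
have blkE j t : j \in C t -> t = blk j.
  move=> jt; apply/eqP; apply: contraT => /Cdisj /disjoint_setI0 /setP/(_ j).
  by rewrite !inE jt blkP.
pose D := \matrix_(j, t) ((j \in C t)%:R - d t j *+ (j \in U t)).
exists m, D, blk; split.
  apply/matrixP => i t; rewrite [LHS]mxE [RHS]mxE.
  under eq_bigr do rewrite mxE mulrBr.
  rewrite sumrB; apply/eqP; rewrite subr_eq0; apply/eqP.
  have /colP/(_ i) := dP t; rewrite !summxE => e.
  apply: etrans (etrans e _).
    rewrite [RHS]big_mkcond; apply: eq_bigr => j _; rewrite mxE.
    by case: ifP => _; rewrite ?mulr1 ?mulr0.
  rewrite big_mkcond; apply: eq_bigr => j _; rewrite !mxE.
  by case: ifP => _; rewrite ?mulr0 // mulr1n mulrC.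
have UE j t : j \in U t -> (blk j < t)%N.
  by case/bigcupP => h ht /blkE <-.
move=> j; split=> [t lt|]; rewrite mxE.
  case: (boolP (j \in U t)) => [/UE|_]; first by rewrite ltnNge ltnW.
  case: (boolP (j \in C t)) => [/blkE e|_]; last by rewrite subr0.
  by rewrite e ltnn in lt.
rewrite blkP; case: (boolP (j \in U _)) => [/UE|_]; first by rewrite ltnn.
by rewrite subr0.
Qed.

(** Applied to the rows of [D], the vector Ramsey theorem gives a monochromatic solution, but
    possibly of small rank; full rank is needed to average over linear maps. *)
Lemma mono_full_rank_solution (K : finType) : columns_condition A ->
  exists n0, forall chi : 'rV[F]_n0 -> K,
    exists2 z : 'M_(null_dim A, n0), row_free z &
      exists c, forall i, chi (row i (null_basis A *m z)) = c.
Proof.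
case/columns_kernel => m [D [blk [AD DP]]].
have [B DE] := null_basisP AD.
have [n0 Hn0] := vector_ramsey F K (m.+1 + null_dim A).
exists n0 => chi; have [Y [Yfree [c Yc]]] := Hn0 chi.
(* The identity block forces full rank. The rows become those of [D] followed by those of the kernel
   basis, so their leading ones are unchanged. *)
exists (row_mx B 1%:M *m Y).
  rewrite -kermx_eq0; apply/rowV0P => v /sub_kermxP; rewrite mulmxA => /eqP.
  rewrite (mulmx_free_eq0 _ Yfree) mul_mx_row mulmx1 => /eqP e0.
  by have [] := eq_row_mx (etrans e0 (esym (row_mx0 _ _ _ _))).
exists c => j; rewrite mulmxA row_mul; apply: (Yc (lshift _ (blk j))).
rewrite mul_mx_row -DE mulmx1; have [D0 D1] := DP j.
split=> [t lt|]; last by rewrite mxE row_mxEl.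
have lt' : (t < m.+1)%N by apply: (ltn_trans lt); exact: (ltn_ord (blk j)).
have -> : t = lshift _ (Ordinal lt') by apply: val_inj.
by rewrite mxE row_mxEl D0.
Qed.

(** Rows in different blocks are independent by their leading ones. In one block only a relation
    [x i = x j] could hold, which a solution with distinct entries excludes. *)
Lemma null_basis_pair n (i j : 'I_k) (a b : F) : columns_condition A -> irredundant A n ->
  i != j -> a *: row i (null_basis A) + b *: row j (null_basis A) = 0 -> a = 0 /\ b = 0.
Proof.
move=> /columns_kernel[m [D [blk [AD DP]]]] [x [xinj xsol]] nij ab0.
have kerP p (X : 'M_(k, p)) : A *m X = 0 -> a *: row i X + b *: row j X = 0.
  move=> /null_basisP[Y ->]; rewrite !row_mul !scalemxAl -mulmxDl.
  by rewrite ab0 mul0mx.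
have wlg i' j' a' b' : (blk i' < blk j')%N ->
    a' *: row i' D + b' *: row j' D = 0 -> a' = 0 /\ b' = 0.
  move=> lt /rowP e; have [_ Di] := DP i'; have [Dj0 Dj] := DP j'.
  have := e (blk i'); rewrite !mxE Di Dj0 // mulr1 mulr0 addr0 => a0.
  by have := e (blk j'); rewrite !mxE a0 Dj mul0r add0r mulr1.
have eD := kerP _ _ AD.
case: (ltngtP (blk i) (blk j)) => [lt|lt|/val_inj eq].
- exact: wlg lt eD.
- by rewrite addrC in eD; have [-> ->] := wlg _ _ _ _ lt eD.
have [_ Di] := DP i; have [_ Dj] := DP j.
have /rowP/(_ (blk i)) := eD; rewrite !mxE Di eq Dj !mulr1 => /eqP.
rewrite addr_eq0 => /eqP abE.
have Ax : A *m (\matrix_j x j) = 0.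
  apply/row_matrixP => h; rewrite row0 row_mul mulmx_sum_row.
  have /forallP/(_ h)/eqP xs := xsol; rewrite -[RHS]xs; apply: eq_bigr => g _.
  by rewrite rowK mxE.
have := kerP _ _ Ax; rewrite !rowK abE scaleNr addrC => /eqP.
rewrite subr_eq0 => /eqP bE; suff b0 : b = 0 by rewrite b0 oppr0.
apply/eqP; apply: contraT => b0; case/eqP: nij; apply: xinj.
by apply/esym; apply: (scalerI b0).
Qed.

End Partition.

(** * Averaging over linear maps *)

Section Counting.
Variable F : finFieldType.

Lemma card_preimset_le (T S : finType) (f : T -> S) (G : {set S}) c :
  (forall g, g \in G -> #|[set x | f x == g]| <= c)%N ->
  (#|[set x | f x \in G]| <= #|G| * c)%N.
Proof.
move=> H; rewrite -sum1_card (partition_big f (mem G)) /=; last by move=> x; rewrite inE.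
rewrite -sum_nat_const; apply: leq_sum => g gG; apply: leq_trans (H g gG).
rewrite -[leqRHS]sum1_card [leqRHS]big_mkcond [leqLHS]big_mkcond /=.
by apply: leq_sum => x _; rewrite !inE; case: (f x \in G) => //=.
Qed.

Lemma leq_card_bigcup_le (I T : finType) (P : pred I) (B : I -> {set T}) :
  (#|\bigcup_(i | P i) B i| <= \sum_(i | P i) #|B i|)%N.
Proof.
elim/big_rec2: _ => [|i m X _ IH]; first by rewrite cards0.
by apply: leq_trans (leq_card_setU _ _) _; rewrite leq_add2l.
Qed.

Lemma card_mulmx_eq u d n (M : 'M[F]_(u, d)) (Y : 'M[F]_(u, n)) :
  (#|[set z | M *m z == Y]| <= (#|F| ^ n) ^ (d - \rank M))%N.
Proof.
case: (set_0Vmem [set z | M *m z == Y]) => [->|[z0]]; first by rewrite cards0.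
rewrite inE => /eqP z0P.
pose B := [set z0 + null_basis M *m y | y : 'M_(null_dim M, n)].
apply: (@leq_trans #|B|).
  apply: subset_leq_card; apply/subsetP => z; rewrite inE => /eqP zP.
  have /null_basisP[y yP] : M *m (z - z0) = 0 by rewrite mulmxBr zP z0P subrr.
  by apply/imsetP; exists y; rewrite // -yP addrC subrK.
apply: leq_trans (leq_imset_card _ _) _.
by rewrite card_mx null_dimE -expnM mulnC.
Qed.

(** A random linear map [M] from [F^n0] to [F^n] sends, at least half of the time, no nonzero vector
    into the uncovered set. It then pulls the sets [C c] back to a colouring with a full-rank
    monochromatic solution. *)
Lemma supersaturation (K : finType) (c0 : K) k d (Q : 'M[F]_(k, d)) n0 n
    (C : K -> {set 'rV[F]_n}) :
  (forall i, row i Q != 0) -> (0 < k)%N ->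
  (forall chi : 'rV[F]_n0 -> K, exists2 z : 'M_(d, n0), row_free z &
     exists c, forall i, chi (row i (Q *m z)) = c) ->
  (2 * #|F| ^ n0 * #|~: \bigcup_c C c| <= #|F| ^ n)%N ->
  ((#|F| ^ n) ^ d <= 2 * #|F| ^ (d * n0) *
     \sum_c #|[set z : 'M_(d, n) | [forall i, row i (Q *m z) \in C c]]|)%N.
Proof.
move=> Q0 k0 Hn0; set D := ~: _; set N := (#|F| ^ n)%N => HD.
have q0 : (0 < #|F|)%N by apply/card_gt0P; exists 0.
have N0 : (0 < N)%N by rewrite expn_gt0 q0.
pose Gc c := [set z : 'M_(d, n) | [forall i, row i (Q *m z) \in C c]].
pose G := \bigcup_c Gc c.
have n0_gt0 : (0 < n0)%N.
  rewrite lt0n; apply/eqP => n00; have [z zfree _] := Hn0 (fun=> c0).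
  have : row (Ordinal k0) Q *m z = 0 by apply/rowP; case=> j jlt; exfalso; rewrite n00 in jlt.
  by move/eqP; rewrite (mulmx_free_eq0 _ zfree) (negPf (Q0 _)).
have dn0 : (d <= n0)%N.
  by have [z /eqP <- _] := Hn0 (fun=> c0); exact: rank_leq_col.
pose bad := [set M : 'M[F]_(n0, n) | [exists u : 'rV_n0, (u != 0) && (u *m M \in D)]].
have badle : (#|bad| <= #|F| ^ n0 * (#|D| * N ^ n0.-1))%N.
  have -> : bad = \bigcup_(u : 'rV_n0 | u != 0) [set M | u *m M \in D].
    apply/setP => M; rewrite !inE; apply/existsP/bigcupP => [[u /andP[]]|[u]].
      by exists u; rewrite // inE.
    by rewrite inE => u0 uM; exists u; rewrite u0.
  apply: leq_trans (leq_card_bigcup_le _ _) _.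
  have <- : #|{: 'rV[F]_n0}| = (#|F| ^ n0)%N by rewrite card_mx mul1n.
  rewrite -[leqRHS]sum_nat_const big_mkcond [leqRHS]big_mkcond /=.
  apply: leq_sum => u _; case: ifP => // u0; apply: card_preimset_le => g _.
  by apply: leq_trans (card_mulmx_eq _ _) _; rewrite rank_rV u0 subn1.
have badle2 : (2 * #|bad| <= N ^ n0)%N.
  apply: leq_trans (_ : 2 * (#|F| ^ n0 * (#|D| * N ^ n0.-1)) <= _)%N; first by rewrite leq_mul2l.
  rewrite -[in leqRHS](prednK n0_gt0) expnS !mulnA leq_mul2r.
  by rewrite HD orbT.
have goodle : (#|~: bad| <= #|F| ^ (d * n0) * (#|G| * N ^ (n0 - d)))%N.
  apply: leq_trans (_ : #|\bigcup_(z : 'M_(d, n0) | row_free z) [set M | z *m M \in G]| <= _)%N.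
    apply: subset_leq_card; apply/subsetP => M; rewrite !inE => /existsPn nbad.
    (* The default [c0] is taken only where [u *m M] is uncovered; the rows of [Q *m z] are nonzero,
       so it never occurs there. *)
    pose chi (u : 'rV_n0) := odflt c0 [pick c | u *m M \in C c].
    have [z zfree [c zc]] := Hn0 chi; apply/bigcupP; exists z; rewrite // inE.
    apply/bigcupP; exists c => //; rewrite inE; apply/forallP => i.
    rewrite mulmxA row_mul; have := zc i; rewrite /chi.
    case: pickP => [c' + <- //|none].
    have := nbad (row i (Q *m z)).
    rewrite row_mul (mulmx_free_eq0 _ zfree) (negPf (Q0 i)) /= inE negbK.
    by case/bigcupP => c' _; rewrite -row_mul none.
  apply: leq_trans (leq_card_bigcup_le _ _) _.
  rewrite -card_mx -[leqRHS]sum_nat_const big_mkcond [leqRHS]big_mkcond /=.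
  apply: leq_sum => z _; case: ifP => // zfree; apply: card_preimset_le => g _.
  (* Full rank of [z] makes each image arise from at most [N ^ (n0 - d)] maps. *)
  by apply: leq_trans (card_mulmx_eq _ _) _; rewrite (eqP zfree).
have Gle : (#|G| <= \sum_c #|Gc c|)%N by apply: leq_card_bigcup_le.
have tot : (#|bad| + #|~: bad| = N ^ n0)%N by rewrite cardsC card_mx -expnM mulnC.
have : (N ^ n0 <= 2 * #|F| ^ (d * n0) * #|G| * N ^ (n0 - d))%N by lia.
have Nd : (0 < N ^ (n0 - d))%N by rewrite expn_gt0 N0.
rewrite -{1}(subnKC dn0) expnD (leq_pmul2r Nd) => /leq_trans; apply.
by rewrite leq_mul2l Gle orbT.
Qed.

End Counting.

(** * Hypergraph containers *)

Section Strategy.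
Variable V : finType.
Implicit Types (I J C : {set V}).

(* [Pick o nx em] asks for the first vertex of [o] lying in the set under
   investigation, and continues with [em] if there is none. *)
Inductive strategy := Stop of {set V} | Pick of seq V & (V -> strategy) & strategy.

Fixpoint run (s : strategy) I : {set V} * {set V} :=
  match s with
  | Stop C => (set0, C)
  | Pick o nx em =>
    if [seq v <- o | v \in I] is v :: _ then (v |: (run (nx v) I).1, (run (nx v) I).2)
    else run em I
  end.

Lemma run_sub s I : (run s I).1 \subset I.
Proof.
elim: s => [C|o nx IHnx em IHem] /=; first exact: sub0set.
case E: [seq v <- o | v \in I] => [//|v t] /=.
rewrite subUset IHnx andbT sub1set.
have : v \in [seq v <- o | v \in I] by rewrite E mem_head.
by rewrite mem_filter => /andP[].
Qed.

(** The container is determined by the fingerprint alone: in every set between the fingerprint and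
    [I] the first available vertices are the same. *)
Lemma run_stable s I J : (run s I).1 \subset J -> J \subset I -> run s J = run s I.
Proof.
move=> sJ /subsetP JI; elim: s sJ => [//|o nx IHnx em IHem] /=.
have fJ : [seq v <- o | v \in J] = [seq v <- [seq v <- o | v \in I] | v \in J].
  rewrite -filter_predI; apply: eq_filter => v /=.
  by case vJ: (v \in J) => //=; rewrite JI.
rewrite fJ; case E: [seq v <- o | v \in I] => [|v t] /=; first exact: IHem.
by rewrite subUset sub1set => /andP[-> /IHnx->].
Qed.

Fixpoint bind (s : strategy) (f : {set V} -> strategy) : strategy :=
  match s with
  | Stop C => f C
  | Pick o nx em => Pick o (fun v => bind (nx v) f) (bind em f)
  end.

Lemma run_bind s f I :
  run (bind s f) I = ((run s I).1 :|: (run (f (run s I).2) I).1, (run (f (run s I).2) I).2).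
Proof.
elim: s => [C|o nx IHnx em IHem] /=; first by rewrite set0U; case: run.
by case E: [seq v <- o | v \in I] => [//|v t] /=; rewrite IHnx /= setUA.
Qed.

End Strategy.
Arguments Stop {V}.

Section Degrees.
Variable V : finType.
Implicit Types (T e : {set V}) (H G : seq {set V}).
Local Open Scope nat_scope.

Definition deg H T := count (fun e => T \subset e) H.

Lemma count_sum (U : Type) (a : pred U) (s : seq U) : count a s = \sum_(x <- s) a x.
Proof. by elim: s => [|x s IH] /=; rewrite ?big_nil // big_cons IH. Qed.

Lemma sum_deg_sets G : \sum_T deg G T = \sum_(e <- G) 2 ^ #|e|.
Proof.
under eq_bigr do rewrite /deg count_sum.
rewrite exchange_big /=; apply: eq_bigr => e _.
rewrite -card_powerset -sum1_card [RHS]big_mkcond /=.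
by apply: eq_bigr => T _; rewrite inE; case: (T \subset e).
Qed.

Lemma sum_deg_vertices H : \sum_v deg H [set v] = \sum_(e <- H) #|e|.
Proof.
under eq_bigr do rewrite /deg count_sum.
rewrite exchange_big /=; apply: eq_bigr => e _.
rewrite -sum1_card [RHS]big_mkcond /=.
by apply: eq_bigr => v _; rewrite sub1set; case: (v \in e).
Qed.

Lemma count_exists_deg (P : pred {set V}) H :
  count (fun e => [exists T, P T && (T \subset e)]) H <= \sum_(T | P T) deg H T.
Proof.
under [leqRHS]eq_bigr do rewrite /deg count_sum.
rewrite exchange_big count_sum /=; apply: leq_sum => e _.
case: existsP => // -[T /andP[PT Te]].
by rewrite (bigD1 T) //= Te.
Qed.

Lemma deg_filter (a : pred {set V}) H T : deg (filter a H) T <= deg H T.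
Proof. by rewrite /deg count_filter; apply: sub_count => e /andP[]. Qed.

End Degrees.

(** * One container step, by descent on the uniformity *)

Section Level.
Variables (R : realFieldType) (V : finType) (p : R) (b : nat).
Implicit Types (T e I F : {set V}) (H G : seq {set V}) (K : R).
Local Open Scope ring_scope.

(** The usual codegree condition: sets of size [t] have degree at most [K * p ^+ (t - 1)] times the
    average [size H / #|V|]. *)
Definition spread K H := forall T, T != set0 ->
  #|V|%:R * (deg H T)%:R <= K * p ^+ #|T|.-1 * (size H)%:R.

Section Loop.
Variable H : seq {set V}.

(* Edges through a saturated set are discarded, which keeps the links collected in [G]
   as spread out as [H]. *)
Definition saturated G T := (T != set0) && (p ^+ #|T| * (size H)%:R <= #|V|%:R * (deg G T)%:R).

Definition unsat G e := ~~ [exists T, saturated G T && (T \subset e)].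

Definition live (F : {set V}) G := [seq e : {set V} <- H | [disjoint e & F] && unsat G e].

Definition link v H' : seq {set V} := [seq e :\ v | e <- H' & v \in e].

Definition by_degree F G : seq V :=
  sort (fun u v => deg (live F G) [set v] <= deg (live F G) [set u])%N (enum (~: F)).

(** At most [j] rounds, each picking from the investigated set a vertex of largest degree among the
    live edges. [F] collects the picked vertices and [G] their links. *)
Fixpoint loop (j : nat) F G (f : {set V} -> seq {set V} -> strategy V) : strategy V :=
  if j is j'.+1 then
    Pick (by_degree F G) (fun v => loop j' (v |: F) (G ++ link v (live F G)) f) (f F G)
  else f F G.

(** [inv_deg] holds since each earlier pick contributed to [G] at least the present degree of [u].
    [inv_edge] says that an edge of [G] inside [I] would come from an edge of [H] inside [I]. *)
Record loop_inv (i : nat) K I F G (j : nat) : Prop := LoopInv {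
  inv_lost : (count (fun e : {set V} => ~~ [disjoint e & F] && unsat G e) H <= size G)%N;
  inv_spread : forall T, T != set0 ->
    #|V|%:R * (deg G T)%:R <= (1 + K) * p ^+ #|T| * (size H)%:R;
  inv_deg : forall u, u \in I -> u \notin F -> (j * deg (live F G) [set u] <= size G)%N;
  inv_edge : forall e, e \in G -> exists2 g, g \in H &
    [/\ e \subset g, g \subset e :|: I & #|e| = i] }.

Lemma disjoint_setU1r v e F : [disjoint e & v |: F] = (v \notin e) && [disjoint e & F].
Proof. by rewrite -!setI_eq0 setIUr setU_eq0 setI_eq0 disjoint_sym disjoints1. Qed.

Lemma saturated_cat G G' T : saturated G T -> saturated (G ++ G') T.
Proof.
move=> /andP[T0 h]; rewrite /saturated T0 (le_trans h) // ler_wpM2l ?ler0n //.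
by rewrite ler_nat /deg count_cat leq_addr.
Qed.

Lemma unsat_cat G G' e : unsat (G ++ G') e -> unsat G e.
Proof.
apply: contra => /existsP[T /andP[sT Te]]; apply/existsP; exists T.
by rewrite saturated_cat.
Qed.

Lemma loop_inv_pick i K I F G j v : 0 <= p -> 0 <= K ->
  spread K H -> (forall e, e \in H -> #|e| = i.+1) ->
  v \in I -> (forall u, u \in I -> u \notin F -> deg (live F G) [set u] <= deg (live F G) [set v])%N ->
  loop_inv i K I F G j ->
  loop_inv i K I (v |: F) (G ++ link v (live F G)) j.+1.
Proof.
move=> p0 K0 sprH szH vI vmax [lost spr dg ed].
have szlink : size (link v (live F G)) = deg (live F G) [set v].
  rewrite size_map size_filter /deg; apply: eq_count => e.
  by rewrite sub1set.
split.
- rewrite size_cat szlink; apply: leq_trans (leq_add lost (leqnn _)).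
  rewrite /deg /live count_filter -count_predUI.
  apply: leq_trans (leq_addr _ _); apply: sub_count => e /= /andP[dis us].
  have us' := unsat_cat us; rewrite us' !andbT sub1set.
  case: (boolP [disjoint e & F]) => //= dF; rewrite andbT.
  by move: dis; rewrite disjoint_setU1r dF andbT negbK.
- move=> T T0; rewrite /deg count_cat natrD mulrDr.
  (* A saturated [T] gains no further edge; an unsaturated one is below [p ^+ #|T| * size H] and
     gains at most the degree of [v |: T] in [H]. *)
  have [sT|nsT] := boolP (saturated G T).
    rewrite [X in _ + _ * X%:R](_ : _ = 0%N) ?mulr0 ?addr0 ?spr //.
    apply/eqP; rewrite -leqn0 leqNgt -has_count; apply/hasPn => _ /mapP[e + ->].
    rewrite !mem_filter => /and3P[ve /andP[dF us] eH].
    apply: contra us => Te; apply/existsP; exists T; rewrite sT /=.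
    exact: subset_trans Te (subsetDl _ _).
  have lt1 : #|V|%:R * (deg G T)%:R <= p ^+ #|T| * (size H)%:R.
    by move: nsT; rewrite /saturated T0 /= -ltNge => /ltW.
  rewrite mulrDl mulrDl mul1r lerD //.
  have [vT|vT] := boolP (v \in T).
    rewrite [X in _ * X%:R](_ : _ = 0%N) ?mulr0 ?mulr_ge0 ?exprn_ge0 ?ler0n //.
    apply/eqP; rewrite -leqn0 leqNgt -has_count; apply/hasPn => _ /mapP[e _ ->].
    by apply/negP => /subsetP/(_ v vT); rewrite !inE eqxx.
  apply: le_trans (_ : #|V|%:R * (deg H (v |: T))%:R <= _).
    rewrite ler_wpM2l ?ler0n // ler_nat /link count_map count_filter /live /deg count_filter.
    apply: sub_count => e /= /andP[/andP[Te ve] _].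
    by rewrite subUset sub1set ve /= (subset_trans Te) // subsetDl.
  have := sprH (v |: T); rewrite cardsU1 vT /=; apply.
  by apply/set0Pn; exists v; rewrite setU11.
- move=> u uI; rewrite in_setU1 negb_or => /andP[uv uF].
  rewrite size_cat szlink mulSn addnC; apply: leq_add.
    apply: leq_trans (dg u uI uF); rewrite leq_mul2l; apply/orP; right.
    rewrite /live /deg !count_filter; apply: sub_count => e /= /and3P[-> dis /unsat_cat ->].
    by move: dis; rewrite disjoint_setU1r => /andP[_ ->].
  apply: leq_trans (vmax u uI uF).
  rewrite /live /deg !count_filter; apply: sub_count => e /= /and3P[-> dis /unsat_cat ->].
  by move: dis; rewrite disjoint_setU1r => /andP[_ ->].
- move=> e; rewrite mem_cat => /orP[/ed //|/mapP[g]].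
  rewrite !mem_filter => /and3P[vg _ gH] ->; exists g => //; split.
  + exact: subsetDl.
  + apply/subsetP => x xg; rewrite !inE xg andbT.
    by case: eqVneq => //= ->.
  + by have := szH g gH; rewrite (cardsD1 v) vg add1n => -[].
Qed.

Lemma loop_inv_init i K I : 0 <= p -> 0 <= K -> loop_inv i K I set0 [::] 0.
Proof.
move=> p0 K0; split => //.
  rewrite leqn0 -[X in _ == X](count_pred0 H); apply/eqP/eq_count => e.
  by rewrite /= disjoint_sym disjoints_subset sub0set.
move=> T _; rewrite /deg /= mulr0.
by rewrite !mulr_ge0 ?addr_ge0 ?exprn_ge0 ?ler0n ?ler01.
Qed.

Lemma run_loop i K I f F G j0 j : 0 <= p -> 0 <= K ->
  spread K H -> (forall e, e \in H -> #|e| = i.+1) ->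
  loop_inv i K I F G j0 ->
  exists F' G', [/\ loop_inv i K I F' G' (j0 + j),
    (run (loop j F G f) I).2 = (run (f F' G') I).2 &
    (#|(run (loop j F G f) I).1| <= j + #|(run (f F' G') I).1|)%N].
Proof.
move=> p0 K0 sprH szH; elim: j j0 F G => [|j IH] j0 F G inv /=.
  by exists F, G; rewrite addn0.
case E: [seq v <- by_degree F G | v \in I] => [|v t].
  exists F, G; split => //; last by rewrite leq_addl.
  case: inv => h1 h2 h3 h4; split => // u uI uF.
  have : u \in [seq v <- by_degree F G | v \in I].
    by rewrite mem_filter uI mem_sort mem_enum inE.
  by rewrite E.
have vI : v \in I.
  have : v \in [seq v <- by_degree F G | v \in I] by rewrite E mem_head.
  by rewrite mem_filter => /andP[].
have vmax u : u \in I -> u \notin F ->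
    (deg (live F G) [set u] <= deg (live F G) [set v])%N.
  move=> uI uF; have : u \in [seq v <- by_degree F G | v \in I].
    by rewrite mem_filter uI mem_sort mem_enum inE.
  pose r (u v : V) := (deg (live F G) [set v] <= deg (live F G) [set u])%N.
  have rtr : transitive r by move=> x y z xy yz; exact: leq_trans yz xy.
  have : sorted r [seq v <- by_degree F G | v \in I].
    apply: sorted_filter => //; apply: sort_sorted => x y; exact: leq_total.
  rewrite E /= => /(order_path_min rtr)/allP pt.
  by rewrite inE => /predU1P[->//|/pt].
have [F' [G' [inv' r2 r1]]] := IH _ _ _ (loop_inv_pick p0 K0 sprH szH vI vmax inv).
exists F', G'; rewrite addnS -addSn; split => //=.
by rewrite addSn; apply: leq_trans (leq_card_setU _ _) _; rewrite cards1 add1n ltnS.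
Qed.

End Loop.

(** Chosen so that edges lost to picked vertices and edges lost to saturated sets together make up
    at most a quarter of [H]. *)
Definition level_ratio (i : nat) K : R := (4 * (1 + K * 2 ^+ i))^-1.

Definition next_spread (i : nat) K : R := (1 + K) / level_ratio i K.

(** Either the links are numerous and form a spread hypergraph of lower uniformity, or they are few
    and bounding the live degrees gives the container. Both depend only on [F] and [G], hence only
    on the picks. *)
Fixpoint level_strategy (i : nat) K H : strategy V :=
  if i is i'.+1 then
    loop H b set0 [::] (fun F G =>
      if level_ratio i' K * p * (size H)%:R <= (size G)%:R
      then level_strategy i' (next_spread i' K) G
      else Stop [set v | b * deg (live H F G) [set v] <= size G]%N)
  else Stop set0.

Fixpoint level_gain (i : nat) K : R :=
  if i is i'.+1 then Num.min (2 * K)^-1 (level_gain i' (next_spread i' K)) else 1.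

Lemma level_ratio_gt0 i K : 0 < K -> 0 < level_ratio i K.
Proof. by move=> K0; rewrite invr_gt0 mulr_gt0 ?addr_gt0 ?mulr_gt0 ?exprn_gt0. Qed.

Lemma next_spread_gt0 i K : 0 < K -> 0 < next_spread i K.
Proof. by move=> K0; rewrite divr_gt0 ?level_ratio_gt0 ?addr_gt0. Qed.

Lemma level_gain_gt0 i K : 0 < K -> 0 < level_gain i K.
Proof.
elim: i K => [//|i IH] K K0 /=.
by rewrite lt_min invr_gt0 mulr_gt0 //= IH // next_spread_gt0.
Qed.

(** The live edges carry degree sum at least [3/4 * size H], of which the container gets at most a
    quarter of [size H]. The remaining half lies on vertices of degree at most [K * size H / #|V|],
    so there are many of these. *)
Lemma container_size i K H I F G : 0 < p <= 1 -> 0 < K -> (0 < size H)%N ->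
  p * #|V|%:R <= b%:R ->
  spread K H -> (forall e, e \in H -> #|e| = i.+1) ->
  loop_inv H i K I F G b ->
  (size G)%:R < level_ratio i K * p * (size H)%:R ->
  (2 * K)^-1 * #|V|%:R <= #|~: [set v | b * deg (live H F G) [set v] <= size G]%N|%:R.
Proof.
move=> /andP[p0 p1] K0 H0 pb sprH szH [lost _ _ ed] smallG.
set C := [set v | _]; set m : R := (size H)%:R; set al := level_ratio i K.
have al0 : 0 < al := level_ratio_gt0 i K0.
have alE : al * (1 + K * 2 ^+ i) = 4^-1.
  by rewrite /al /level_ratio invfM mulfVK // gt_eqF // addr_gt0 ?mulr_gt0 ?exprn_gt0.
have m0 : 0 < m by rewrite ltr0n.
have N0 : 0 < #|V|%:R :> R.
  rewrite ltr0n; case: (H) H0 szH => // e H' _ szH.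
  have ez := szH e (mem_head _ _).
  by apply: (@leq_trans #|e|); [rewrite ez | exact: max_card].
have lost2 : p * (count (fun e => ~~ unsat H G e) H)%:R <= K * 2 ^+ i * (size G)%:R.
  rewrite -(ler_pM2l N0).
  apply: le_trans (_ : #|V|%:R * (p * \sum_(T | saturated H G T) (deg H T)%:R) <= _).
    rewrite ler_pM2l // ler_pM2l // -natr_sum ler_nat.
    apply: leq_trans (count_exists_deg _ _); apply: sub_count => e.
    by rewrite negbK.
  rewrite mulrCA mulr_sumr mulr_sumr.
  apply: le_trans (_ : \sum_(T | saturated H G T) K * (#|V|%:R * (deg G T)%:R) <= _).
    apply: ler_sum => T /andP[T0 satT].
    apply: le_trans (_ : p * (K * p ^+ #|T|.-1 * m) <= _).
      by rewrite ler_pM2l // sprH.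
    have -> : p * (K * p ^+ #|T|.-1 * m) = K * (p ^+ #|T| * m).
      have : (0 < #|T|)%N by rewrite card_gt0.
      by case: #|T| => // t _; rewrite exprS /=; ring.
    by rewrite ler_pM2l.
  rewrite -mulr_sumr -mulr_sumr mulrCA ler_pM2l // -mulrA ler_pM2l //.
  rewrite -natr_sum -natrX -natrM ler_nat.
  apply: leq_trans (_ : \sum_T deg G T <= _)%N.
    by rewrite [leqRHS](bigID (saturated H G)) /= leq_addr.
  rewrite sum_deg_sets mulnC -sum1_size big_distrl /= big_seq [leqRHS]big_seq.
  by apply: leq_sum => e /ed[g _ [_ _ ->]]; rewrite mul1n.
have liveB : 3 / 4 * m <= (size (live H F G))%:R.
  have : (size H <= size (live H F G) + size G + count (fun e => ~~ unsat H G e) H)%N.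
    apply: leq_trans (leq_add (leq_add (leqnn _) lost) (leqnn _)).
    rewrite size_filter !count_sum -!big_split /= -sum1_size.
    by apply: leq_sum => e _; case: [disjoint e & F]; case: unsat.
  rewrite -(ler_nat R) !natrD -/m; set c : R := (count _ _)%:R.
  have cle : c <= K * 2 ^+ i * al * m.
    rewrite -(ler_pM2l p0); apply: le_trans lost2 _.
    have -> : p * (K * 2 ^+ i * al * m) = K * 2 ^+ i * (al * p * m) by ring.
    by rewrite ler_wpM2l ?(ltW smallG) // mulr_ge0 ?exprn_ge0 ?(ltW K0).
  have Gle : (size G)%:R <= al * m.
    apply: le_trans (ltW smallG) _; rewrite ler_wpM2r ?(ltW m0) //.
    by rewrite ler_piMr ?(ltW al0).
  have : al * m + K * 2 ^+ i * al * m = 4^-1 * m by rewrite -alE; ring.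
  lra.
pose dg v := (deg (live H F G) [set v])%:R : R.
have sumdg : 3 / 4 * m <= \sum_v dg v.
  apply: le_trans liveB _; rewrite -natr_sum ler_nat sum_deg_vertices -sum1_size.
  rewrite big_seq [leqRHS]big_seq; apply: leq_sum => e.
  by rewrite mem_filter => /andP[_ /szH ->].
have sumC : \sum_(v in C) dg v <= 4^-1 * m.
  apply: le_trans (_ : \sum_(v in C) (4^-1 * m / #|V|%:R) <= _); last first.
    rewrite sumr_const -[leLHS]mulr_natr mulrAC ler_pdivrMr //.
    by rewrite ler_wpM2l ?ler_nat ?max_card // mulr_ge0 ?invr_ge0 ?(ltW m0).
  apply: ler_sum => v; rewrite inE -(ler_nat R) natrM => vC.
  rewrite ler_pdivlMr // -(ler_pM2l p0).
  apply: le_trans (_ : b%:R * dg v <= _).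
    by rewrite mulrCA mulrC ler_wpM2r.
  apply: le_trans vC (le_trans (ltW smallG) _).
  rewrite mulrAC -/m mulrC ler_wpM2l ?(ltW p0) // ler_wpM2r ?(ltW m0) //.
  rewrite -alE ler_pMr // lerDl mulr_ge0 ?exprn_ge0 //; lra.
have sumnC : \sum_(v in ~: C) dg v <= #|~: C|%:R * (K * m / #|V|%:R).
  rewrite mulrC mulr_natr -sumr_const; apply: ler_sum => v _.
  rewrite ler_pdivlMr // mulrC.
  have := sprH [set v]; rewrite cards1 expr0 mulr1 => sv.
  apply: le_trans (sv _); last by apply/set0Pn; exists v; rewrite inE.
  by rewrite ler_pM2l // ler_nat deg_filter.
have : \sum_v dg v = \sum_(v in C) dg v + \sum_(v in ~: C) dg v.
  rewrite (bigID (mem C)) /=; congr (_ + _); apply: eq_bigl => v.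
  by rewrite in_setC.
set x := #|~: C|%:R in sumnC *; set N := #|V|%:R : R.
move=> sE; have : 2^-1 * m <= x * (K * m / N) by rewrite /N; lra.
have -> : x * (K * m / N) = (x * K / N) * m by ring.
rewrite ler_pM2r // ler_pdivlMr // => h.
by rewrite invfM mulrAC ler_pdivrMr.
Qed.

(** The last clause says that excluded vertices lie on edges of [H]; it makes every exclusion count
    when [H] lives inside a smaller set. *)
Lemma level_strategyP i K H I : 0 < p <= 1 -> 0 < K -> (0 < size H)%N ->
  p * #|V|%:R <= b%:R ->
  spread K H -> (forall e, e \in H -> #|e| = i) ->
  (forall e, e \in H -> ~~ (e \subset I)) ->
  let: (P, C) := run (level_strategy i K H) I in
  [/\ (#|P| <= i * b)%N, I \subset C, level_gain i K * #|V|%:R <= #|~: C|%:R &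
      forall v, v \notin C -> exists2 e, e \in H & v \in e].
Proof.
move=> p01 K0 H0 pb; case/andP: (p01) => p0 p1.
elim: i K H K0 H0 => [|i IH] K H K0 H0 sprH szH indI.
  (* Uniformity 0 cannot occur: the empty edge would lie in [I]. *)
  case: H H0 szH indI {sprH} => // e H _ szH indI.
  have /eqP := szH e (mem_head _ _); rewrite cards_eq0 => /eqP e0.
  by have := indI e (mem_head _ _); rewrite e0 sub0set.
set f := (fun F G => if level_ratio i K * p * (size H)%:R <= (size G)%:R
      then level_strategy i (next_spread i K) G
      else Stop [set v | b * deg (live H F G) [set v] <= size G]%N).
have [F [G [inv r2 r1]]] := run_loop f b (ltW p0) (ltW K0) sprH szH
  (loop_inv_init H i I (ltW p0) (ltW K0)).
rewrite add0n in inv; rewrite -/(level_strategy i.+1 K H) /= -/f.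
case E : (run (loop H b set0 [::] f) I) r2 r1 => [P C] /=.
have indG e : e \in G -> ~~ (e \subset I).
  case: inv => _ _ _ ed /ed[g gH [_ gI _]]; apply: contra (indI g gH) => eI.
  by apply: subset_trans gI _; rewrite subUset eI subxx.
have sG e : e \in G -> #|e| = i by case: inv => _ _ _ ed /ed[g _ []].
have coverG e v : e \in G -> v \in e -> exists2 g, g \in H & v \in g.
  by case: inv => _ _ _ ed /ed[g gH [/subsetP eg _ _]] /eg; exists g.
rewrite /f; case: ifPn => [bigG|]; last first.
  rewrite -ltNge => smallG /= -> r1; split.
  - by apply: leq_trans r1 _; rewrite cards0 addn0 mulSn leq_addr.
  - apply/subsetP => u uI; rewrite inE; case: (boolP (u \in F)) => uF; last first.
      by case: inv => _ _ + _; apply.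
    rewrite [deg _ _](_ : _ = 0%N) ?muln0 //; apply/eqP.
    rewrite -leqn0 leqNgt -has_count; apply/hasPn => e; rewrite mem_filter sub1set.
    move=> /andP[/andP[dis _] _]; apply/negP => ue.
    by rewrite (disjointFr dis ue) in uF.
  - apply: le_trans (container_size p01 K0 H0 pb sprH szH inv smallG).
    by rewrite ler_wpM2r ?ler0n // ge_min lexx.
  - move=> v; rewrite inE -ltnNge => /(leq_ltn_trans (leq0n _)).
    rewrite muln_gt0 => /andP[_]; rewrite -has_count => /hasP[e].
    by rewrite mem_filter sub1set => /andP[_ eH] ve; exists e.
have al0 := level_ratio_gt0 i K0.
have m0 : 0 < (size H)%:R :> R by rewrite ltr0n.
have G0 : (0 < size G)%N.
  by rewrite -(ltr_nat R); apply: lt_le_trans bigG; rewrite !mulr_gt0.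
have sprG : spread (next_spread i K) G.
  move=> T T0; case: inv => _ /(_ T T0) h _ _; apply: le_trans h _.
  have -> : (1 + K) * p ^+ #|T| * (size H)%:R =
      next_spread i K * p ^+ #|T|.-1 * (level_ratio i K * p * (size H)%:R).
    have : (0 < #|T|)%N by rewrite card_gt0.
    case: #|T| => // t _; rewrite exprS /next_spread /=.
    by field; rewrite gt_eqF.
  by rewrite ler_wpM2l // mulr_ge0 ?exprn_ge0 ?(ltW p0) // ltW // next_spread_gt0.
have := IH _ G (next_spread_gt0 i K0) G0 sprG sG indG.
case: (run (level_strategy i _ G) I) => P' C' /= [P'le IC gain cov] -> r1; split.
- by rewrite mulSn (leq_trans r1) // leq_add2l.
- exact: IC.
- by apply: le_trans gain; rewrite ler_wpM2r ?ler0n // ge_min lexx orbT.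
- by move=> v /cov[e eG ve]; apply: coverG ve.
Qed.

End Level.

(** * Random subsets *)

Section Shrink.
Variables (R : realFieldType) (V : finType) (p : R) (b i : nat) (E : seq {set V}) (K M eps : R).
Implicit Types (U I : {set V}).

Definition sub_edges U := [seq e : {set V} <- E | e \subset U].

(** While [U] keeps a proportion [eps] of the edges, these are spread with constant [K / eps], and
    each round removes a fixed fraction of all vertices, so a bounded number of rounds is enough. *)
Fixpoint shrink (j : nat) U : strategy V :=
  if j is j'.+1 then
    if eps * M <= (size (sub_edges U))%:R then
      bind (level_strategy p b i (K / eps) (sub_edges U)) (fun C => shrink j' (U :&: C))
    else Stop U
  else Stop U.

Hypotheses (p01 : 0 < p <= 1) (K0 : 0 < K) (eps0 : 0 < eps) (M0 : 0 < M).
Hypotheses (pb : p * #|V|%:R <= b%:R) (szE : forall e, e \in E -> #|e| = i).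
Hypothesis codeg : forall T, T != set0 ->
  #|V|%:R * (deg E T)%:R <= K * p ^+ #|T|.-1 * M.

Lemma shrinkP (j : nat) U I : (forall e, e \in E -> ~~ (e \subset I)) -> I \subset U ->
  #|U|%:R < j%:R * level_gain i (K / eps) * #|V|%:R ->
  let: (P, C) := run (shrink j U) I in
  [/\ (#|P| <= j * (i * b))%N, I \subset C & (size (sub_edges C))%:R < eps * M].
Proof.
move=> indI; elim: j U => [|j IH] U IU ltU.
  by move: ltU; rewrite mul0r mul0r ltrn0.
rewrite /=; case: ifPn => [big|]; last by rewrite -ltNge /= cards0.
rewrite run_bind.
have big0 : (0 < size (sub_edges U))%N.
  by rewrite -(ltr_nat R); apply: lt_le_trans big; rewrite mulr_gt0.
have spr : spread p (K / eps) (sub_edges U).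
  move=> T T0; apply: le_trans (_ : #|V|%:R * (deg E T)%:R <= _).
    by rewrite ler_wpM2l ?ler0n // ler_nat deg_filter.
  apply: le_trans (codeg T0) _.
  have -> : K * p ^+ #|T|.-1 * M = K / eps * p ^+ #|T|.-1 * (eps * M).
    by field; rewrite gt_eqF.
  case/andP: p01 => p0 _.
  by rewrite ler_wpM2l // mulr_ge0 ?exprn_ge0 ?(ltW p0) // divr_ge0 // ltW.
have szU e : e \in sub_edges U -> #|e| = i by rewrite mem_filter => /andP[_ /szE].
have indU e : e \in sub_edges U -> ~~ (e \subset I) by rewrite mem_filter => /andP[_ /indI].
have := level_strategyP p01 (divr_gt0 K0 eps0) big0 pb spr szU indU.
case: (run (level_strategy _ _ _ _ _) I) => P C /= [Ple IC gain cov].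
have subU : ~: C \subset U.
  apply/subsetP => v; rewrite inE => /cov[e]; rewrite mem_filter => /andP[/subsetP eU _].
  exact: eU.
have IUC : I \subset U :&: C by rewrite subsetI IU.
have ltUC : #|U :&: C|%:R < j%:R * level_gain i (K / eps) * #|V|%:R.
  have cE : (#|U :&: C| + #|~: C| = #|U|)%N.
    by rewrite -(cardsID C U); congr (_ + _)%N; rewrite setDE (setIidPr subU).
  have : #|U|%:R = #|U :&: C|%:R + #|~: C|%:R :> R by rewrite -natrD cE.
  move: ltU; rewrite -natr1 -!mulrA mulrDl mul1r; lra.
have := IH _ IUC ltUC; case: (run (shrink j (U :&: C)) I) => P' C' /= [P'le IC' small].
split => //.
by rewrite mulSn (leq_trans (leq_card_setU _ _)) // leq_add.
Qed.

End Shrink.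

(** * Containment probabilities and union bounds *)

Section Probability.
Variables (R : realFieldType) (V : finType) (p : R).
Implicit Types (S T D : {set V}) (E : pred {set V}).

Let wt S := \prod_v (if v \in S then p else 1 - p).

(** Expansion of the product over [v] of a present and an absent term, where avoidance kills the
    former on [D] and containment the latter on [T]. *)
Lemma prob_contain_avoid T D : [disjoint T & D] ->
  random_subset_prob p (fun S => (T \subset S) && [disjoint S & D]) = p ^+ #|T| * (1 - p) ^+ #|D|.
Proof.
move=> dis.
transitivity (\prod_v ((if v \in D then 0 else p) + (if v \in T then 0 else 1 - p))); last first.
  rewrite -!prodr_const (big_mkcond [in T]) (big_mkcond [in D]) -big_split /=.
  apply: eq_bigr => v _; case: (boolP (v \in T)) => vT.
    by rewrite (disjointFr dis vT) addr0 mulr1.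
  by case: ifP => _; rewrite ?add0r ?mul1r // addrC subrK.
rewrite bigA_distr /random_subset_prob big_mkcond /=; apply: eq_bigr => S _.
case: ifPn => [/andP[/subsetP TS SD]|].
  apply: eq_bigr => v _; case: ifPn => vS; first by rewrite (disjointFr SD vS).
  by case: ifPn => // /TS; rewrite (negPf vS).
rewrite negb_and => /orP[/subsetPn[v vT vS]|].
  by apply/esym; rewrite (bigD1 v) //= (negPf vS) vT mul0r.
rewrite disjoint_subset => /subsetPn[v vS]; rewrite !inE negbK => vD.
by apply/esym; rewrite (bigD1 v) //= vS vD mul0r.
Qed.

Lemma prob_contain T : random_subset_prob p (fun S => T \subset S) = p ^+ #|T|.
Proof.
have dis0 S : [disjoint S & set0] by rewrite disjoint_sym disjoints_subset sub0set.
have := prob_contain_avoid (dis0 T); rewrite cards0 mulr1 => <-.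
by apply: eq_bigl => S; rewrite dis0 andbT.
Qed.

Lemma prob_compl E : random_subset_prob p E + random_subset_prob p (fun S => ~~ E S) = 1.
Proof.
have := prob_contain set0; rewrite cards0 expr0 => <-.
rewrite /random_subset_prob [RHS](bigID E) /=; congr (_ + _).
  by apply: eq_bigl => S; rewrite sub0set.
by apply: eq_bigl => S; rewrite sub0set.
Qed.

Hypothesis p01 : 0 <= p <= 1.

Lemma prob_weight_ge0 S : 0 <= wt S.
Proof. by case/andP: p01 => ? ?; apply: prodr_ge0 => v _; case: ifP => _ //; lra. Qed.

Lemma prob_ge0 E : 0 <= random_subset_prob p E.
Proof. by apply: sumr_ge0 => S _; exact: prob_weight_ge0. Qed.

Lemma prob_union (I : finType) (P : pred I) E (B : I -> pred {set V}) :
  (forall S, E S -> exists2 x, P x & B x S) ->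
  random_subset_prob p E <= \sum_(x | P x) random_subset_prob p (B x).
Proof.
move=> EB; rewrite /random_subset_prob.
under [leRHS]eq_bigr do rewrite big_mkcond.
rewrite exchange_big big_mkcond /=; apply: ler_sum => S _.
have ge0 x : 0 <= (if B x S then wt S else 0) by case: ifP => // _; exact: prob_weight_ge0.
case: ifP => [/EB[x Px BxS]|_]; last by apply: sumr_ge0.
by rewrite (bigD1 x) //= BxS lerDl; apply: sumr_ge0.
Qed.

Lemma prob_mono E E' : (forall S, E S -> E' S) ->
  random_subset_prob p E <= random_subset_prob p E'.
Proof.
move=> EE; have := @prob_union 'I_1 xpredT E (fun=> E'); rewrite big_ord1; apply.
by move=> S /EE; exists ord0.
Qed.

(** A map [t] encodes [r] disjoint fingerprints at once, the value [ord0] marking vertices in none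
    of them. *)
Definition fp_dom r (t : {ffun V -> 'I_r.+1}) := [set v | t v != ord0].

(** Union bound over [t]. The restriction to size at most [m] is replaced by the weight
    [x ^+ #|fp_dom t| / x ^+ m], at least 1 there, after which the sum factors over the vertices. *)
Lemma prob_fingerprints r (m L : nat) E (D : {ffun V -> 'I_r.+1} -> {set V}) (x : R) :
  0 < x <= 1 ->
  (forall S, E S -> exists t, [/\ fp_dom t \subset S, (#|fp_dom t| <= m)%N,
     [disjoint S & D t] & (L <= #|D t|)%N]) ->
  random_subset_prob p E <= x ^- m * (1 + r%:R * (p * x)) ^+ #|V| * (1 - p) ^+ L.
Proof.
move=> /andP[x0 x1] HE; case/andP: p01 => p0 p1.
pose P (t : {ffun V -> 'I_r.+1}) :=
  [&& #|fp_dom t| <= m, L <= #|D t| & [disjoint fp_dom t & D t]]%N.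
apply: le_trans (prob_union (P := P)
  (B := fun t S => (fp_dom t \subset S) && [disjoint S & D t]) _) _.
  move=> S /HE[t [tS tm SD LD]]; exists t; last by rewrite tS.
  by rewrite /P tm LD /=; apply: disjointWl SD.
apply: le_trans (_ : \sum_(t : {ffun V -> 'I_r.+1}) x ^- m *
    \prod_v (if t v != ord0 then p * x else 1) * (1 - p) ^+ L <= _).
  rewrite [leRHS](bigID P) /= -[leLHS]addr0; apply: lerD; last first.
    apply: sumr_ge0 => t _; rewrite !mulr_ge0 ?invr_ge0 ?exprn_ge0 ?(ltW x0) //; last lra.
    by apply: prodr_ge0 => v _; case: ifP => _ //; rewrite mulr_ge0 // ltW.
  apply: ler_sum => t /and3P[tm LD dis]; rewrite prob_contain_avoid //.
  have -> : \prod_v (if t v != ord0 then p * x else 1) = (p * x) ^+ #|fp_dom t|.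
    rewrite -prodr_const [RHS]big_mkcond /=; apply: eq_bigr => v _.
    by rewrite inE.
  rewrite exprMn; apply: ler_pM; rewrite ?exprn_ge0 //; first by lra.
    rewrite mulrCA ler_peMr ?exprn_ge0 // -[leLHS](mulVf (_ : x ^+ m != 0)).
      rewrite ler_wpM2l ?invr_ge0 ?exprn_ge0 ?(ltW x0) //.
      by apply: ler_wiXn2l => //; exact: ltW.
    by rewrite expf_neq0 // gt_eqF.
  by apply: ler_wiXn2l => //; lra.
rewrite -mulr_suml -mulr_sumr -(bigA_distr_bigA (fun _ (j : 'I_r.+1) => if j != ord0 then p * x else 1)) /=.
rewrite prodr_const big_ord_recl /= (eq_bigr (fun=> p * x)) //.
by rewrite sumr_const card_ord -[X in 1 + X]mulr_natl.
Qed.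

End Probability.

(** * The one-statement for fixed n *)

Lemma count_enum_card (T : finType) (a : pred T) : count a (enum T) = #|[set z | a z]|.
Proof. by rewrite -sum1_count -sum1_card big_enum_cond; apply: eq_bigl => z; rewrite inE. Qed.

Section Solutions.
Variables (F : finFieldType) (k d n : nat) (Q : 'M[F]_(k, d)).
Notation V := 'rV[F]_n.
Notation N := (#|F| ^ n)%N.

Definition sol (z : 'M[F]_(d, n)) (i : 'I_k) : V := row i (Q *m z).

(** A sequence indexed by [z], so that an edge is counted once for each solution parametrising
    it. *)
Definition sol_edges : seq {set V} :=
  [seq [set sol z i | i : 'I_k] | z <- enum 'M[F]_(d, n) & injectiveb (sol z)].

Lemma card_points : #|{: V}| = N.
Proof. by rewrite card_mx mul1n. Qed.

Lemma points_gt0 : (0 < N)%N.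
Proof. by rewrite -card_points; apply/card_gt0P; exists 0. Qed.

Lemma sol_edges_size e : e \in sol_edges -> #|e| = k.
Proof.
case/mapP => z; rewrite mem_filter => /andP[/injectiveP zinj _] ->.
by rewrite card_imset // card_ord.
Qed.

Lemma card_sol_through t (g : 'I_t -> 'I_k) (y : 'I_t -> V) :
  (#|[set z | [forall j, sol z (g j) == y j]]| <= N ^ (d - \rank (rowsub g Q)))%N.
Proof.
apply: leq_trans (card_mulmx_eq (rowsub g Q) (\matrix_j y j)).
apply: subset_leq_card; apply/subsetP => z; rewrite !inE => /forallP zP.
apply/eqP/row_matrixP => j; rewrite rowK -(eqP (zP j)) /sol [LHS]row_mul [RHS]row_mul.
by rewrite row_rowsub.
Qed.

Variables (R : realFieldType) (p : R).
Hypothesis p01 : 0 < p <= 1.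
Hypothesis rank_bound : forall t (g : 'I_t -> 'I_k), (0 < t)%N -> injective g ->
  N%:R * (N ^ (d - \rank (rowsub g Q)))%:R <= p ^+ t.-1 * (N ^ d)%:R.

(** Each solution whose edge contains [T] assigns distinct coordinates to the elements of [T]. There
    are at most [k ^ k] assignments [g], and [rank_bound] treats each one. *)
Lemma sol_edges_codeg (T : {set V}) : T != set0 ->
  #|{: V}|%:R * (deg sol_edges T)%:R <= (k ^ k)%:R * p ^+ #|T|.-1 * (N ^ d)%:R.
Proof.
move=> T0; set t := #|T|; case/andP: p01 => p0 _.
have t0 : (0 < t)%N by rewrite card_gt0.
pose P (g : {ffun 'I_t -> 'I_k}) := injectiveb g.
have degle : (deg sol_edges T <= \sum_(g | P g) N ^ (d - \rank (rowsub g Q)))%N.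
  pose B g := [set z | [forall j, sol z (g j) == enum_val (j : 'I_t)]].
  apply: leq_trans (_ : #|\bigcup_(g | P g) B g| <= _)%N; last first.
    apply: leq_trans (leq_card_bigcup_le _ _) _; apply: leq_sum => g _.
    exact: card_sol_through.
  rewrite /deg /sol_edges count_map count_filter.
  rewrite count_enum_card.
  apply: subset_leq_card; apply/subsetP => z; rewrite inE /= => /andP[Tsub zinj].
  have /fin_all_exists[g gP] (j : 'I_t) : exists i : 'I_k, sol z i = enum_val j.
    have := enum_valP j => /(subsetP Tsub)/imsetP[i _ ->]; by exists i.
  apply/bigcupP; exists [ffun j => g j].
    apply/injectiveP => j1 j2; rewrite !ffunE => e.
    by apply: enum_val_inj; rewrite -!gP e.
  by rewrite inE; apply/forallP => j; rewrite ffunE gP.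
rewrite card_points; apply: le_trans (_ : N%:R * (\sum_(g | P g) N ^ (d - \rank (rowsub g Q)))%:R <= _).
  by rewrite ler_wpM2l ?ler0n // ler_nat.
rewrite natr_sum mulr_sumr -mulrA.
apply: le_trans (_ : \sum_(g | P g) p ^+ t.-1 * (N ^ d)%:R <= _).
  by apply: ler_sum => g /injectiveP ginj; apply: rank_bound.
rewrite sumr_const -[leLHS]mulr_natl; apply: ler_wpM2r.
  by rewrite mulr_ge0 ?exprn_ge0 ?ler0n // ltW.
rewrite ler_nat; have [tk|kt] := leqP t k.
  apply: leq_trans (max_card _) _; rewrite card_ffun !card_ord.
  have k0 : (0 < k)%N by apply: leq_trans tk.
  by rewrite leq_pexp2l.
rewrite eq_card0 // => g; rewrite !inE; apply/negP => /injectiveP/leq_card.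
by rewrite !card_ord leqNgt kt.
Qed.

Hypothesis rows_distinct : forall i j, i != j -> row i Q != row j Q.

Lemma card_noninj : (#|[set z | ~~ injectiveb (sol z)]| <= k ^ 2 * N ^ d.-1)%N.
Proof.
pose B (ij : 'I_k * 'I_k) := [set z : 'M[F]_(d, n) | (row ij.1 Q - row ij.2 Q) *m z == 0].
apply: leq_trans (_ : #|\bigcup_(ij | ij.1 != ij.2) B ij| <= _)%N.
  apply: subset_leq_card; apply/subsetP => z; rewrite inE => /injectivePn[i [j nij e]].
  apply/bigcupP; exists (i, j) => //; rewrite inE mulmxBl -!row_mul.
  by rewrite -[row i _]/(sol z i) e subrr.
apply: leq_trans (leq_card_bigcup_le _ _) _.
apply: leq_trans (_ : \sum_(ij : 'I_k * 'I_k) N ^ d.-1 <= _)%N; last first.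
  by rewrite sum_nat_const card_prod !card_ord.
rewrite big_mkcond; apply: leq_sum => -[i j] _ /=; case: ifP => // nij.
apply: leq_trans (card_mulmx_eq _ _) _; rewrite rank_rV subr_eq0 rows_distinct //.
by rewrite subn1.
Qed.

Variables (r n0 b J : nat).
Hypotheses (r0 : (0 < r)%N) (k0 : (0 < k)%N) (d0 : (0 < d)%N).
Hypothesis rows_nonzero : forall i, row i Q != 0.
Hypothesis ramsey : forall chi : 'rV[F]_n0 -> 'I_r,
  exists2 z : 'M_(d, n0), row_free z & exists c, forall i, chi (row i (Q *m z)) = c.
Hypothesis pb : p * N%:R <= b%:R.

(** With this value edges in the [r] containers account for a quarter of what supersaturation
    demands; [Nbig] leaves at most half to solutions with repeated entries. *)
Definition ramsey_eps : R := (8 * r * #|F| ^ (d * n0))%:R^-1.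

Hypothesis Jbig : 1 < J%:R * level_gain k ((k ^ k)%:R / ramsey_eps).
Hypothesis Nbig : (4 * #|F| ^ (d * n0) * r * k ^ 2 <= N)%N.

Lemma ramsey_eps_gt0 : 0 < ramsey_eps.
Proof.
by rewrite invr_gt0 ltr0n !muln_gt0 r0 expn_gt0; apply/orP; left; apply/card_gt0P; exists 0.
Qed.

(** If the uncovered set were smaller, supersaturation would put more solutions into the sets [C c]
    than the hypothesis and the degenerate ones allow. *)
Lemma uncovered_large (C : 'I_r -> {set V}) :
  (forall c, (size (sub_edges sol_edges (C c)))%:R < ramsey_eps * (N ^ d)%:R) ->
  (N %/ (2 * #|F| ^ n0) <= #|~: \bigcup_c C c|)%N.
Proof.
move=> small; set D := ~: _; rewrite leqNgt; apply/negP => ltD.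
have q0 : (0 < #|F|)%N by apply/card_gt0P; exists 0.
have h : (2 * #|F| ^ n0 * #|D| <= N)%N.
  rewrite mulnC -leq_divRL ?muln_gt0 ?expn_gt0 ?q0 //; exact: ltnW.
have := supersaturation (Ordinal r0) rows_nonzero k0 ramsey h.
have N0 := points_gt0.
set X := (\sum_c _)%N; set w := (#|F| ^ (d * n0))%N => sup.
have : (X%:R <= r%:R * (ramsey_eps * (N ^ d)%:R + (k ^ 2 * N ^ d.-1)%:R) :> R).
  set cst := ramsey_eps * _ + _.
  have -> : r%:R * cst = \sum_(c < r) cst by rewrite sumr_const card_ord mulr_natl.
  rewrite natr_sum; apply: ler_sum => c _; rewrite /cst.
  apply: le_trans (_ : (size (sub_edges sol_edges (C c)))%:R + (k ^ 2 * N ^ d.-1)%:R <= _).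
    rewrite -natrD ler_nat.
    apply: leq_trans (leq_add (leqnn _) card_noninj).
    have -> : size (sub_edges sol_edges (C c)) =
        #|[set z | injectiveb (sol z) && [forall i, sol z i \in C c]]|.
      rewrite /sub_edges /sol_edges size_filter count_map count_filter.
      rewrite count_enum_card; congr #|pred_of_set _|; apply/setP => z; rewrite !inE /= andbC.
      congr (_ && _); apply/subsetP/forallP => [sub i|sub v /imsetP[i _ ->] //].
      by apply: sub; rewrite imset_f.
    apply: leq_trans (leq_card_setU _ _).
    apply: subset_leq_card; apply/subsetP => z; rewrite !inE => ->.
    by rewrite andbT orbN.
  by rewrite lerD2r ltW.
have w0 : (0 < w)%N by rewrite expn_gt0 q0.
have Nd : (N ^ d = N * N ^ d.-1)%N by rewrite -expnS prednK.
have NdN : (0 < N ^ d)%N by rewrite expn_gt0 N0.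
move: sup Nbig; rewrite -/w -!(ler_nat R) !natrM => sup Nb.
rewrite mulrDr mulrA.
have -> : r%:R * ramsey_eps = (8 * w%:R)^-1.
  by rewrite /ramsey_eps -/w !natrM; field; rewrite !pnatr_eq0 -!lt0n w0 r0.
move=> Xlt.
have w0' : 0 < w%:R :> R by rewrite ltr0n.
have Nd0 : 0 < (N ^ d.-1)%:R :> R by rewrite ltr0n expn_gt0 N0.
have : 2 * w%:R * X%:R <= 2 * w%:R * ((8 * w%:R)^-1 * (N ^ d)%:R + r%:R * (k%:R * k%:R * (N ^ d.-1)%:R)) :> R.
  by rewrite ler_pM2l // mulr_gt0.
have -> : 2 * w%:R * ((8 * w%:R)^-1 * (N ^ d)%:R + r%:R * (k%:R * k%:R * (N ^ d.-1)%:R)) =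
  4^-1 * (N ^ d)%:R + 2^-1 * (4 * w%:R * r%:R * (k%:R * k%:R) * (N ^ d.-1)%:R) :> R.
  by field; rewrite gt_eqF.
have : 4 * w%:R * r%:R * (k%:R * k%:R) * (N ^ d.-1)%:R <= (N ^ d)%:R :> R.
  by rewrite Nd natrM ler_pM2r.
have : 0 < (N ^ d)%:R :> R by rewrite ltr0n.
lra.
Qed.

(** Containers are built at density [p], while the random set has density [q]. The threshold density
    can thus serve for every larger [q]. *)
Lemma prob_not_ramsey (E : pred {set V}) (q x : R) : 0 <= q <= 1 -> 0 < x <= 1 ->
  (forall S, E S -> exists chi : {ffun V -> 'I_r},
     forall z c, injective (sol z) -> ~ forall i, sol z i \in S /\ chi (sol z i) = c) ->
  random_subset_prob q E <=
    x ^- (r * (J * (k * b))) * (1 + r%:R * (q * x)) ^+ N * (1 - q) ^+ (N %/ (2 * #|F| ^ n0)).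
Proof.
move=> q01 x01 HE.
pose s := shrink p b k sol_edges (k ^ k)%:R (N ^ d)%:R ramsey_eps J setT.
have K0 : 0 < (k ^ k)%:R :> R by rewrite ltr0n expn_gt0 k0.
have M0 : 0 < (N ^ d)%:R :> R by rewrite ltr0n expn_gt0 points_gt0.
have pb' : p * #|{: V}|%:R <= b%:R by rewrite card_points.
have sP (I : {set V}) : (forall e, e \in sol_edges -> ~~ (e \subset I)) ->
    let: (P, C) := run s I in [/\ (#|P| <= J * (k * b))%N, I \subset C &
      (size (sub_edges sol_edges C))%:R < ramsey_eps * (N ^ d)%:R].
  move=> ind; apply: shrinkP => //.
  - exact: ramsey_eps_gt0.
  - exact: sol_edges_size.
  - exact: sol_edges_codeg.
  - rewrite cardsT ltr_pMl // card_points ltr0n; exact: points_gt0.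
pose cls (t : {ffun V -> 'I_r.+1}) (c : 'I_r) := [set v | t v == lift ord0 c].
pose D t := ~: \bigcup_c (run s (cls t c)).2.
rewrite -[X in (_ + _) ^+ X]card_points.
apply: (@prob_fingerprints _ _ _ q01 r _ _ E D x) => // S /HE[chi chiP].
pose I c := [set v in S | chi v == c].
have indI c e : e \in sol_edges -> ~~ (e \subset I c).
  case/mapP => z; rewrite mem_filter => /andP[/injectiveP zinj _] ->.
  apply/negP => /subsetP sub; apply: (chiP z c zinj) => i.
  have /sub : sol z i \in [set sol z i | i : 'I_k] by rewrite imset_f.
  by rewrite inE => /andP[? /eqP].
(* Colour classes are disjoint, so their fingerprints fit into one map. *)
pose t := [ffun v => if v \in (run s (I (chi v))).1 then lift ord0 (chi v) else ord0].
have clsE c : cls t c = (run s (I c)).1.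
  apply/setP => v; rewrite inE ffunE; case: ifPn => [vin|nin].
    rewrite (inj_eq (@lift_inj _ _)); apply/eqP/idP => [<- //|vin'].
    by have /subsetP/(_ v vin') := run_sub s (I c); rewrite inE => /andP[_ /eqP].
  apply/esym/negP => vin'; have /subsetP/(_ v vin') := run_sub s (I c).
  by rewrite inE => /andP[_ /eqP cE]; rewrite cE vin' in nin.
have runE c : run s (cls t c) = run s (I c).
  by rewrite clsE; apply: run_stable; rewrite ?run_sub.
exists t; have domE : fp_dom t = \bigcup_c (run s (I c)).1.
  apply/setP => v; rewrite inE ffunE; apply/idP/bigcupP => [|[c _ vin]].
    by case: ifP => [vin _|]; rewrite ?eqxx //; exists (chi v).
  have : v \in cls t c by rewrite clsE.
  by rewrite inE ffunE => /eqP ->; rewrite eq_sym neq_lift.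
split.
- rewrite domE; apply/bigcupsP => c _; apply: subset_trans (run_sub _ _) _.
  by apply/subsetP => v; rewrite inE => /andP[].
- rewrite domE; apply: leq_trans (leq_card_bigcup_le _ _) _.
  rewrite -[r in leqRHS]card_ord -sum_nat_const; apply: leq_sum => c _.
  by have := sP _ (@indI c); case: (run s (I c)) => P C [].
- rewrite /D -subsets_disjoint; apply/subsetP => v vS.
  apply/bigcupP; exists (chi v) => //; rewrite runE.
  have := sP _ (@indI (chi v)); case: (run s (I (chi v))) => P C /= [_ /subsetP IC _].
  by apply: IC; rewrite inE vS eqxx.
- apply: uncovered_large => c; rewrite runE.
  by have := sP _ (@indI c); case: (run s (I c)) => P C [].
Qed.

End Solutions.

(** * First moment of walks *)

Section FirstMoment.
Variables (F : finFieldType) (w d n : nat) (Q : 'M[F]_(w, d)).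
Notation V := 'rV[F]_n.
Notation N := (#|F| ^ n)%N.
Notation solQ := (@sol F w d n Q).
Implicit Types (Y Z S e : {set V}) (U : {set 'I_w}) (z : 'M[F]_(d, n)).

Definition rk U := \rank (rows_in Q U).

(* [excess U] is [w - 1] times the loss in the exponent of [|F|^n] caused by a new edge
   meeting the old vertices exactly in the coordinates [U]. *)
Definition excess U := ((w.-1 * (rk U).-1) - (d.-1 * #|U|.-1))%N.

Definition im z : {set V} := [set solQ z i | i : 'I_w].

Definition hit z Y : {set 'I_w} := [set i | solQ z i \in Y].

Definition edges_in S : {set {set V}} :=
  [set e : {set V} | (e \subset S) && [exists z, injectiveb (solQ z) && (e == im z)]].

(** As a set, an edge forgets its coordinates; one parametrisation is fixed so that losses can be
    read off from them. *)
Definition zof e := odflt 0 [pick z | injectiveb (solQ z) && (e == im z)].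

Definition walk_loss e Y := excess (hit (zof e) Y).

(** The steps range over all solutions and [S] is consulted only at the end, so the union bound can
    be applied step by step with [Y] and [Z] deterministic. *)
Fixpoint walk_event (fin : pred nat) (ms : seq bool) Y Z (c : nat) : pred {set V} := fun S =>
  if ms is m :: ms' then
    [exists z, [&& injectiveb (solQ z), step_ok m Y Z (im z) &
      walk_event fin ms' (im z :|: Y) (im z :\: Y) (c + excess (hit z Y))%N S]]
  else (Y \subset S) && fin c.

Lemma zofP S e : e \in edges_in S -> injectiveb (solQ (zof e)) /\ e = im (zof e).
Proof.
rewrite inE => /andP[_ /existsP[z zP]]; rewrite /zof.
by case: pickP => [z' /andP[? /eqP]|/(_ z)] //; rewrite zP.
Qed.

Lemma reach_walk_event (fin : pred nat) S ms Y Z c : Y \subset S ->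
  reach (edges_in S) walk_loss ms Y Z c (fun _ _ c => fin c) -> walk_event fin ms Y Z c S.
Proof.
elim: ms Y Z c => [|m ms IH] Y Z c YS /=; first by move=> ->; rewrite YS.
move=> [e eE [ok h]]; have [zinj eim] := zofP eE; apply/existsP; exists (zof e).
rewrite zinj -eim ok; apply: IH => //.
by rewrite subUset YS andbT; move: eE; rewrite inE => /andP[].
Qed.

Lemma card_im z : injectiveb (solQ z) -> #|im z| = w.
Proof. by move=> /injectiveP zi; rewrite card_imset // card_ord. Qed.

Lemma card_hit z Y : injectiveb (solQ z) -> #|im z :&: Y| = #|hit z Y|.
Proof.
move=> /injectiveP zi; rewrite -(card_imset _ zi); congr #|pred_of_set _|.
apply/setP => v; rewrite inE; apply/andP/imsetP => [[/imsetP[i _ ->] iY]|[i + ->]].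
  by exists i; rewrite ?inE.
by rewrite inE => iY; rewrite imset_f.
Qed.

Lemma card_im_new z Y : injectiveb (solQ z) -> (#|im z :|: Y| = (w - #|hit z Y|) + #|Y|)%N.
Proof.
move=> zi; have := cardsUI (im z) Y; rewrite card_hit // card_im // => h.
have : (#|hit z Y| <= w)%N by rewrite -[X in (_ <= X)%N]card_ord max_card.
move: h; move: #|im z :|: Y| #|hit z Y| #|Y| => a b c; lia.
Qed.

Lemma card_hit_in U Y : (#|[set z | [forall i in U, solQ z i \in Y]]| <= #|Y| ^ #|U| * N ^ (d - rk U))%N.
Proof.
pose G := [set \matrix_j y j | y : {ffun 'I_#|U| -> V} in ffun_on (mem Y)].
have cG : (#|G| <= #|Y| ^ #|U|)%N.
  by apply: leq_trans (leq_imset_card _ _) _; rewrite card_ffun_on card_ord.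
apply: leq_trans (_ : #|G| * N ^ (d - rk U) <= _)%N; last by rewrite leq_mul2r cG orbT.
apply: leq_trans (_ : #|[set z | rows_in Q U *m z \in G]| <= _)%N; last first.
  by apply: card_preimset_le => g _; exact: card_mulmx_eq.
apply: subset_leq_card; apply/subsetP => z; rewrite !inE => /forall_inP zP.
apply/imsetP; exists [ffun j => solQ z (enum_val j)].
  by apply/ffun_onP => j; rewrite ffunE; apply: zP; exact: enum_valP.
apply/row_matrixP => j; rewrite rowK ffunE /sol [LHS]row_mul [RHS]row_mul /rows_in.
by rewrite row_rowsub.
Qed.

Variables (R : realFieldType) (p c0 eta : R) (M : nat).
Hypotheses (p0 : 0 <= p <= 1) (c00 : 0 < c0 <= 1) (eta1 : 1 <= eta).
Hypotheses (dw : (d < w)%N) (d1 : (1 < d)%N).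
Hypothesis etaN : eta ^+ w.-1 = N%:R.
Hypothesis ple : p <= c0 * eta ^- d.-1.
Hypothesis rk_gt0 : forall U, U != set0 -> (0 < rk U)%N.
Hypothesis balanced : forall U, U != set0 -> (d.-1 * #|U|.-1 <= w.-1 * (rk U).-1)%N.

Let gam : R := w%:R ^+ 2 * c0 ^+ w.-1.
Let Gam : R := ((2 * M) ^ w)%:R.

Lemma rk_le U : (rk U <= d)%N.
Proof. exact: rank_leq_col. Qed.

(** Solutions are grouped by the coordinates [U] that hit old vertices. An unrestricted step chooses
    [U] and at most [M ^ w] old vertices; a cheap one chooses a single coordinate and one of at most
    [w] vertices of [Z], whence the constant [gam]. *)
Lemma sum_steps (m : bool) Y Z : (0 < M)%N -> (#|Y| <= M)%N -> (#|Z| <= w)%N ->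
  \sum_(z | injectiveb (solQ z) && step_ok m Y Z (im z))
    N%:R ^- (d - rk (hit z Y)) * c0 ^+ (w - #|hit z Y|) <= if m then Gam else gam.
Proof.
case/andP: c00 => c0_gt0 c0_le1 M0 YM Zw.
have N0 : 0 < N%:R :> R by rewrite ltr0n points_gt0.
pose P U := if m then U != set0 else #|U| == 1%N.
pose B := if m then Y else Z.
have hitP z : injectiveb (solQ z) && step_ok m Y Z (im z) ->
    P (hit z Y) && [forall i in hit z Y, solQ z i \in B].
  move=> /andP[zi]; rewrite /P /B /step_ok /meets_once; case: (m) => [|/andP[c1 sub]].
    rewrite -card_gt0 card_hit // card_gt0 => -> /=.
    by apply/forall_inP => i; rewrite inE.
  rewrite -card_hit // c1 /=; apply/forall_inP => i; rewrite inE => iY.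
  by apply: (subsetP sub); rewrite inE iY imset_f.
rewrite (partition_big (fun z => hit z Y) P) /=; last by move=> z /hitP/andP[].
apply: le_trans (_ : \sum_(U | P U) (#|B| ^ #|U|)%:R * c0 ^+ (w - #|U|) <= _).
  apply: ler_sum => U PU.
  rewrite (eq_bigr (fun=> N%:R ^- (d - rk U) * c0 ^+ (w - #|U|))); last by move=> z /andP[_ /eqP ->].
  rewrite sumr_const -[leLHS]mulr_natl mulrA ler_wpM2r ?exprn_ge0 ?(ltW c0_gt0) //.
  rewrite ler_pdivrMr ?exprn_gt0 // -natrX -natrM ler_nat.
  apply: leq_trans (card_hit_in U B); apply: subset_leq_card; apply/subsetP => z.
  by rewrite !inE => /andP[/hitP/andP[_ h] /eqP <-].
rewrite /P /B; case: (m).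
  apply: le_trans (_ : \sum_(U : {set 'I_w}) (M ^ w)%:R <= _); last first.
    by rewrite sumr_const -cardsT -powersetT card_powerset cardsT card_ord /Gam expnMn natrM mulr_natl.
  rewrite big_mkcond; apply: ler_sum => U _; case: ifP => // U0.
  rewrite -[leRHS]mulr1; apply: ler_pM; rewrite ?ler0n ?exprn_ge0 ?(ltW c0_gt0) //.
    rewrite ler_nat; apply: leq_trans (_ : M ^ #|U| <= _)%N; first by rewrite leq_exp2r ?card_gt0.
    by rewrite leq_pexp2l // -[X in (_ <= X)%N]card_ord max_card.
  by apply: exprn_ile1 => //; exact: ltW.
apply: le_trans (_ : \sum_(U : {set 'I_w} | #|U| == 1%N) w%:R * c0 ^+ w.-1 <= _).
  apply: ler_sum => U /eqP ->; rewrite expn1 subn1.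
  by rewrite ler_wpM2r ?exprn_ge0 ?(ltW c0_gt0) // ler_nat.
rewrite sumr_const /gam expr2 -[leRHS]mulrA -[leLHS]mulr_natl.
rewrite ler_wpM2r ?mulr_ge0 ?exprn_ge0 ?(ltW c0_gt0) ?ler0n // ler_nat.
apply: leq_trans (_ : #|[set [set i] | i : 'I_w]| <= _)%N.
  apply: subset_leq_card; apply/subsetP => U; rewrite unfold_in => /cards1P[i ->].
  by rewrite imset_f.
by apply: leq_trans (leq_imset_card _ _) _; rewrite card_ord.
Qed.

(* The bookkeeping identity behind [prob_walk_event]: with [eta ^+ w.-1 = N], a walk on
   [Y] with [k] free vectors and total excess [c] satisfies
   [eta ^- d.-1 ^+ #|Y| = eta ^+ (w - d) / eta ^+ c / N ^+ k]. *)
Lemma excess_step U : U != set0 ->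
  (w.-1 * (d - rk U) + excess U = d.-1 * (w - #|U|))%N.
Proof.
move=> U0; have h1 := balanced U0; have h2 := rk_gt0 U0; have h3 := rk_le U.
have h4 : (0 < #|U|)%N by rewrite card_gt0.
have h5 : (#|U| <= w)%N by rewrite -[X in (_ <= X)%N]card_ord max_card.
move: h1 h2 h3 h4 h5; rewrite /excess; move: (rk U) #|U| => a b.
case: a => // a; case: b => // b; move: dw d1; case: (w) => // w'; case: (d) => // d' /= _ _.
move=> h1 _ h3 _ h5; rewrite !subSS.
have -> : (w' * (d' - a) = w' * d' - w' * a)%N by rewrite mulnBr.
have -> : (d' * (w' - b) = w' * d' - d' * b)%N by rewrite mulnBr mulnC.
have : (w' * a <= w' * d')%N by rewrite leq_mul2l; apply/orP; right.
lia.
Qed.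

(** Here [k] counts the free vectors already summed over, and [kap] compares the surplus
    [eta ^+ (w - d)] with the loss at the end of the walk. *)
Lemma prob_walk_event (fin : pred nat) (kap : R) :
  0 <= kap -> (forall c, fin c -> eta ^+ (w - d) <= kap * eta ^+ c) ->
  forall ms Y Z c k, (w.-1 * k + c = (w - d) + d.-1 * #|Y|)%N ->
  (#|Y| + w * size ms <= M)%N -> (0 < M)%N -> (#|Z| <= w)%N ->
  random_subset_prob p (walk_event fin ms Y Z c) <=
    kap * c0 ^+ #|Y| * N%:R ^- k * (Gam ^+ count id ms * gam ^+ count negb ms).
Proof.
move=> kap0 kapP; case/andP: c00 => c0_gt0 c0_le1.
have N0 : 0 < N%:R :> R by rewrite ltr0n points_gt0.
have eta0 : 0 < eta by apply: lt_le_trans eta1.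
have Gam0 : 0 <= Gam by rewrite ler0n.
have gam0 : 0 <= gam by rewrite mulr_ge0 ?exprn_ge0 ?ler0n ?(ltW c0_gt0).
elim=> [|m ms IH] Y Z c k inv YM M0 Zw.
  rewrite /= !expr0 !mulr1; have [finc|nfin] := boolP (fin c); last first.
    rewrite [leLHS]big1; last by move=> S /andP[_].
    by rewrite !mulr_ge0 ?invr_ge0 ?exprn_ge0 ?(ltW c0_gt0) ?(ltW N0).
  apply: le_trans (_ : p ^+ #|Y| <= _).
    rewrite -(prob_contain p Y); apply: prob_mono => // S /=.
    by case/andP.
  apply: le_trans (_ : (c0 * eta ^- d.-1) ^+ #|Y| <= _).
    by apply: lerXn2r; rewrite ?nnegrE //; [case/andP: p0|rewrite mulr_ge0 ?invr_ge0 ?exprn_ge0 ?(ltW c0_gt0) ?(ltW eta0)].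
  rewrite exprMn mulrAC [leRHS]mulrC ler_wpM2l ?exprn_ge0 ?(ltW c0_gt0) //.
  rewrite -etaN -exprM exprVn -exprM.
  rewrite ler_pdivlMr ?exprn_gt0 // mulrC ler_pdivrMr ?exprn_gt0 //.
  rewrite -(ler_pM2r (exprn_gt0 c eta0)) -exprD inv exprD mulrAC.
  by rewrite ler_pM2r ?exprn_gt0 // kapP.
rewrite [walk_event _ _ _ _ _]/=.
pose P z := injectiveb (solQ z) && step_ok m Y Z (im z).
pose B z := walk_event fin ms (im z :|: Y) (im z :\: Y) (c + excess (hit z Y)).
apply: le_trans (prob_union p0 (P := P) (B := B) _) _.
  by move=> S /existsP[z /and3P[h1 h2 h3]]; exists z; rewrite ?/P ?h1.
set C := Gam ^+ count id ms * gam ^+ count negb ms.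
have C0 : 0 <= C by rewrite mulr_ge0 ?exprn_ge0.
apply: le_trans (_ : \sum_(z | P z) (kap * c0 ^+ #|Y| * N%:R ^- k * C) *
    (N%:R ^- (d - rk (hit z Y)) * c0 ^+ (w - #|hit z Y|)) <= _).
  apply: ler_sum => z /andP[zi ok].
  have hit0 : hit z Y != set0.
    rewrite -card_gt0 -card_hit //; move: ok; case: (m) => /=; first by rewrite -card_gt0.
    by case/andP => /eqP ->.
  apply: le_trans (IH _ _ _ (k + (d - rk (hit z Y)))%N _ _ _ _) _ => //.
  - rewrite card_im_new // !mulnDr -(excess_step hit0) addnACA inv -addnA.
    by congr (_ + _)%N; rewrite addnC.
  - rewrite card_im_new //; apply: leq_trans YM; rewrite /= mulnS.
    by rewrite [X in (X + _ <= _)%N]addnC -addnA leq_add2l leq_add2r leq_subr.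
  - by rewrite -(card_im zi) subset_leq_card // subsetDl.
  rewrite -/C card_im_new // !exprD invfM.
  have AC (x1 x2 x3 x4 x5 x6 : R) : x1 * (x2 * x3) * (x4 * x5) * x6 = x1 * x3 * x4 * x6 * (x5 * x2) by ring.
  by rewrite AC.
rewrite -mulr_sumr.
have Y_M : (#|Y| <= M)%N by apply: leq_trans YM; rewrite leq_addr.
apply: le_trans (_ : kap * c0 ^+ #|Y| * N%:R ^- k * C * (if m then Gam else gam) <= _).
  apply: ler_wpM2l; last exact: sum_steps.
  by rewrite !mulr_ge0 ?invr_ge0 ?exprn_ge0 ?(ltW c0_gt0) ?(ltW N0).
rewrite /C; case: (m) => /=; rewrite add1n add0n exprS -!mulrA !ler_wpM2l ?invr_ge0 ?exprn_ge0 ?(ltW c0_gt0) ?(ltW N0) //.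
  by rewrite mulrA mulrC.
by rewrite mulrC /gam expr2 -!mulrA.
Qed.

End FirstMoment.

Lemma reach_subset (V : finType) (EE EE' : {set {set V}}) loss ms Y Z c fin :
  EE' \subset EE -> reach EE' loss ms Y Z c fin -> reach EE loss ms Y Z c fin.
Proof.
move=> /subsetP sub; elim: ms Y Z c => [//|m ms IH] Y Z c /= [e /sub eE [ok h]].
by exists e => //; split => //; exact: IH.
Qed.

Fact pred_split w d : (d < w)%N -> (1 < d)%N -> w.-1 = ((w - d) + d.-1)%N.
Proof. lia. Qed.

Fact walk_length (a b t n : nat) : (a < 5)%N -> (b < 5)%N -> (t < n.+1)%N ->
  (a + (t + b) <= (n + 9).-1)%N /\ (a + b <= 8)%N.
Proof. lia. Qed.

(** * Expected number of bad walks *)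

Section Noncolourable.
Variables (F : finFieldType) (w d n : nat) (Q : 'M[F]_(w, d)).
Notation N := (#|F| ^ n)%N.
Variables (R : realFieldType) (p c0 eta : R).
Hypotheses (p0 : 0 <= p <= 1) (c00 : 0 < c0 <= 1) (eta1 : 1 <= eta) (n_gt0 : (0 < n)%N).
Hypotheses (w3 : (3 <= w)%N) (dw : (d < w)%N) (d1 : (1 < d)%N).
Hypothesis etaN : eta ^+ w.-1 = N%:R.
Hypothesis ple : p <= c0 * eta ^- d.-1.
Hypothesis rk1 : forall i, rk Q [set i] = 1%N.
Hypothesis rk2 : forall U : {set 'I_w}, #|U| = 2%N -> rk Q U = 2%N.
Hypothesis strictly_balanced : forall U : {set 'I_w}, (1 < #|U| < w)%N ->
  (d.-1 * #|U|.-1 < w.-1 * (rk Q U).-1)%N.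
Hypothesis rk_full : rk Q setT = d.
Let M := (w * (n + 9))%N.
Let Gam : R := ((2 * M) ^ w)%:R.
Let gam : R := w%:R ^+ 2 * c0 ^+ w.-1.
Hypothesis gam1 : gam <= 1.

Let rk_gt0 (U : {set 'I_w}) : U != set0 -> (0 < rk Q U)%N.
Proof.
case/set0Pn => i iU; rewrite -(rk1 i).
apply: mxrankS; apply/row_subP => j; rewrite row_rowsub.
have := enum_valP j; rewrite inE => /eqP ->.
have <- : row (enum_rank_in iU i) (rows_in Q U) = row i Q.
  by rewrite row_rowsub enum_rankK_in.
exact: row_sub.
Qed.

Let balanced (U : {set 'I_w}) : U != set0 -> (d.-1 * #|U|.-1 <= w.-1 * (rk Q U).-1)%N.
Proof.
move=> U0; have [lt1|gt1] := leqP #|U| 1.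
  have -> : #|U|.-1 = 0%N by case: #|U| lt1 => [|[]].
  by rewrite muln0.
have [ltw|ge] := ltnP #|U| w; first by rewrite ltnW // strictly_balanced // gt1.
have -> : U = setT by apply/eqP; rewrite eqEcard subsetT cardsT card_ord.
by rewrite rk_full cardsT card_ord mulnC.
Qed.

Lemma noncolourable_walk (S : {set 'rV[F]_n}) : ~~ colourable (edges_in Q S) ->
  exists (v : 'rV[F]_n) (a : 'I_5) (t : 'I_n.+1) (b : 'I_5),
    walk_event Q (fun c => ((t == n :> nat) && (b == 0%N :> nat)) || (w - d < c)%N)
      (nseq a true ++ nseq t false ++ nseq b true) [set v] [set v] 0 S.
Proof.
move=> /minimal_noncolourable[EE [sub ncol mincol]].
have inE e : e \in EE -> e \in edges_in Q S by exact: (subsetP sub).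
have szE e : e \in EE -> #|e| = w.
  by move=> /inE/zofP[zi ->]; rewrite card_im.
have hitE e Y : e \in EE -> #|hit Q (zof Q e) Y| = #|e :&: Y|.
  by move=> /inE/zofP[zi eim]; rewrite -card_hit // -eim.
have pot0 : (0 < w - d)%N by rewrite subn_gt0.
have lossp e Y : e \in EE -> #|e :&: Y| = 2%N -> (w - d <= walk_loss Q e Y)%N.
  move=> eE e2; rewrite /walk_loss /excess hitE // rk2 ?hitE // e2 /= !muln1.
  by move: dw d1; case: (w) => // w'; case: (d) => // d' _ _; rewrite subSS.
have loss0 e Y : e \in EE -> (2 <= #|e :&: Y| < w)%N -> (0 < walk_loss Q e Y)%N.
  move=> eE h; rewrite /walk_loss /excess subn_gt0; apply: strictly_balanced.
  by rewrite hitE.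
have crit e v : e \in EE -> v \in e -> exists2 e', e' \in EE & e :&: e' = [set v].
  move=> eE; apply: critical_edge => //; last exact: mincol.
  by move=> e' /szE ->; apply: leq_trans w3.
have [v [a [t [b [[a4 tn b4] h]]]]] :=
  noncolourable_bad_walk w3 szE pot0 lossp loss0 crit ncol mincol n.
have a5 : (a < 5)%N by []. have b5 : (b < 5)%N by []. have tn' : (t < n.+1)%N by [].
exists v, (Ordinal a5), (Ordinal tn'), (Ordinal b5).
apply: reach_walk_event; last first.
  apply: (reach_subset sub); apply: reach_impl h => Y Z c /= [[-> ->]|->].
    by rewrite !eqxx.
  by rewrite orbT.
(* The start [v] lies in [S] because the first edge meets it; an empty walk is not bad, as [n] is
   positive and its loss is 0. *)
have first_in ms fin : ms != [::] ->
    reach EE (walk_loss Q) ms [set v] [set v] 0 fin -> v \in S.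
  case: ms => // m ms _ /= [e eE [ok _]].
  have eS : e \subset S by have := inE e eE; rewrite finset.inE => /andP[].
  apply: (subsetP eS); move: ok.
  have : e :&: [set v] != set0 -> v \in e.
    by case/set0Pn => x; rewrite !finset.inE => /andP[xe /eqP <-].
  case: (m) => //= hv /andP[/eqP c1 _]; apply: hv.
  by rewrite -card_gt0 c1.
rewrite sub1set; have [ms0|ms0] := eqVneq (nseq a true ++ nseq t false ++ nseq b true) [::]; last first.
  exact: first_in ms0 h.
move: h ms0; case: (a) => //; case: (t) => //; case: (b) => //= -[[n0 _]|//].
by exfalso; move: n_gt0; rewrite -n0.
Qed.

Lemma prob_noncolourable :
  random_subset_prob p (fun S : {set 'rV[F]_n} => ~~ colourable (edges_in Q S)) <=
  (25 * n.+1)%:R * (Gam ^+ 8 * (eta^-1 + N%:R * gam ^+ n)).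
Proof.
case/andP: (c00) => c0_gt0 c0_le1.
have N0 : 0 < N%:R :> R by rewrite ltr0n points_gt0.
have eta0 : 0 < eta by apply: lt_le_trans eta1.
have gam0 : 0 <= gam by rewrite mulr_ge0 ?exprn_ge0 ?ler0n ?(ltW c0_gt0).
have M0 : (0 < M)%N by rewrite muln_gt0 addn_gt0 orbT andbT (leq_trans _ w3).
have Gam1 : 1 <= Gam by rewrite ler1n expn_gt0 muln_gt0 M0.
pose I := ('rV[F]_n * ('I_5 * ('I_n.+1 * 'I_5)))%type.
pose fin (t b : nat) (c : nat) := ((t == n :> nat) && (b == 0%N :> nat)) || (w - d < c)%N.
pose B (x : I) := walk_event Q (fin x.2.2.1 x.2.2.2)
  (nseq x.2.1 true ++ nseq x.2.2.1 false ++ nseq x.2.2.2 true) [set x.1] [set x.1] 0.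
apply: le_trans (prob_union p0 (P := xpredT) (B := B) _) _.
  by move=> S /noncolourable_walk[v [a [t [b h]]]]; exists (v, (a, (t, b))).
apply: le_trans (_ : \sum_(x : I) N%:R^-1 * (Gam ^+ 8 * (eta^-1 + N%:R * gam ^+ n)) <= _); last first.
  rewrite sumr_const !card_prod !card_ord card_points -[leLHS]mulr_natl !natrM mulrA.
  have h (x y z : R) : 0 < x -> x * (5 * (y * 5)) / x * z = 25 * y * z by move=> x0; field; rewrite gt_eqF.
  by rewrite h.
apply: ler_sum => -[v [a [t b]]] _; rewrite /B /=.
pose long := (t == n :> nat) && (b == 0%N :> nat).
(* Long paths keep the surplus and rely on [gam ^+ n]; heavy walks have loss at least [w - d + 1],
   which leaves [eta^-1]. *)
pose kap : R := if long then eta ^+ (w - d) else eta^-1.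
have kap0 : 0 <= kap by rewrite /kap; case: ifP => _; rewrite ?invr_ge0 ?exprn_ge0 ?(ltW eta0).
have kapP c : fin t b c -> eta ^+ (w - d) <= kap * eta ^+ c.
  rewrite /fin /kap -/long; case: (boolP long) => [_ _|_ /= lt].
    by rewrite ler_peMr ?exprn_ge0 ?(ltW eta0) // exprn_ege1.
  rewrite mulrC ler_pdivlMr // -exprSr; exact: ler_weXn2l.
have inv : (w.-1 * 1 + 0 = (w - d) + d.-1 * #|[set v]|)%N.
  by rewrite cards1 !muln1 addn0; exact: pred_split.
have szM : (#|[set v]| + w * size (nseq a true ++ nseq t false ++ nseq b true) <= M)%N.
  rewrite cards1 !size_cat !size_nseq /M.
  apply: leq_trans (_ : w * (n + 9).-1 + w <= _)%N; last by rewrite -mulnSr prednK ?addn_gt0 ?orbT.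
  rewrite addnC; apply: leq_add; last by apply: leq_trans w3.
  rewrite leq_mul2l; apply/orP; right.
  by have [] := walk_length (ltn_ord a) (ltn_ord b) (ltn_ord t).
have Zw : (#|[set v]| <= w)%N by rewrite cards1 (leq_trans _ w3).
apply: le_trans (prob_walk_event p0 c00 eta1 dw d1 etaN ple rk_gt0 balanced kap0 kapP inv szM M0 Zw) _.
rewrite cards1 expr1 -/Gam -/gam.
have cnt1 : count id (nseq a true ++ nseq t false ++ nseq b true) = (a + b)%N.
  by rewrite !count_cat !count_nseq /= mul0n !mul1n.
have cnt2 : count negb (nseq a true ++ nseq t false ++ nseq b true) = t.
  by rewrite !count_cat !count_nseq /= !mul0n mul1n addn0.
rewrite cnt1 cnt2 [kap * c0 * _]mulrC -mulrA ler_wpM2l ?invr_ge0 ?(ltW N0) //.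
apply: le_trans (_ : kap * (Gam ^+ 8 * gam ^+ t) <= _).
  rewrite -mulrA ler_wpM2l //; apply: le_trans (_ : Gam ^+ (a + b) * gam ^+ t <= _).
    by rewrite ler_piMl // mulr_ge0 ?exprn_ge0 ?ler0n.
  rewrite ler_wpM2r ?exprn_ge0 //; apply: ler_weXn2l => //.
  by have [] := walk_length (ltn_ord a) (ltn_ord b) (ltn_ord t).
rewrite mulrCA ler_wpM2l ?exprn_ge0 ?ler0n // /kap.
case: (boolP long) => [/andP[/eqP -> _]|_].
  rewrite -[leLHS]add0r lerD ?invr_ge0 ?(ltW eta0) // ler_wpM2r ?exprn_ge0 //.
  by rewrite -etaN; apply: ler_weXn2l => //; rewrite (pred_split dw d1) leq_addr.
rewrite -[leLHS]addr0 lerD ?mulr_ge0 ?exprn_ge0 ?ler0n //.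
by rewrite ler_piMr ?invr_ge0 ?(ltW eta0) // exprn_ile1.
Qed.

End Noncolourable.

(** * The critical set of coordinates *)

Section RowRanks.
Variable F : finFieldType.

Lemma rank_rowsub k d t (P : 'M[F]_(k, d)) (g : 'I_t -> 'I_k) :
  \rank (rowsub g P) = \rank (rows_in P (g @: 'I_t)).
Proof.
apply/eqP; rewrite eqn_leq; apply/andP; split; apply: mxrankS; apply/row_subP => j.
  have gj : g j \in g @: 'I_t by rewrite imset_f.
  have <- : row (enum_rank_in gj (g j)) (rows_in P (g @: 'I_t)) = row j (rowsub g P).
    by rewrite !row_rowsub enum_rankK_in.
  exact: row_sub.
have /imsetP[i _ gi] := enum_valP j.
have -> : row j (rows_in P (g @: 'I_t)) = row i (rowsub g P) by rewrite !row_rowsub gi.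
exact: row_sub.
Qed.

Lemma rank_rows_in_mono k d (P : 'M[F]_(k, d)) (U W : {set 'I_k}) : U \subset W ->
  (\rank (rows_in P U) <= \rank (rows_in P W))%N.
Proof.
move=> /subsetP UW; apply: mxrankS; apply/row_subP => j.
have jW : enum_val j \in W := UW _ (enum_valP j).
have -> : row j (rows_in P U) = row (enum_rank_in jW (enum_val j)) (rows_in P W).
  by rewrite !row_rowsub enum_rankK_in.
exact: row_sub.
Qed.

Lemma rowsub_mul k d e t (P : 'M[F]_(k, d)) (B : 'M[F]_(d, e)) (g : 'I_t -> 'I_k) :
  rowsub g P *m B = rowsub g (P *m B).
Proof. by apply/row_matrixP => j; rewrite row_mul !row_rowsub row_mul. Qed.

(** Projecting solutions to [W] leaves only [\rank (rows_in P W)] free vectors; this basis has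
    exactly that many columns. *)
Definition restricted_basis k d (P : 'M[F]_(k, d)) (W : {set 'I_k}) := col_base (rows_in P W).

Lemma rk_restricted k d (P : 'M[F]_(k, d)) (W : {set 'I_k}) (U : {set 'I_#|W|}) :
  rk (restricted_basis P W) U = \rank (rows_in P (enum_val @: U)).
Proof.
rewrite /rk -(mxrankMfree _ (row_base_free (rows_in P W))) /rows_in rowsub_mul mulmx_base.
rewrite -/(rows_in P (enum_val @: U)).
have -> : rowsub (fun j : 'I_#|U| => enum_val j) (rowsub (fun j : 'I_#|W| => enum_val j) P) =
    rowsub (fun j : 'I_#|U| => enum_val (enum_val j : 'I_#|W|)) P.
  by apply/row_matrixP => j; rewrite !row_rowsub.
rewrite rank_rowsub; congr (\rank (rows_in P _)); apply/setP => i.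
apply/imsetP/imsetP => [[j _ ->]|[x xU ->]]; first by exists (enum_val j); rewrite // enum_valP.
by exists (enum_rank_in xU x); rewrite // enum_rankK_in.
Qed.

Lemma sol_restricted k d n (P : 'M[F]_(k, d)) (W : {set 'I_k}) (z : 'M[F]_(d, n)) (i : 'I_#|W|) :
  sol (restricted_basis P W) (row_base (rows_in P W) *m z) i = sol P z (enum_val i).
Proof. by rewrite /sol mulmxA mulmx_base /rows_in rowsub_mul row_rowsub. Qed.

End RowRanks.

(** * Ranks of kernel rows and the choice of the critical set *)

Section Balanced.
Variables (R : realFieldType) (F : finFieldType) (l k : nat) (A : 'M[F]_(l, k)).
Hypotheses (l_gt0 : (0 < l)%N) (full_rank : \rank A = l) (cols : columns_condition A).
Variable n1 : nat.
Hypothesis irr : irredundant A n1.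

Notation P := (null_basis A).
Notation D U := (\rank (rows_in P U)).

Lemma null_row_neq0 i : row i P != 0.
Proof.
have [m [B [blk [AB BP]]]] := columns_kernel cols.
have [Y BE] := null_basisP AB; have [_ B1] := BP i.
apply/eqP => r0; have : row i B = 0 by rewrite BE row_mul r0 mul0mx.
by move/rowP/(_ (blk i)); rewrite !mxE B1 => /eqP; rewrite oner_eq0.
Qed.

Lemma null_rank1 i : D [set i] = 1%N.
Proof.
have -> : [set i] = (fun _ : 'I_1 => i) @: 'I_1.
  apply/setP => j; rewrite inE; apply/eqP/imsetP => [->|[? _ ->] //]; by exists ord0.
by rewrite -rank_rowsub rank_rV; have -> : rowsub (fun=> i) P = row i P by [];
   rewrite ?null_row_neq0 //; apply/row_matrixP => j; rewrite row_rowsub !ord1 row_id.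
Qed.

Lemma null_rank2 (U : {set 'I_k}) : #|U| = 2%N -> D U = 2%N.
Proof.
move=> /eqP/cards2P[i [j [nij ->]]].
pose g (a : 'I_2) := if a == 0 then i else j.
have -> : [set i; j] = g @: 'I_2.
  apply/setP => x; rewrite !inE; apply/orP/imsetP => [[/eqP ->|/eqP ->]|[a _ ->]].
  - by exists 0.
  - by exists 1.
  - by rewrite /g; case: ifP; rewrite eqxx; [left|right].
rewrite -rank_rowsub; apply/eqP; rewrite -/(row_free _) -kermx_eq0.
apply/rowV0P => v /sub_kermxP; rewrite mulmx_sum_row !big_ord_recl big_ord0 addr0 !row_rowsub.
rewrite /g /= => /(null_basis_pair cols irr nij)[v0 v1].
by apply/rowP => -[[|[|//]] lt2]; rewrite [RHS]mxE; [rewrite -[RHS]v0|rewrite -[RHS]v1];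
   congr (v 0 _); apply: val_inj.
Qed.

Lemma null_rank_ge2 (U : {set 'I_k}) : (2 <= #|U|)%N -> (2 <= D U)%N.
Proof.
case/card_gt1P => x [y [xU yU nxy]]; rewrite -(@null_rank2 [set x; y]) ?cards2 ?nxy //.
by apply: rank_rows_in_mono; rewrite subUset !sub1set xU.
Qed.

Lemma null_rankT : D setT = null_dim A.
Proof.
have e : (D setT + l = k)%N.
  rewrite rows_in_null_rank // cardsT card_ord -[RHS]addn0; congr (_ + _)%N; apply/eqP; rewrite -leqn0.
  by apply: leq_trans (rank_leq_col _) _; rewrite setCT cards0.
have dE := null_dimE A; rewrite full_rank in dE.
exact: etrans (canRL (addnK l) e) (esym dE).
Qed.

Lemma null_dims : (2 <= null_dim A < k)%N.
Proof.
have k1 : (0 < k)%N.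
  have [m [C [/(_ ord0) C0 _ _ _ _]]] := cols; have /set0Pn[i _] := C0.
  exact: leq_ltn_trans (leq0n i) (ltn_ord i).
have lk : (l <= k)%N by rewrite -full_rank rank_leq_col.
have dE : null_dim A = (k - l)%N by rewrite null_dimE full_rank.
have d1 : (1 <= null_dim A)%N.
  by rewrite -null_rankT -(null_rank1 (Ordinal k1)); apply: rank_rows_in_mono; rewrite subsetT.
have k2 : (2 <= k)%N by lia.
have : (2 <= D setT)%N by apply: null_rank_ge2; rewrite cardsT card_ord.
rewrite null_rankT; lia.
Qed.

(** The rank identity of [rows_in_null_rank] turns the denominator into the rank of the kernel rows
    in [U], minus 1. *)
Lemma m_ratioE (U : {set 'I_k}) : (2 <= #|U|)%N ->
  m_ratio R A U = (#|U|.-1)%:R / ((D U).-1)%:R.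
Proof.
move=> U2; have D2 := null_rank_ge2 U2; have := rows_in_null_rank U full_rank.
rewrite /m_ratio full_rank; move: #|U| U2 (D U) D2 (\rank (cols_outside A U)) => u u2 b b2 a e.
have e' : b%:R + l%:R = u%:R + a%:R :> R by rewrite -!natrD e.
case: b b2 e e' => // b _ e e'; case: u u2 e e' => // u _ e e'; rewrite /=.
by congr (_ / _); move: e'; rewrite -!natr1; lra.
Qed.

(** Maximality of the ratio gives the weak inequality for all [U]; minimal size among the maximisers
    makes it strict for smaller [U]. *)
Lemma critical_set : exists W : {set 'I_k},
  [/\ (3 <= #|W|)%N, (1 < D W < #|W|)%N, m_F R A = (#|W|.-1)%:R / ((D W).-1)%:R,
      forall U : {set 'I_k}, (2 <= #|U|)%N -> ((D W).-1 * #|U|.-1 <= #|W|.-1 * (D U).-1)%N &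
      forall U : {set 'I_k}, (1 < #|U| < #|W|)%N -> ((D W).-1 * #|U|.-1 < #|W|.-1 * (D U).-1)%N].
Proof.
pose big (U : {set 'I_k}) := (2 <= #|U|)%N.
have /andP[dim2 dimk] := null_dims.
have bigT : big setT by rewrite /big cardsT card_ord; apply: leq_trans dim2 (ltnW dimk).
have [W0 W0big W0max] : exists2 W, big W & forall U, big U -> m_ratio R A U <= m_ratio R A W.
  by case: (arg_maxP (m_ratio R A) bigT) => W ? ?; exists W.
pose opt U := big U && (m_ratio R A U == m_ratio R A W0).
have optW0 : opt W0 by rewrite /opt W0big eqxx.
have [W /andP[Wbig /eqP Wopt] Wmin] : exists2 W, opt W & forall U, opt U -> (#|W| <= #|U|)%N.
  by case: (arg_minnP (fun U : {set 'I_k} => #|U|) optW0) => W ? ?; exists W.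
have cmp U : big U ->
    (m_ratio R A U <= m_ratio R A W) = ((D W).-1 * #|U|.-1 <= #|W|.-1 * (D U).-1)%N.
  move=> Ubig; rewrite !m_ratioE //; have := null_rank_ge2 Ubig; have := null_rank_ge2 Wbig.
  move: (D U) (D W) => [//|a] [//|b] /= b1 a1.
  by rewrite ler_pdivrMr ?ltr0n // mulrAC ler_pdivlMr ?ltr0n // -!natrM ler_nat mulnC.
have Wmax U : big U -> ((D W).-1 * #|U|.-1 <= #|W|.-1 * (D U).-1)%N.
  by move=> Ubig; rewrite -cmp // Wopt W0max.
have W2 := null_rank_ge2 Wbig.
(* The full set has ratio [(k - 1) / (null_dim A - 1)], which exceeds 1 since [l] is positive; so
   does the maximum. *)
have DW : (D W < #|W|)%N.
  have := Wmax _ bigT; rewrite null_rankT cardsT card_ord.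
  move: W2 Wbig dim2 dimk; rewrite /big; move: (D W) => a; move: #|W| (null_dim A) => b c.
  case: (k) => [|k'] a2 b2 c2 ck h; first by lia.
  have : (a.-1 * k' < b.-1 * k')%N.
    by apply: leq_ltn_trans h _; rewrite ltn_mul2l; lia.
  rewrite ltn_mul2r; lia.
exists W; split=> //; first by lia.
- by rewrite W2.
- rewrite -m_ratioE // Wopt; apply: le_anti; apply/andP; split.
    by apply: bigmax_le => [|U Ubig]; apply: W0max.
  exact: le_bigmax_cond.
- move=> U /andP[U1 UW]; rewrite ltn_neqAle Wmax // andbT; apply/eqP => e.
  have : opt U.
    rewrite /opt /big U1 -Wopt eq_le cmp // e leqnn /=.
    rewrite !m_ratioE //; have := null_rank_ge2 U1; have := null_rank_ge2 Wbig.
    move: e; move: (D U) (D W) => [//|a] [//|b] /= e b1 a1.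
    by rewrite ler_pdivrMr ?ltr0n // mulrAC ler_pdivlMr ?ltr0n // -!natrM ler_nat -e mulnC.
  by move/Wmin; rewrite leqNgt UW.
Qed.

(** A proper two-colouring of the edges, used as an [r]-colouring, admits no monochromatic solution,
    since its [W]-part would be a monochromatic edge. *)
Lemma rado_noncolourable (r n : nat) (W : {set 'I_k}) (S : {set 'rV[F]_n}) : (2 <= r)%N ->
  rado A r S -> ~~ colourable (edges_in (restricted_basis P W) S).
Proof.
move=> r2 /forallP rS; apply/negP => /existsP[X /forall_inP pX].
have r1 : (0 < r)%N by apply: leq_trans r2.
pose c1 : 'I_r := Ordinal r1; pose c2 : 'I_r := Ordinal r2.
pose chi := [ffun v => if v \in X then c1 else c2].
have /existsP[x /and4P[/injectiveP xinj /forallP xS xsol /existsP[c /forallP xc]]] := rS chi.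
have Ax : A *m (\matrix_j x j) = 0.
  apply/row_matrixP => h; rewrite row0 row_mul mulmx_sum_row.
  have /forallP/(_ h)/eqP xs := xsol; rewrite -[RHS]xs; apply: eq_bigr => g _.
  by rewrite rowK mxE.
have [z zE] := null_basisP Ax.
have xz i : sol P z i = x i by rewrite /sol -zE rowK.
pose z' := row_base (rows_in P W) *m z.
have z'E i : sol (restricted_basis P W) z' i = x (enum_val i) by rewrite sol_restricted xz.
have /pX/andP[] : im (restricted_basis P W) z' \in edges_in (restricted_basis P W) S.
  rewrite inE; apply/andP; split.
    by apply/subsetP => v /imsetP[i _ ->]; rewrite z'E.
  apply/existsP; exists z'; rewrite eqxx andbT; apply/injectiveP => i j.
  by rewrite !z'E => /xinj/enum_val_inj.
have mono i : (x i \in X) = (c == c1).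
  by rewrite -(eqP (xc i)) ffunE; case: ifP.
move=> n1' n2'; have [cc|cc] := boolP (c == c1).
  by case/negP: n1'; apply/subsetP => v /imsetP[i _ ->]; rewrite z'E mono.
by case/negP: n2'; apply/subsetP => v /imsetP[i _ ->]; rewrite z'E inE mono.
Qed.

Lemma not_rado_colouring (r n : nat) (S : {set 'rV[F]_n}) : ~~ rado A r S ->
  exists chi : {ffun 'rV[F]_n -> 'I_r},
    forall z c, injective (sol P z) -> ~ forall i, sol P z i \in S /\ chi (sol P z i) = c.
Proof.
rewrite negb_forall => /existsP[chi /existsPn H]; exists chi => z c zinj zc.
have /negP[] := H [ffun i => sol P z i]; apply/and4P; split.
- by apply/injectiveP => i j; rewrite !ffunE => /zinj.
- by apply/forallP => i; rewrite ffunE; case: (zc i).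
- apply/forallP => i; apply/eqP.
  have /(congr1 (row i)) : A *m (P *m z) = 0 by rewrite mulmxA mul_null_basis mul0mx.
  rewrite row0 row_mul mulmx_sum_row => e; rewrite -[RHS]e; apply: eq_bigr => j _.
  by rewrite ffunE mxE.
- apply/existsP; exists c; apply/forallP => i; rewrite ffunE.
  by case: (zc i) => _ ->.
Qed.

End Balanced.

From mathcomp Require Import all_classical all_reals all_analysis.

Import Order.TTheory GRing.Theory Num.Theory.
Import numFieldNormedType.Exports.
Local Open Scope classical_set_scope.
Local Open Scope ring_scope.

(** * The threshold *)

Section Asymptotics.
Variable R : realType.

Lemma mul_geometric_le (x : R) (j : nat) : 0 < x < 1 -> j%:R * x ^+ j * (1 - x) <= 1 - x ^+ j.
Proof.
move=> /andP[x0 x1]; elim: j => [|j IH]; first by rewrite mul0r mul0r expr0 subrr.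
have xj : 0 <= x ^+ j <= 1 by rewrite exprn_ge0 ?exprn_ile1 // ltW.
rewrite exprS -natr1; move: xj IH; move: (x ^+ j) (j%:R : R) => y a /andP[y0 y1] IH.
have : x * (a * y * (1 - x)) <= x * (1 - y) by rewrite ler_pM2l.
have : 0 <= (1 - x) * (1 - x * y).
  by rewrite mulr_ge0 ?subr_ge0 ?(ltW x1) // mulr_ile1 // ltW.
nra.
Qed.

(** With [x] the root of order [K + 1] of [rho], each factor [(n + 9) * x ^+ n] is bounded and one
    factor [x ^+ n] is left over. *)
Lemma poly_geometric_cvg0 (K : nat) (rho : R) : 0 < rho < 1 ->
  (n + 9)%:R ^+ K * rho ^+ n @[n --> \oo] --> (0 : R).
Proof.
move=> /andP[rho0 rho1].
pose x := rho `^ (K.+1%:R^-1).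
have x0 : 0 < x by exact: powR_gt0.
have xK : x ^+ K.+1 = rho.
  by rewrite -powR_mulrn ?(ltW x0) // -powRrM mulVf ?pnatr_eq0 // powRr1 // ltW.
have x1 : x < 1.
  rewrite ltNge; apply/negP => x1; have := exprn_ege1 K.+1 x1.
  by rewrite xK leNgt rho1.
pose B := x ^- 9 / (1 - x).
have x1' : 0 < 1 - x by rewrite subr_gt0.
have B0 : 0 <= B by rewrite divr_ge0 ?invr_ge0 ?exprn_ge0 // ltW.
have Bn n : (n + 9)%:R * x ^+ n <= B.
  rewrite /B ler_pdivlMr // -[leRHS]mul1r ler_pdivlMr ?exprn_gt0 //.
  have := @mul_geometric_le x (n + 9); rewrite x0 x1 => /(_ isT); rewrite exprD.
  have : 0 <= x ^+ n * x ^+ 9 by rewrite mulr_ge0 ?exprn_ge0 // ltW.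
  move: (x ^+ n) (x ^+ 9) ((n + 9)%:R : R) => a b c h1 h2.
  have -> : c * a * (1 - x) * b = c * (a * b) * (1 - x) by ring.
  lra.
apply: (@squeeze_cvgr _ _ _ _ (fun=> 0) (fun n => B ^+ K * x ^+ n)).
- near=> n; rewrite mulr_ge0 ?exprn_ge0 ?ler0n ?(ltW rho0) //=.
  have -> : (n + 9)%:R ^+ K * rho ^+ n = ((n + 9)%:R * x ^+ n) ^+ K * x ^+ n.
    by rewrite -xK -exprM exprMn -exprM -mulrA -exprD; congr (_ * x ^+ _); rewrite mulSn addnC mulnC.
  rewrite ler_wpM2r ?exprn_ge0 ?(ltW x0) //; apply: lerXn2r; rewrite ?nnegrE //.
  by rewrite mulr_ge0 ?exprn_ge0 ?ler0n ?(ltW x0).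
- exact: cvg_cst.
rewrite -(mulr0 (B ^+ K)); apply: cvgM; first exact: cvg_cst.
by apply: cvg_expr; rewrite ger0_norm ?(ltW x0).
Unshelve. all: by end_near.
Qed.

Lemma expR_bound (a : R) : 0 < a -> expR (- a) <= a^-1.
Proof.
move=> a0; rewrite expRN lef_pV2 ?posrE ?expR_gt0 //.
by apply: le_trans (expR_ge1Dx a); rewrite lerDr.
Qed.

Fact half_arith (a r p N : R) : r != 0 -> N * (r * (p * (a / (2 * r)))) = a / 2 * (p * N).
Proof. by move=> r0; field. Qed.

Fact quarter_arith (a c z : R) : a != 0 -> c * z = a / 4 * (4 * c / a * z).
Proof. by move=> a0; field. Qed.

Fact budget_arith (r J k x z : R) : 2 * r * J * k * x * z = r * (J * (k * (2 * z))) * x.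
Proof. by ring. Qed.

Fact floor_arith (y L N : R) : N < 2 * y + L * (2 * y) -> 4 * y <= N -> N <= L * (4 * y).
Proof. by move=> h1 h2; lra. Qed.

Fact exponent_arith (a y1 y2 y3 y4 e : R) : y1 <= y2 -> a * y3 <= y4 -> y2 <= a / 4 * y3 ->
  a / 4 * e <= a / 4 * y3 -> y1 + a / 2 * y3 + - y4 <= - (a / 4 * e).
Proof. by move=> h1 h2 h3 h4; lra. Qed.

End Asymptotics.

(** * The two statements at the threshold *)

Section Threshold.
Variables (R : realType) (F : finFieldType) (l k : nat) (A : 'M[F]_(l, k)).
Hypotheses (l_gt0 : (0 < l)%N) (full_rank : \rank A = l) (cols : columns_condition A).
Variable n1 : nat.
Hypothesis irr : irredundant A n1.
Variable W : {set 'I_k}.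
Notation P := (null_basis A).
Notation D U := (\rank (rows_in P U)).
Notation w := #|W|.
Notation d := (D W).
Hypotheses (w3 : (3 <= w)%N) (dw : (1 < d < w)%N).
Hypothesis mE : m_F R A = (w.-1)%:R / (d.-1)%:R.
Hypothesis bal : forall U : {set 'I_k}, (2 <= #|U|)%N -> (d.-1 * #|U|.-1 <= w.-1 * (D U).-1)%N.
Hypothesis strict : forall U : {set 'I_k}, (1 < #|U| < w)%N -> (d.-1 * #|U|.-1 < w.-1 * (D U).-1)%N.
Notation q := (#|F|%:R : R).
(** [s ^+ n] is the quantity [eta] of the first-moment bounds; powers of it express both the number
    of points and the threshold. *)
Definition root_q : R := q `^ (w.-1%:R^-1).
Notation s := root_q.

Lemma q_gt1 : 1 < q.
Proof.
rewrite ltr1n; apply/card_gt1P; exists 0, 1; rewrite !inE; split => //.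
by rewrite eq_sym oner_eq0.
Qed.

Let w1 : (0 < w.-1)%N. Proof. by move: w3; case: w => [|[]]. Qed.

Lemma root_qX : s ^+ w.-1 = q.
Proof.
have q0 : 0 < q by apply: lt_trans q_gt1.
rewrite -powR_mulrn ?powR_ge0 // -powRrM mulVf ?powRr1 ?(ltW q0) //.
by rewrite pnatr_eq0 -lt0n.
Qed.

Lemma root_q_gt1 : 1 < s.
Proof.
rewrite ltNge; apply/negP => s1; have := exprn_ile1 w.-1 (powR_ge0 _ _) s1.
by rewrite root_qX leNgt q_gt1.
Qed.

Lemma root_qN n : (s ^+ n) ^+ w.-1 = (#|F| ^ n)%:R.
Proof. by rewrite exprAC root_qX natrX. Qed.

Lemma threshold_root n : q `^ (- (n%:R / m_F R A)) = (s ^+ n) ^- d.-1.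
Proof.
rewrite powRN -exprM -powR_mulrn ?powR_ge0 // -powRrM mE invf_div natrM.
congr (_ `^ _)^-1; ring.
Qed.

(** Makes the cost of a cheap step at most [1 / (2 * q)], so that a path of length [n] beats the
    [q ^+ n] choices of its start. *)
Definition small_const : R := (2 * q * w%:R ^+ 2)^-1.

Lemma small_const_bounds : [/\ 0 < small_const <= 1,
  w%:R ^+ 2 * small_const ^+ w.-1 <= (2 * q)^-1 & (2 * q)^-1 <= 1].
Proof.
have q1 := q_gt1.
have w1r : 1 <= w%:R ^+ 2 :> R by rewrite -natrX ler1n expn_gt0 (leq_trans _ w3).
have w0 : 0 < w%:R ^+ 2 :> R by apply: lt_le_trans w1r.
have q0' : 0 < q by lra.
have q0 : 0 < 2 * q by lra.
have c0 : 0 < small_const by rewrite invr_gt0 mulr_gt0.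
have c1 : small_const <= 1.
  have pos : 0 < 2 * q * w%:R ^+ 2 by rewrite mulr_gt0.
  have big : 1 <= 2 * q by lra.
  by rewrite /small_const invf_le1 // (le_trans w1r) // ler_peMl // ltW.
rewrite c0 c1; split => //; last by rewrite invf_le1 //; lra.
apply: le_trans (_ : w%:R ^+ 2 * small_const <= _).
  rewrite ler_pM2l // -[leRHS]expr1; apply: ler_wiXn2l => //; exact: ltW.
by rewrite /small_const invfM mulrCA mulfV ?mulr1 // gt_eqF.
Qed.

Lemma zero_statement r (p : nat -> R) : (2 <= r)%N -> (forall n, 0 <= p n <= 1) ->
  (\forall n \near \oo, p n <= small_const * q `^ (- (n%:R / m_F R A))) ->
  random_subset_prob (p n) (@rado F l k A r n) @[n --> \oo] --> (0 : R).
Proof.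
move=> r2 p01 ple; have [c01 gamle gamle1] := small_const_bounds.
have s1 := root_q_gt1; have s0 : 0 < s by apply: lt_trans s1.
pose rho : R := Num.max s^-1 2^-1.
have rho01 : 0 < rho < 1.
  by rewrite lt_max invr_gt0 s0 /= gt_max invf_lt1 // s1 invf_lt1 ?ltr1n.
(* At most eight unrestricted steps cost degree [w] each, and the choice of the path length costs
   one more. *)
pose K := (w * 8).+1.
pose cst : R := 50 * (2 * w)%:R ^+ (w * 8).
apply: (@squeeze_cvgr _ _ _ _ (fun=> 0) (fun n => cst * ((n + 9)%:R ^+ K * rho ^+ n))); last first.
- rewrite -(mulr0 cst); apply: cvgM; first exact: cvg_cst.
  exact: poly_geometric_cvg0.
- exact: cvg_cst.
near=> n; rewrite prob_ge0 //=.
have n0 : (0 < n)%N by near: n; exact: nbhs_infty_gt.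
apply: le_trans (prob_mono (p01 n) (fun S => @rado_noncolourable F l k A r n W S r2)) _.
pose Q := restricted_basis P W.
case/andP: (dw) => d1 ltdw.
have cim (U : {set 'I_w}) : #|enum_val @: U| = #|U| by rewrite card_imset //; exact: enum_val_inj.
have rkE U : rk Q U = D (enum_val @: U) by exact: rk_restricted.
have eta1 : 1 <= s ^+ n by rewrite exprn_ege1 // ltW.
have ple' : p n <= small_const * (s ^+ n) ^- d.-1.
  by rewrite -threshold_root; near: n.
have rk1 i : rk Q [set i] = 1%N by rewrite rkE imset_set1; apply: null_rank1 cols _.
have rk2 (U : {set 'I_w}) : #|U| = 2%N -> rk Q U = 2%N.
  by move=> U2; rewrite rkE; apply: (null_rank2 cols irr); rewrite cim.
have sb (U : {set 'I_w}) : (1 < #|U| < w)%N -> (d.-1 * #|U|.-1 < w.-1 * (rk Q U).-1)%N.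
  by move=> h; rewrite rkE -(cim U); apply: strict; rewrite cim.
have rkT : rk Q [set: 'I_w]%SET = d.
  rewrite rkE; congr (\rank (rows_in P _)); apply/setP => i.
  apply/imsetP/idP => [[j _ ->]|iW]; first exact: enum_valP.
  by exists (enum_rank_in iW i); rewrite ?inE // enum_rankK_in.
have gam1 : w%:R ^+ 2 * small_const ^+ w.-1 <= 1 :> R.
  exact: le_trans gamle gamle1.
apply: le_trans (@prob_noncolourable F w d n Q R (p n) small_const (s ^+ n) (p01 n) c01 eta1 n0 w3
  ltdw d1 (root_qN n) ple' rk1 rk2 sb rkT gam1) _.
case/andP: rho01 => rho0 rho1; case/andP: c01 => c0 _.
have e1 : (s ^+ n)^-1 <= rho ^+ n.
  rewrite -exprVn; apply: lerXn2r; rewrite ?nnegrE ?invr_ge0 ?(ltW s0) ?(ltW rho0) //.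
  by rewrite le_max lexx.
have e2 : (#|F| ^ n)%:R * (w%:R ^+ 2 * small_const ^+ w.-1) ^+ n <= rho ^+ n.
  rewrite natrX -exprMn; apply: lerXn2r; rewrite ?nnegrE ?(ltW rho0) //.
    by rewrite !mulr_ge0 ?exprn_ge0 ?ler0n ?(ltW c0).
  apply: le_trans (_ : q * (2 * q)^-1 <= _); first by rewrite ler_wpM2l ?ler0n.
  have q0 : q != 0 by rewrite gt_eqF // (lt_trans _ q_gt1).
  by rewrite invfM mulrCA mulfV // mulr1 le_max lexx orbT.
have e3 : (((2 * (w * (n + 9))) ^ w)%:R : R) ^+ 8 = (2 * w)%:R ^+ (w * 8) * (n + 9)%:R ^+ (w * 8).
  by rewrite mulnA natrX -exprM natrM exprMn.
have e4 : (25 * n.+1)%:R <= 25 * (n + 9)%:R :> R by rewrite natrM ler_wpM2l // ler_nat -addn1 leq_add2l.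
rewrite e3 /cst /K.
have G0 : 0 <= (2 * w)%:R ^+ (w * 8) :> R by rewrite exprn_ge0.
have H0 : 0 <= (n + 9)%:R ^+ (w * 8) :> R by rewrite exprn_ge0.
apply: le_trans (_ : 25 * (n + 9)%:R * ((2 * w)%:R ^+ (w * 8) * (n + 9)%:R ^+ (w * 8) * (rho ^+ n + rho ^+ n)) <= _).
  apply: ler_pM => //.
    by rewrite !mulr_ge0 // addr_ge0 ?invr_ge0 ?mulr_ge0 ?exprn_ge0 ?mulr_ge0 ?exprn_ge0 ?ler0n ?(ltW s0) ?(ltW c0).
  by rewrite ler_wpM2l ?mulr_ge0 // lerD.
have AC (g h x y : R) : 25 * y * (g * h * (x + x)) = 50 * g * (y * h * x) by ring.
by rewrite exprS AC.
Unshelve. all: by end_near.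
Qed.

(** The weak balance inequality, read in exponents of [s ^+ n], is exactly the codegree condition at
    the threshold density. *)
Lemma null_rank_bound n t (g : 'I_t -> 'I_k) : (0 < t)%N -> injective g ->
  (#|F| ^ n)%:R * ((#|F| ^ n) ^ (null_dim A - \rank (rowsub g P)))%:R <=
    ((s ^+ n) ^- d.-1) ^+ t.-1 * ((#|F| ^ n) ^ null_dim A)%:R :> R.
Proof.
move=> t0 ginj; have s1 := root_q_gt1; have s0 : 0 < s by apply: lt_trans s1.
set e := s ^+ n; have e1 : 1 <= e by rewrite exprn_ege1 // ltW.
have e0 : 0 < e by apply: lt_le_trans e1.
set U := (g @: 'I_t)%SET.
have cU : #|U| = t by rewrite card_imset // card_ord.
rewrite rank_rowsub -/U.
have DU : (0 < D U)%N.
  have gU : g (Ordinal t0) \in U by rewrite imset_f.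
  by rewrite -(null_rank1 cols (g (Ordinal t0))); apply: rank_rows_in_mono; rewrite finset.sub1set.
have DUd : (D U <= null_dim A)%N by exact: rank_leq_col.
have balU : (d.-1 * t.-1 <= w.-1 * (D U).-1)%N.
  have [t1|t2] := leqP t 1; last by rewrite -cU; apply: bal; rewrite cU.
  have -> : t.-1 = 0%N by case: (t) t1 => [|[]].
  by rewrite muln0.
have exE : (null_dim A - D U).+1 = (null_dim A - (D U).-1)%N.
  by case: (D U) DU DUd => // a _ h; rewrite -subSn // subSS.
rewrite -natrM -expnS exE natrX -(root_qN n) -/e natrX -(root_qN n) -/e.
rewrite exprVn mulrC -!exprM ler_pdivlMr ?exprn_gt0 // -exprD.
apply: ler_weXn2l; first exact: ltW.
have le : ((D U).-1 <= null_dim A)%N by apply: leq_trans (leq_pred _) DUd.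
rewrite -mulnDr leq_mul2l; apply/orP; right.
apply: leq_trans (leq_add (leqnn _) balU) _; rewrite -mulnDr (subnK le).
exact: leqnn.
Qed.

(** In units of [p n * N], the choice of fingerprints costs [a0 / 4], the generating function
    [a0 / 2], and avoiding the uncovered set gains [a0]; what remains is exponentially small. *)
Lemma one_statement r : (0 < r)%N -> exists2 C : R, 0 < C &
  forall p : nat -> R, (forall n, 0 <= p n <= 1) ->
    (\forall n \near \oo, C * q `^ (- (n%:R / m_F R A)) <= p n) ->
    random_subset_prob (p n) (@rado F l k A r n) @[n --> \oo] --> (1 : R).
Proof.
move=> r0; have [n0 ramsey] := mono_full_rank_solution 'I_r cols.
have /andP[dim2 dimk] := null_dims l_gt0 full_rank cols irr.
have k0 : (0 < k)%N by apply: leq_ltn_trans dimk.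
have d0 : (0 < null_dim A)%N by apply: leq_trans dim2.
have q1 := q_gt1; have q0 : 0 < q by apply: lt_trans q1.
have s1 := root_q_gt1; have s0 : 0 < s by apply: lt_trans s1.
pose gain : R := level_gain k ((k ^ k)%:R / ramsey_eps F (null_dim A) R r n0).
have gain0 : 0 < gain.
  by apply: level_gain_gt0; rewrite divr_gt0 ?ramsey_eps_gt0 // ltr0n expn_gt0 k0.
pose J := Num.Def.archi_bound gain^-1.
have Jbig : 1 < J%:R * gain.
  by rewrite -ltr_pdivrMr // div1r archi_boundP // invr_ge0 ltW.
have J0 : (0 : R) <= J%:R by rewrite ler0n.
(* The uncovered set has at least [N %/ (2 * #|F| ^ n0)] elements; the factor 4 absorbs the
   rounding. *)
pose a0 : R := (4 * q ^+ n0)^-1.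
have qn0 : 1 <= q ^+ n0 by rewrite exprn_ege1 // ltW.
have a00 : 0 < a0 by rewrite invr_gt0; lra.
have a01 : a0 <= 1 by rewrite invf_le1; lra.
have r1 : 1 <= r%:R :> R by rewrite ler1n.
(* Reduces the exponent [r * p n * x * N] to half of the gain. *)
pose x : R := a0 / (2 * r%:R).
have x0 : 0 < x by rewrite divr_gt0 //; lra.
have x1 : x <= 1 by rewrite ler_pdivrMr; lra.
pose c1 : R := 2 * r%:R * J%:R * k%:R * x^-1.
have c10 : 0 <= c1 by rewrite !mulr_ge0 ?ler0n ?invr_ge0 ?(ltW x0).
(* The first term makes [c1 * pi * N] at most [a0 / 4 * (p n * N)]; the 1 ensures that [p n * N] is
   at least [pi * N]. *)
pose C : R := 4 * c1 / a0 + 1.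
have C1 : 1 <= C by rewrite lerDr divr_ge0 ?(ltW a00) // mulr_ge0.
exists C; first by apply: lt_le_trans C1.
move=> p p01 ple.
pose h (n : nat) : R := 1 - 4 / a0 * s^-1 ^+ n.
apply: (@squeeze_cvgr _ _ _ _ h (fun=> 1)); last first.
- exact: cvg_cst.
- rewrite -[X in _ --> X](subr0 1) -(mulr0 (4 / a0)); apply: cvgB; first exact: cvg_cst.
  apply: cvgM; first exact: cvg_cst.
  apply: cvg_expr; rewrite ger0_norm ?invr_ge0 ?(ltW s0) // invf_lt1 //.
near=> n.
have /andP[p0 p1] := p01 n.
set e := s ^+ n; have e1 : 1 <= e by rewrite exprn_ege1 // ltW.
have e0 : 0 < e by apply: lt_le_trans e1.
(* Containers are always built at the threshold density [pi], so their fingerprint budget does not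
   grow with [p n]. *)
pose pi := e ^- d.-1; pose N : R := (#|F| ^ n)%:R.
have pile : C * pi <= p n by rewrite /pi -threshold_root; near: n.
have pi0 : 0 < pi by rewrite invr_gt0 exprn_gt0.
have pi1 : pi <= 1 by rewrite invf_le1 ?exprn_gt0 // exprn_ege1.
have N0 : 0 < N by rewrite ltr0n expn_gt0 -(ltr_nat R) q0.
have piN : e <= pi * N.
  rewrite /N -(root_qN n) -/e mulrC ler_pdivlMr ?exprn_gt0 // -exprS.
  by apply: ler_weXn2l => //; case/andP: (dw) => d1 ltdw; move: ltdw d1; case: d => // d' + _; case: w.
have piN1 : 1 <= pi * N by apply: le_trans piN.
pose b := (Num.Def.trunc (pi * N)).+1.
have /andP[bl br] := trunc_itv (le_trans ler01 piN1).
have pb : pi * N <= b%:R by exact: ltW.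
have b2 : b%:R <= 2 * (pi * N).
  have -> : b%:R = (Num.Def.trunc (pi * N))%:R + 1 :> R by rewrite natr1.
  by rewrite mulr2n mulrDl mul1r lerD.
have Xbig X : (X <= n)%N -> (X <= #|F| ^ n)%N.
  move=> Xn; apply: leq_trans Xn _; apply: ltnW; apply: ltn_expl.
  by rewrite -(ltr_nat R).
have Nbig : (4 * #|F| ^ (null_dim A * n0) * r * k ^ 2 <= #|F| ^ n)%N.
  by apply: Xbig; near: n; exact: nbhs_infty_ge.
have Nbig2 : (4 * #|F| ^ n0 <= #|F| ^ n)%N by apply: Xbig; near: n; exact: nbhs_infty_ge.
have rowd i j : i != j -> row i P != row j P.
  move=> nij; apply/eqP => eij.
  have [|/eqP] := @null_basis_pair F l k A n1 i j 1 (-1) cols irr nij.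
    by rewrite eij scaleN1r scale1r subrr.
  by rewrite oner_eq0.
have x01 : 0 < x <= 1 by rewrite x0 x1.
have pi01 : 0 < pi <= 1 by rewrite pi0 pi1.
have bound := @prob_not_ramsey F k (null_dim A) n P R pi pi01 (@null_rank_bound n) rowd r n0 b J
  r0 k0 d0 (null_row_neq0 cols) ramsey pb Jbig Nbig (fun S => ~~ @rado F l k A r n S) (p n) x (p01 n) x01
  (fun S => @not_rado_colouring F l k A r n S).
have tot := prob_compl (p n) (@rado F l k A r n).
have nn := prob_ge0 (p01 n) (fun S => ~~ @rado F l k A r n S).
apply/andP; split; last by rewrite -[leRHS]tot lerDl.
have radoE : random_subset_prob (p n) (@rado F l k A r n) =
    1 - random_subset_prob (p n) (fun S => ~~ @rado F l k A r n S).
  by apply/eqP; rewrite eq_sym subr_eq; apply/eqP; exact: (esym tot).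
rewrite radoE /h lerD2l lerN2.
apply: le_trans bound _.
set m := (r * (J * (k * b)))%N; set L := (_ %/ _)%N.
have Lle : a0 * N <= L%:R.
  have : (#|F| ^ n < L.+1 * (2 * #|F| ^ n0))%N.
    have F0 : (0 < #|F|)%N by rewrite -(ltr_nat R).
    by apply: ltn_ceil; rewrite muln_gt0 expn_gt0 F0.
  rewrite -(ltr_nat R) -/N [in X in _ -> X]/a0 mulSn natrD !natrM !natrX => lt1.
  have lt2 : 4 * q ^+ n0 <= N by rewrite -natrX -natrM ler_nat.
  have q4 : 0 < 4 * q ^+ n0 by rewrite mulr_gt0 ?exprn_gt0.
  by rewrite mulrC ler_pdivrMr //; apply: floor_arith.
have E1 : x ^- m <= expR (m%:R * x^-1).
  rewrite -exprVn expRM_natl; apply: lerXn2r; rewrite ?nnegrE ?invr_ge0 ?(ltW x0) ?expR_ge0 //.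
  by apply: le_trans (expR_ge1Dx _); rewrite lerDr.
have E2 : (1 + r%:R * (p n * x)) ^+ (#|F| ^ n) <= expR (N * (r%:R * (p n * x))).
  rewrite expRM_natl; apply: lerXn2r; rewrite ?nnegrE ?expR_ge0 ?expR_ge1Dx //.
  by rewrite addr_ge0 // !mulr_ge0 // ltW.
have E3 : (1 - p n) ^+ L <= expR (L%:R * - p n).
  rewrite expRM_natl; apply: lerXn2r; rewrite ?nnegrE ?expR_ge0 ?expR_ge1Dx //.
  by rewrite subr_ge0.
apply: le_trans (_ : expR (m%:R * x^-1) * expR (N * (r%:R * (p n * x))) * expR (L%:R * - p n) <= _).
  apply: ler_pM; rewrite ?exprn_ge0 ?mulr_ge0 ?invr_ge0 ?exprn_ge0 ?(ltW x0) ?subr_ge0 //.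
    by rewrite addr_ge0 // !mulr_ge0 // ltW.
  apply: ler_pM => //; rewrite ?invr_ge0 ?exprn_ge0 ?(ltW x0) //.
  by rewrite addr_ge0 // !mulr_ge0 // ltW.
rewrite -!expRD.
have M1 : m%:R * x^-1 <= c1 * (pi * N).
  rewrite /m /c1 !natrM.
  rewrite budget_arith.
  by rewrite ler_wpM2r ?invr_ge0 ?(ltW x0) // !ler_wpM2l ?ler0n.
have M2 : N * (r%:R * (p n * x)) = a0 / 2 * (p n * N).
  by apply: half_arith; rewrite pnatr_eq0 -lt0n.
have M3 : a0 * (p n * N) <= L%:R * p n by rewrite mulrCA mulrC ler_wpM2r.
have M4 : C * (pi * N) <= p n * N by rewrite mulrA ler_wpM2r // ltW.
have M5 : c1 * (pi * N) <= a0 / 4 * (p n * N).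
  have -> : c1 * (pi * N) = a0 / 4 * ((4 * c1 / a0) * (pi * N)) by apply: quarter_arith; rewrite gt_eqF.
  rewrite ler_wpM2l ?divr_ge0 ?(ltW a00) //; apply: le_trans M4; rewrite ler_wpM2r ?lerDl //.
  exact: le_trans ler01 piN1.
have M6 : e <= p n * N.
  apply: le_trans piN (le_trans _ M4); rewrite ler_peMl //; exact: le_trans ler01 piN1.
apply: le_trans (_ : expR (- (a0 / 4 * e)) <= _).
  rewrite ler_expR mulrN M2.
  have : a0 / 4 * e <= a0 / 4 * (p n * N) by rewrite ler_wpM2l ?divr_ge0 ?(ltW a00).
  exact: exponent_arith M1 M3 M5.
apply: le_trans (expR_bound _) _; first by rewrite mulr_gt0 ?divr_gt0.
by rewrite exprVn invfM invf_div.
Unshelve. all: by end_near.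
Qed.

End Threshold.

Theorem theorem5p4 (R : realType) (F : finFieldType) (l k : nat)
    (A : 'M[F]_(l, k)) (l_gt0 : (0 < l)%N)
    (full_rank : \rank A = l)
    (cols : columns_condition A)
    (irr : exists n0 : nat, forall n : nat, (n0 <= n)%N -> irredundant A n)
    (r : nat) (r_ge2 : (2 <= r)%N) :
  exists C c : R, [/\ 0 < C, 0 < c &
    forall p : nat -> R, (forall n, 0 <= p n <= 1) ->
      ((\forall n \near \oo,
          p n <= c * #|F|%:R `^ (- (n%:R / m_F R A))) ->
        random_subset_prob (p n) (@rado F l k A r n) @[n --> \oo] --> (0 : R))
      /\
      ((\forall n \near \oo,
          C * #|F|%:R `^ (- (n%:R / m_F R A)) <= p n) ->
        random_subset_prob (p n) (@rado F l k A r n) @[n --> \oo] --> (1 : R))].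
Proof.
have [n1 /(_ n1 (leqnn _)) irr1] := irr.
have [W [w3 dw mE bal strict]] := @critical_set R F l k A l_gt0 full_rank cols n1 irr1.
have [C C0 CP] := @one_statement R F l k A l_gt0 full_rank cols n1 irr1 W w3 dw mE bal r (ltnW r_ge2).
have [/andP[c0 _] _ _] := @small_const_bounds R F k W w3.
exists C, (small_const R F W); split => // p p01; split; last exact: CP.
exact: (@zero_statement R F l k A cols n1 irr1 W w3 dw mE strict r p r_ge2 p01).
Qed.
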